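(* Let $(J^s)_{s\in(1/2,1)}$ satisfy Hypotheses (H1) and (H2) below with constant $\delta>0$ and limit kernel $J^1$. Let $0\le k<m<M\le1$, $\eta>2+\delta$, $\theta=\frac{m-k}{m+d/2}$, $\varepsilon\in(0,1)$, and $u_0\in L^1_M\cap H^\eta$. Let $u^s_\varepsilon$ be the solution of $\partial_tu=\varepsilon^{-2s}(J^s_\varepsilon*u-u)+\mathrm{div}(xu)$ and $u_\varepsilon$ the solution of $\partial_tu=\varepsilon^{-2}(J^1_\varepsilon*u-u)+\mathrm{div}(xu)$, both with initial datum $u_0$. Then for every $T^*>0$ there exists $C=C(d,k,M,m,u_0)$ such that for all $t\in[0,T^*]$ $$\|u^s_\varepsilon(t)-u_\varepsilon(t)\|_{L^1_k}\le C(1-s)^\theta\big(1+\varepsilon^{\delta\theta}|\log\varepsilon|\big).$$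
   Context: $\langle x\rangle=(1+|x|^2)^{1/2}$; $\|f\|_{L^1_k}=\int\langle x\rangle^k|f|$; $H^\eta$ the $L^2$-Sobolev space; $\hat f(\xi)=\int e^{-ix\cdot\xi}f$; $J_\varepsilon(x)=\varepsilon^{-d}J(x/\varepsilon)$; solutions are mild solutions in $C([0,\infty);L^1_k)$. Hypothesis (H1): $(J^s)_{s\in(1/2,1)}$ is a family of probability densities on $\mathbb{R}^d$ with $J^s\in L^1\cap L^p$ for some $p\in(1,\infty]$, such that (i) $\int\min\{1,|y|^2\}J^s<\infty$; (ii) there exist $\delta,C_0>0$ independent of $s$ with $\hat J^s(\xi)=1-|\xi|^{2s}+R_s(\xi)$, $|R_s(\xi)|\le C_0|\xi|^{2s+\delta}$ for $|\xi|\le1$; (iii) there exist $C,R>0$, $\Psi$ with $\int(1+|x|^2)|\Psi|<\infty$, $\int x\Psi=0$, independent of $s$, with $J^s(x)\le C(1-s)|x|^{-d-2s}+\Psi(x)$ for $|x|\ge R$. Hypothesis (H2): $J^1$ is a probability density with $\hat J^1(\xi)=1-|\xi|^2+R_1(\xi)$, $|R_1(\xi)|\le C_0|\xi|^{2+\delta}$ for $|\xi|\le1$, and there is $\mathfrak C>0$ with $\left|\frac{1-\hat J^s(\xi)}{|\xi|^{2s}}-\frac{1-\hat J^1(\xi)}{|\xi|^2}\right|\le\mathfrak C(1-s)|\xi|^\delta\max(1,|\log|\xi||)$ for all $s\in(1/2,1)$, $\xi\in\mathbb{R}^d$. *)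

(* Defs.v *)
From HB Require Import structures.
From mathcomp Require Import all_boot all_order all_algebra.
From mathcomp Require Import all_classical all_reals all_analysis.
Set Implicit Arguments. Unset Strict Implicit. Unset Printing Implicit Defensive.
Import Order.TTheory GRing.Theory Num.Theory.
Import numFieldNormedType.Exports.
Local Open Scope classical_set_scope.
Local Open Scope ring_scope.

Section Rd.
Variable R : realType.

Definition dotp {d : nat} (x y : 'rV[R]_d) : R := \sum_(i < d) x 0 i * y 0 i.
Definition enorm {d : nat} (x : 'rV[R]_d) : R := Num.sqrt (dotp x x).
Definition jap {d : nat} (x : 'rV[R]_d) : R := Num.sqrt (1 + dotp x x).

Definition Borel (d : nat) := g_sigma_algebraType (@open ('rV[R]_d)).
Definition Bmeas {d : nat} (f : 'rV[R]_d -> R) : Prop :=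
  measurable_fun [set: Borel d] (f : Borel d -> R).

(* Lebesgue integral over R^d of an extended-real valued function, as the
   iterated one-dimensional Lebesgue integral (coincides with the integral
   w.r.t. d-dimensional Lebesgue measure for nonnegative Borel functions,
   by Tonelli). *)
Fixpoint iint (d : nat) : ('rV[R]_d -> \bar R) -> \bar R :=
  match d return ('rV[R]_d -> \bar R) -> \bar R with
  | 0 => fun f => f 0
  | d'.+1 => fun f =>
      (\int[@lebesgue_measure R]_(x in [set: R])
          iint (fun y : 'rV[R]_d' => f (row_mx (const_mx x : 'rV[R]_1) y)))%E
  end.

Definition integ {d : nat} (f : 'rV[R]_d -> R) : R :=
  fine (iint (fun x => (Num.max (f x) 0)%:E)) -
  fine (iint (fun x => (Num.max (- f x) 0)%:E)).

Definition integrable {d : nat} (f : 'rV[R]_d -> R) : Prop :=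
  Bmeas f /\ (iint (fun x => `|f x|%:E) < +oo)%E.

Definition L1k {d : nat} (k : R) (f : 'rV[R]_d -> R) : Prop :=
  Bmeas f /\ (iint (fun x => (`|f x| * jap x `^ k)%:E) < +oo)%E.
Definition L1k_norm {d : nat} (k : R) (f : 'rV[R]_d -> R) : R :=
  fine (iint (fun x => (`|f x| * jap x `^ k)%:E)).

Definition in_some_Lp {d : nat} (f : 'rV[R]_d -> R) : Prop :=
  (exists p : R, 1 < p /\ (iint (fun x => (`|f x| `^ p)%:E) < +oo)%E)
  \/ (exists c : R, iint (fun x => (\1_[set y | c < `|f y|] x)%:E) = 0%E).

Definition prob_density {d : nat} (f : 'rV[R]_d -> R) : Prop :=
  integrable f /\ (forall x, 0 <= f x) /\ integ f = 1.

Definition fourier_re {d : nat} (f : 'rV[R]_d -> R) (xi : 'rV[R]_d) : R :=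
  integ (fun x => cos (dotp x xi) * f x).
Definition fourier_im {d : nat} (f : 'rV[R]_d -> R) (xi : 'rV[R]_d) : R :=
  - integ (fun x => sin (dotp x xi) * f x).
Definition cmod (a b : R) : R := Num.sqrt (a ^+ 2 + b ^+ 2).

(* Sobolev space H^eta (for an integrable f, via its Fourier transform) *)
Definition in_H {d : nat} (eta : R) (f : 'rV[R]_d -> R) : Prop :=
  Bmeas f /\ (iint (fun x => (`|f x| ^+ 2)%:E) < +oo)%E /\
  (iint (fun xi => ((1 + dotp xi xi) `^ eta *
      (fourier_re f xi ^+ 2 + fourier_im f xi ^+ 2))%:E) < +oo)%E.

Definition resc {d : nat} (eps : R) (J : 'rV[R]_d -> R) (x : 'rV[R]_d) : R :=
  eps `^ (- (d%:R)) * J (eps^-1 *: x).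

Definition conv {d : nat} (f g : 'rV[R]_d -> R) (x : 'rV[R]_d) : R :=
  integ (fun y => f (x - y) * g y).

(* Mild solution in C([0,oo); L^1_k) of
     d_t u = a (K * u - u) + div(x u),   u(0) = u0,
   i.e. (Duhamel formula along the characteristics of div(x u))
     u(t,x) = e^{(d-a)t} u0(e^t x)
              + a int_0^t e^{(d-a)(t-tau)} (K * u(tau))(e^{t-tau} x) dtau
   for a.e. x, for every t >= 0. *)
Definition duhamel {d : nat} (a : R) (K u0 : 'rV[R]_d -> R)
    (u : R -> 'rV[R]_d -> R) (t : R) (x : 'rV[R]_d) : R :=
  expR ((d%:R - a) * t) * u0 (expR t *: x) +
  a * fine (\int[@lebesgue_measure R]_(tau in [set tau : R | (0 <= tau <= t)%R])
         (expR ((d%:R - a) * (t - tau)) *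
            conv K (u tau) (expR (t - tau) *: x))%:E)%E.

Definition mild_sol {d : nat} (k a : R) (K u0 : 'rV[R]_d -> R)
    (u : R -> 'rV[R]_d -> R) : Prop :=
  (forall t, 0 <= t -> L1k k (u t)) /\
  (forall t0, 0 <= t0 ->
     (fun t => L1k_norm k (fun x => u t x - u t0 x))
       @ (within (fun t => 0 <= t) (nbhs t0)) --> (0 : R)) /\
  (forall t, 0 <= t ->
     iint (fun x => `|u t x - duhamel a K u0 u t x|%:E) = 0%E).

Definition H1 {d : nat} (J : R -> 'rV[R]_d -> R) (delta C0 c Rr : R)
    (Psi : 'rV[R]_d -> R) : Prop :=
  0 < delta /\ 0 < C0 /\ 0 < c /\ 0 < Rr /\
  (forall s, 1/2 < s < 1 -> prob_density (J s) /\ in_some_Lp (J s)) /\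
  (forall s, 1/2 < s < 1 ->
     (iint (fun y => (Num.min 1 (dotp y y) * J s y)%:E) < +oo)%E) /\
  (forall s, 1/2 < s < 1 -> forall xi, enorm xi <= 1 ->
     cmod (fourier_re (J s) xi - (1 - enorm xi `^ (2 * s)))
          (fourier_im (J s) xi)
       <= C0 * enorm xi `^ (2 * s + delta)) /\
  (Bmeas Psi /\
   (iint (fun x => ((1 + dotp x x) * `|Psi x|)%:E) < +oo)%E /\
   (forall i : 'I_d, integ (fun x => x 0 i * Psi x) = 0) /\
   (forall s, 1/2 < s < 1 -> forall x, Rr <= enorm x ->
      J s x <= c * (1 - s) * enorm x `^ (- (d%:R) - 2 * s) + Psi x)).

Definition H2 {d : nat} (J : R -> 'rV[R]_d -> R) (J1 : 'rV[R]_d -> R)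
    (delta C0 cc : R) : Prop :=
  prob_density J1 /\
  (forall xi, enorm xi <= 1 ->
     cmod (fourier_re J1 xi - (1 - enorm xi ^+ 2)) (fourier_im J1 xi)
       <= C0 * enorm xi `^ (2 + delta)) /\
  0 < cc /\
  (forall s, 1/2 < s < 1 -> forall xi, xi != 0 ->
     cmod ((1 - fourier_re (J s) xi) / enorm xi `^ (2 * s)
             - (1 - fourier_re J1 xi) / enorm xi ^+ 2)
          ((- fourier_im (J s) xi) / enorm xi `^ (2 * s)
             - (- fourier_im J1 xi) / enorm xi ^+ 2)
       <= cc * (1 - s) * enorm xi `^ delta * Num.max 1 `|ln (enorm xi)|).

End Rd.

(* Main.v *)
(* Along the characteristics of div(xu) the Fourier transform of a solution solves the linear ODE
   d/dt u^(t, e^t z) = - alpha(e^t z) u^(t, e^t z), alpha = a (1 - K^), Re alpha >= 0.  By (H2) the two symbols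
   differ by at most C (1-s) (1 + eps^delta |ln eps|) (1 + |xi|^2)^(eta/2), so for u0 in H^eta the difference of the
   two solutions is O(Q) in L^2, Q = (1-s) (1 + eps^delta |ln eps|).  Moments of order m < M are bounded uniformly
   in s and eps: by Gronwall, the integral of (1 - cos(x.xi)) |u(t)| is controlled by that of u0 plus C |xi|^(2s)
   (resp. |xi|^2), and summing over dyadic xi recovers |x|^m.  Cutting at <x> = rho = Q^(-1/(m + d/2)) balances the
   L^2 and the L^1_m contributions to the L^1_k norm, which gives Q^theta.  Plancherel is replaced by duality with
   the tensorized Cauchy kernel, a positive approximate identity whose Fourier transform is bounded by 1. *)
Require Import Defs.
From HB Require Import structures.
From mathcomp Require Import all_boot all_order all_algebra.
From mathcomp Require Import all_classical all_reals all_analysis.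
From mathcomp Require Import measurable_realfun ring lra.
Set Implicit Arguments. Unset Strict Implicit. Unset Printing Implicit Defensive.
Import Order.TTheory GRing.Theory Num.Theory.
Import numFieldNormedType.Exports.
Local Open Scope classical_set_scope.
Local Open Scope ring_scope.

(** The rate [a = eps^(-2s)] blows up as eps tends to 0, so no estimate may lose a factor depending
    on [a]: the Gronwall factor e^(a t) is cancelled by the damping e^(- a t) of Duhamel's formula,
    and what remains is a (1 - K^), which scaling bounds by B |xi|^(2s) independently of eps. A mild
    solution satisfies Duhamel's formula only for almost every x, and [conv] takes a default value
    where its integral diverges; hence everything is drawn from one identity, [weak_form], tested
    with bounded functions: cos and sin give the Fourier ODE, the sign of the solution times 1 or 1
    - cos(x.xi) gives mass and moments. Membership in L^1_k says nothing about moments of order m >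
    k, so these are bounded on balls first. The gap m < M makes the dyadic series geometric with
    ratio 2^(m - M), and M <= 1 < 2s lets |xi|^(2s) be replaced by |xi|^M for |xi| <= 1. The gap 2 +
    delta < eta leaves a spare power of |xi| that absorbs the logarithms of (H2). *)

(** * Lebesgue measure on R^d *)

Notation row_cons x y := (row_mx (const_mx x : 'M[_]_(1, 1)) (y : 'M[_]_(1, _))).

Section measurability.
Variable R : realType.

Lemma open_borel d (A : set 'rV[R]_d) : open A -> measurable (A : set (Borel R d)).
Proof. by move=> oA; apply: sub_sigma_algebra. Qed.

Lemma continuous_borel d (f : 'rV[R]_d -> R) : continuous f ->
  measurable_fun [set: Borel R d] (f : Borel R d -> R).
Proof.
move=> cf; apply: (@measurability _ _ (Borel R d) (measurableTypeR R) setT f _ (RGenOInfty.measurableE R)).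
move=> _ [_ [a ->] <-]; rewrite setTI; apply: open_borel.
have /continuousP := cf; apply; exact: interval_open.
Qed.

Lemma measurable_coord d (i : 'I_d) :
  measurable_fun [set: Borel R d] (fun x : Borel R d => (x : 'rV[R]_d) 0 i).
Proof. exact: (continuous_borel (@coord_continuous _ _ _ _ _)). Qed.

(** Every open set is the union of the cubes inside it with rational centre and half-side 1/(n+1).
    These are countably many, and each pulls back to a finite intersection of coordinate
    conditions. *)
Lemma measurable_fun_rV d0 (T : measurableType d0) d (g : T -> 'rV[R]_d) :
  (forall i, measurable_fun [set: T] (fun t => g t 0 i)) ->
  measurable_fun [set: T] (g : T -> Borel R d).
Proof.
move=> mg; apply: (@measurability _ _ T (Borel R d) setT g (@open 'rV[R]_d)) => //.
move=> _ [U oU <-]; rewrite setTI.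
pose Q := ('rV[rat]_d * nat)%type.
pose c (q : Q) : 'rV[R]_d := \row_i ratr (q.1 0 i).
pose A (q : Q) : set 'rV[R]_d := [set x | forall i, `|c q 0 i - x 0 i| < q.2.+1%:R^-1].
have mA q : measurable (g @^-1` A q).
  rewrite (_ : g @^-1` A q = \bigcap_(i in [set: 'I_d])
     (fun t => `|c q 0 i - g t 0 i|) @^-1` `]-oo, q.2.+1%:R^-1[%classic).
    apply: fin_bigcap_measurable => // i _.
    rewrite -[X in measurable X]setTI; apply: (_ : measurable_fun setT _) => //.
    apply: measurableT_comp => //; apply: measurable_funB => //.
  apply/seteqP; split => t /=.
    by move=> h i _ /=; rewrite in_itv /=.
  by move=> h i; have := h i I; rewrite /= in_itv.
rewrite (_ : g @^-1` U = \bigcup_n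
  (if unpickle n is Some q then if `[< A q `<=` U >] then g @^-1` A q else set0 else set0)).
  apply: bigcupT_measurable => n; case: unpickle => // q; case: ifP => // _; exact: mA.
apply/seteqP; split => t /=; last first.
  move=> [n _]; case: unpickle => // q; case: ifPn => // /asboolP AU; exact: AU.
move=> Ut; have := open_nbhs_nbhs (conj oU Ut).
move=> /nbhs_ballP [e /= e0 eU].
(* Two radii must fit in the ball: a point of a cube whose centre is within 1/(k+1) of [g t] lies
   within 2/(k+1) < e of [g t]. *)
have [k ke] : exists k : nat, k.+1%:R^-1 < e / 2.
  have e2 : 0 < e / 2 by rewrite divr_gt0.
  exists (Num.trunc (e / 2)^-1); rewrite invf_plt ?posrE //; exact: truncnS_gt.
have Hq : forall i, exists q : rat, `|ratr q - g t 0 i| < k.+1%:R^-1.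
  move=> i; have := @rat_in_itvoo R (g t 0 i - k.+1%:R^-1) (g t 0 i + k.+1%:R^-1).
  rewrite ltrBlDr -addrA ltrDl -mulr2n pmulrn_lgt0 ?invr_gt0 ?ltr0n //.
  move=> /(_ isT)[q]; rewrite in_itv /= => /andP[h1 h2]; exists q.
  by rewrite ltr_norml ltrBlDl h2 andbT ltrBrDr addrC.
pose q : 'rV[rat]_d := \row_i xchoose (Hq i).
exists (pickle (q, k)) => //; rewrite pickleK.
have cq i : `|c (q, k) 0 i - g t 0 i| < k.+1%:R^-1.
  by rewrite /c !mxE /=; exact: (xchooseP (Hq i)).
rewrite ifT; first exact: cq.
apply/asboolP => x Ax; apply: eU; split => // i j; rewrite ord1.
rewrite /ball /= -(subrKA (c (q, k) 0 j)) (splitr e).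
rewrite (le_lt_trans (ler_normD _ _))// ltrD// (lt_trans _ ke)//.
  by rewrite distrC; exact: cq.
Qed.

Lemma measurable_row_mx d : measurable_fun [set: measurableTypeR R * Borel R d]
  (fun p : measurableTypeR R * Borel R d =>
    (row_cons p.1 p.2) : Borel R d.+1).
Proof.
apply: (@measurable_fun_rV _ _ d.+1) => i.
rewrite -(@splitK 1 d i); case: (@fintype.split 1 d i) => j /=.
  rewrite (_ : (fun _ => _) = fst) //; apply/funext => t.
  by rewrite (@row_mxEl R 1 1 d) mxE.
rewrite (_ : (fun _ => _) = (fun t => (t.2 : 'rV_d) 0 j)); last first.
  by apply/funext => t; rewrite (@row_mxEr R 1 1 d).
apply: (@measurableT_comp _ _ _ _ _ _ (fun x : Borel R d => x 0 j)) => //.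
exact: measurable_coord.
Qed.

Definition hd d (z : 'rV[R]_d.+1) : R := z 0 0.
Definition tl d (z : 'rV[R]_d.+1) : 'rV[R]_d := @rsubmx R 1 1 d z.

Lemma measurable_hd d : measurable_fun [set: Borel R d.+1] (@hd d : Borel R d.+1 -> measurableTypeR R).
Proof. exact: measurable_coord. Qed.

Lemma measurable_tl d : measurable_fun [set: Borel R d.+1] (@tl d : Borel R d.+1 -> Borel R d).
Proof.
apply: measurable_fun_rV => i; under eq_fun do rewrite /tl mxE.
exact: measurable_coord.
Qed.

Lemma hd_row d (x : R) (y : 'rV[R]_d) : hd (row_cons x y) = x.
Proof.
rewrite /hd (_ : 0 = @lshift 1 d 0); last exact/val_inj.
by rewrite (@row_mxEl R 1 1 d) mxE.
Qed.

Lemma row_hd_tl d (z : 'rV[R]_d.+1) :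
  row_cons (hd z) (tl z) = z.
Proof.
rewrite -[RHS](@hsubmxK R 1 1 d); congr row_mx.
by apply/rowP => i; rewrite !mxE ord1; congr (z _ _); apply/val_inj.
Qed.

End measurability.

Section mu.
Variable R : realType.
Local Open Scope ereal_scope.

Lemma sigma_finite_prod d1 d2 (T1 : measurableType d1) (T2 : measurableType d2)
    (m1 : {sigma_finite_measure set T1 -> \bar R})
    (m2 : {sigma_finite_measure set T2 -> \bar R}) : sigma_finite setT (m1 \x m2).
Proof.
have /sigma_finiteP[F [TF ndF Foo]] := sigma_finiteT m1.
have /sigma_finiteP[G [TG ndG Goo]] := sigma_finiteT m2.
exists (fun n => F n `*` G n).
  rewrite -setXTT TF TG; apply/seteqP; split => -[x y] /=; last first.
    by move=> [n _ []/= ? ?]; split; exists n.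
  move=> [[n _ Fx] [k _ Gy]]; exists (maxn n k) => //; split => /=.
    by move: x Fx; exact/subsetPset/ndF/leq_maxl.
  by move: y Gy; exact/subsetPset/ndG/leq_maxr.
move=> k; have [? ?] := Foo k; have [? ?] := Goo k.
split; first exact: measurableX.
by rewrite product_measure1E// lte_mul_pinfty// ge0_fin_numE.
Qed.

(** [iint] is only an iterated integral; convergence theorems and Fubini need a measure behind it.
    In dimension 0 this is a Dirac mass, in dimension d+1 the image of Lebesgue measure times the
    previous one under prepending a coordinate. For nonnegative functions Tonelli then identifies
    the two integrals. *)
Lemma mu_ex d : exists m : {sigma_finite_measure set (Borel R d) -> \bar R},
  forall f : Borel R d -> \bar R, measurable_fun setT f -> (forall x, 0 <= f x) ->
    \int[m]_x f x = iint f.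
Proof.
elim: d => [|d [m hm]].
  exists (@dirac _ (Borel R 0) (0%R : 'rV[R]_0) R) => f mf f0.
  by rewrite integral_dirac // diracT mul1e.
pose phi := fun p : measurableTypeR R * Borel R d =>
    (row_cons p.1 p.2) : Borel R d.+1.
have mphi : measurable_fun setT phi := @measurable_row_mx R d.
pose MM : {measure set (Borel R d.+1) -> \bar R} :=
  [the measure _ _ of pushforward ((@lebesgue_measure R) \x m) phi].
pose M := MM mphi.
pose psi := fun z : Borel R d.+1 => (hd z, tl z) : measurableTypeR R * Borel R d.
have mpsi : measurable_fun setT psi.
  by apply: measurable_fun_pair; [exact: measurable_hd|exact: measurable_tl].
(* [phi] is a bijection with measurable inverse [psi], so an exhausting sequence of the product is
   carried over by [psi]. *)
have sM : sigma_finite setT M.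
  have [F FT Ff] : sigma_finite setT ((@lebesgue_measure R) \x m) by exact: sigma_finite_prod.
  exists (fun n => psi @^-1` F n).
    by rewrite -preimage_bigcup -FT preimage_setT.
  move=> n; have [mF Fn] := Ff n; split.
    by rewrite -[X in measurable X]setTI; exact: mpsi.
  rewrite /M /= /pushforward (_ : phi @^-1` (psi @^-1` F n) = F n) //.
  rewrite -comp_preimage (_ : psi \o phi = id) //.
  apply/funext => -[x y]; rewrite /psi /phi /= /hd /tl row_mxKr; congr pair.
  exact: hd_row.
pose M' : {sigma_finite_measure set (Borel R d.+1) -> \bar R} :=
  HB.pack_for (sigma_finite_measure (Borel R d.+1) R) (M : set _ -> _)
   (Measure.class M) (@Measure_isSigmaFinite.Build _ (Borel R d.+1) R M sM).
exists M' => f mf f0.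
rewrite [LHS](_ : _ = \int[M]_x f x) // ge0_integral_pushforward //.
have mfp := measurableT_comp mf mphi.
rewrite preimage_setT (@fubini_tonelli1 _ _ _ _ R (@lebesgue_measure R) m (f \o phi) mfp) //; last by move=> x; exact: f0.
rewrite /fubini_F /=; apply: eq_integral => x _.
by rewrite hm //; apply: (measurableT_comp mf); exact: (measurableT_comp mphi (pair1_measurable x)).
Qed.

Definition mu d : {sigma_finite_measure set (Borel R d) -> \bar R} := sval (cid (mu_ex d)).

Lemma integral_mu d (f : 'rV[R]_d -> \bar R) : measurable_fun setT (f : Borel R d -> _) ->
  (forall x, 0 <= f x) -> \int[mu d]_x f x = iint f.
Proof. exact: (svalP (cid (mu_ex d))). Qed.

Lemma integral_muS d (f : 'rV[R]_d.+1 -> \bar R) : measurable_fun setT (f : Borel R d.+1 -> _) ->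
  (forall x, 0 <= f x) ->
  \int[mu d.+1]_x f x = \int[@lebesgue_measure R]_x \int[mu d]_y f (row_cons x y).
Proof.
move=> mf f0; rewrite integral_mu //=; apply: eq_integral => x _; rewrite integral_mu //.
apply: (measurableT_comp mf).
exact: (measurableT_comp (@measurable_row_mx R d) (pair1_measurable x)).
Qed.

End mu.

Section change_of_variables.
Variable R : realType.
Local Open Scope ereal_scope.
Local Notation leb := (@lebesgue_measure R).

(** The image of Lebesgue measure under x -> r x + a, multiplied by r, gives every interval ]p, q]
    its length, and Lebesgue measure is the only measure doing so. *)
Lemma lebesgue_integral_scale (r a : R) (f : R -> \bar R) : (0 < r)%R ->
  measurable_fun setT f -> (forall x, 0 <= f x) ->
  \int[leb]_x f (r * x + a)%R = (r^-1)%:E * \int[leb]_x f x.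
Proof.
move=> r0 mf f0.
pose phi (x : measurableTypeR R) : measurableTypeR R := (r * x + a)%R.
have mphi : measurable_fun setT phi.
  by apply: measurable_funD => //; exact: measurable_funM.
have key : forall A, measurable A -> leb A = mscale (NngNum (ltW r0)) (pushforward leb phi) A.
  move=> mf' A mA.
  apply: (@lebesgue_measure_unique R (mscale (NngNum (ltW r0)) (pushforward leb phi))) => //.
  move=> _ [[p q]] _ <-.
  change (leb `]p, q] = r%:E * leb (phi @^-1` `]p, q])).
  rewrite (_ : phi @^-1` _ = `](p - a) / r, (q - a) / r]%classic)%R; last first.
    apply/seteqP; split => x /=; rewrite !in_itv /= /phi ltr_pdivrMr// ler_pdivlMr// [(x * r)%R]mulrC;
    by move=> /andP[h1 h2]; apply/andP; split; lra.
  rewrite !lebesgue_measure_itv /= !lte_fin ltr_pM2r ?invr_gt0// ltrD2r.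
  case: ifP => _; last by rewrite mule0.
  by rewrite -EFinM -!EFinD; congr EFin; field; rewrite gt_eqF.
have h : \int[leb]_x f (phi x) = \int[pushforward leb phi]_x f x.
  by rewrite ge0_integral_pushforward.
rewrite h (_ : \int[leb]_x f x = \int[mscale (NngNum (ltW r0)) (pushforward leb phi)]_x f x); last first.
  by apply: eq_measure_integral => A mA _; exact: key.
rewrite ge0_integral_mscale // muleA -EFinM /= mulVf ?gt_eqF// mul1e //.
Qed.

Lemma lebesgue_integral_opp (f : R -> \bar R) :
  measurable_fun setT f -> (forall x, 0 <= f x) ->
  \int[leb]_x f (- x)%R = \int[leb]_x f x.
Proof.
move=> mf f0.
rewrite (_ : \int[leb]_x f x = \int[pushforward leb (-%R : measurableTypeR R -> measurableTypeR R)]_x f x); last first.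
  by apply: eq_measure_integral => A mA _; exact/esym/lebesgue_measureN.
by rewrite ge0_integral_pushforward//; exact: oppr_measurable.
Qed.

Lemma lebesgue_integral_aff (r a : R) (f : R -> \bar R) : (r != 0)%R ->
  measurable_fun setT f -> (forall x, 0 <= f x) ->
  \int[leb]_x f (r * x + a)%R = (`|r|^-1)%:E * \int[leb]_x f x.
Proof.
move=> r0 mf f0; case: (ltrgtP r 0%R) r0 => // rs _.
  rewrite -lebesgue_integral_opp; last 2 first.
  - apply: (measurableT_comp mf); apply: measurable_funD => //; exact: measurable_funM.
  - by [].
  under eq_integral do rewrite mulrN -mulNr.
  by rewrite (@lebesgue_integral_scale (- r)%R) ?oppr_gt0// ltr0_norm.
by rewrite lebesgue_integral_scale// gtr0_norm.
Qed.

Lemma lebesgue_integral_affZ (c r a : R) (f : R -> \bar R) : (r != 0)%R -> (0 <= c)%R ->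
  measurable_fun setT f -> (forall x, 0 <= f x) ->
  \int[leb]_x (c%:E * f (r * x + a)%R) = (c * `|r|^-1)%:E * \int[leb]_x f x.
Proof.
move=> r0 c0 mf f0.
have maff : measurable_fun setT (fun x : R => (r * x + a)%R).
  by apply: measurable_funD => //; exact: measurable_funM.
rewrite ge0_integralZl_EFin //; last exact: (measurableT_comp mf maff).
by rewrite lebesgue_integral_aff // muleA EFinM.
Qed.

Lemma measurable_row_integral d (f : Borel R d.+1 -> \bar R) :
  measurable_fun setT f -> (forall x, 0 <= f x) ->
  measurable_fun setT (fun x : measurableTypeR R => \int[mu R d]_y f (row_cons x y)).
Proof.
move=> mf f0.
apply: (@measurable_fun_fubini_tonelli_F _ _ _ _ _ (mu R d) _
   (measurableT_comp mf (@measurable_row_mx R d))) => x; exact: f0.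
Qed.

Lemma measurable_aff d (r : R) (a : 'rV[R]_d) :
  measurable_fun setT (fun x : Borel R d => (r *: (x : 'rV_d) + a)%R : Borel R d).
Proof.
apply: measurable_fun_rV => i; under eq_fun do rewrite !mxE.
by apply: measurable_funD => //; apply: measurable_funM => //; exact: measurable_coord.
Qed.

(** Peeling off the first coordinate applies the one-dimensional formula once per dimension. The
    sign of [r] is free: [r = -1] serves for the reflection y -> x - y. *)
Lemma integral_aff d (r : R) (a : 'rV[R]_d) (f : Borel R d -> \bar R) : (r != 0)%R ->
  measurable_fun setT f -> (forall x, 0 <= f x) ->
  \int[mu R d]_x f (r *: (x : 'rV_d) + a)%R = ((`|r|^-1) ^+ d)%:E * \int[mu R d]_x f x.
Proof.
move=> r0; elim: d a f => [|d IH] a f mf f0.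
  rewrite expr0 mul1e; apply: eq_integral => x _; congr f.
  by rewrite [LHS](thinmx0) [RHS](thinmx0).
have mfa := measurableT_comp mf (measurable_aff r a).
rewrite integral_muS //.
rewrite integral_muS //.
pose G (x : measurableTypeR R) : \bar R := \int[mu R d]_y f (row_cons x y).
have mG : measurable_fun setT G by exact: measurable_row_integral.
have G0 x : 0 <= G x by exact: integral_ge0.
transitivity (\int[leb]_x ((`|r|^-1 ^+ d)%:E * G (r * x + hd a)%R)).
  apply: eq_integral => x _; rewrite -(IH (tl a)) //; last first.
    apply: (measurableT_comp mf).
    exact: (measurableT_comp (@measurable_row_mx R d) (pair1_measurable _)).
  apply: eq_integral => y _; congr f.
  rewrite -{1}(row_hd_tl a) (@scale_row_mx R 1 1 d) (@add_row_mx R 1 1 d); apply: (congr2 (@row_mx R 1 1 d)) => //.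
  by apply/rowP => i; rewrite !mxE.
by rewrite lebesgue_integral_affZ ?exprn_ge0 ?invr_ge0// mulrC -exprS.
Qed.

End change_of_variables.

(** * Real-valued integrable functions and Fubini's theorem *)

Notation Lint m f := (m.-integrable setT (EFin \o f)).

Lemma le_of_eq {R : numDomainType} (x y : R) : x = y -> x <= y.
Proof. by move=> ->. Qed.

Lemma max0_ge0 {R : realDomainType} (x : R) : 0 <= Num.max x 0.
Proof. by rewrite le_max lexx orbT. Qed.

Section Lint.
Context {d0 : measure_display} {T : measurableType d0} {R : realType}.
Variable m : {measure set T -> \bar R}.
Implicit Types f g h : T -> R.

Lemma Lint_meas f : Lint m f -> measurable_fun setT f.
Proof. by move=> /measurable_int /measurable_EFinP. Qed.

Lemma LintP f : Lint m f <-> measurable_fun setT f /\ (\int[m]_x `|f x|%:E < +oo)%E.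
Proof.
split=> [fi|[mf fi]]; first by split; [exact: Lint_meas|case/integrableP : fi].
by apply/integrableP; split => //; exact/measurable_EFinP.
Qed.

Lemma Lint_le g f : measurable_fun setT f -> (forall x, `|f x| <= g x) ->
  Lint m g -> Lint m f.
Proof.
move=> mf fg; apply: le_integrable => //; first exact/measurable_EFinP.
by move=> x _ /=; rewrite lee_fin (le_trans (fg x)) ?ler_norm.
Qed.

Lemma Lint_norm f : Lint m f -> Lint m (fun x => `|f x|).
Proof. exact: integrable_norm. Qed.

Lemma LintD f g : Lint m f -> Lint m g -> Lint m (fun x => f x + g x).
Proof.
move=> fi gi; have := integrableD measurableT fi gi.
by apply: eq_integrable.
Qed.

Lemma LintB f g : Lint m f -> Lint m g -> Lint m (fun x => f x - g x).
Proof.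
move=> fi gi; have := integrableB measurableT fi gi.
by apply: eq_integrable.
Qed.

Lemma LintZ c f : Lint m f -> Lint m (fun x => c * f x).
Proof.
move=> fi; have := integrableZl measurableT c fi.
by apply: eq_integrable.
Qed.

Lemma Lint_bddM (c : R) h f : measurable_fun setT h -> (forall x, `|h x| <= c) ->
  Lint m f -> Lint m (fun x => h x * f x).
Proof.
move=> mh hc fi; apply: (@Lint_le (fun x => c * `|f x|)).
- by apply: measurable_funM => //; exact: Lint_meas.
- by move=> x; rewrite normrM ler_wpM2r.
- by apply: LintZ; exact: Lint_norm.
Qed.

Lemma le_Rint f g : Lint m f -> Lint m g -> (forall x, f x <= g x) ->
  \int[m]_x f x <= \int[m]_x g x.
Proof. by move=> fi gi fg; apply: le_Rintegral. Qed.

Lemma norm_Rint_le f g : Lint m g -> measurable_fun setT f -> (forall x, `|f x| <= g x) ->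
  `|\int[m]_x f x| <= \int[m]_x g x.
Proof.
move=> gi mf fg; have fi : Lint m f by exact: Lint_le gi.
apply: le_trans (le_normr_Rintegral measurableT fi) _.
by apply: le_Rint => //; exact: Lint_norm.
Qed.

Lemma RintE f : Lint m f -> (\int[m]_x (f x)%:E)%E = (\int[m]_x f x)%:E.
Proof. by move=> fi; rewrite /Rintegral fineK//; exact: integrable_fin_num. Qed.

Lemma Rint_ae_eq f g : measurable_fun setT f -> measurable_fun setT g ->
  {ae m, forall x, f x = g x} -> \int[m]_x f x = \int[m]_x g x.
Proof.
move=> mf mg fg; congr fine; apply: ae_eq_integral => //.
- exact/measurable_EFinP.
- exact/measurable_EFinP.
- by apply: filterS fg => x -> _.
Qed.

Lemma Rint_eq0_ae f : measurable_fun setT f -> (\int[m]_x `|f x|%:E = 0)%E ->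
  {ae m, forall x, f x = 0}.
Proof.
move=> mf f0; have /ae_eq_integral_abs : measurable_fun setT (EFin \o f) by exact/measurable_EFinP.
move=> /(_ m measurableT)[+ _] => /(_ f0); apply: filterS => x /= /(_ I) [].
by [].
Qed.

Lemma Lint_pos f : Lint m f -> Lint m (fun x => Num.max (f x) 0).
Proof.
move=> fi; apply: (Lint_le _ _ (Lint_norm fi)); first exact: measurable_maxr (Lint_meas fi) _.
by move=> x; rewrite ger0_norm ?le_max ?lexx ?orbT// ge_max ler_norm normr_ge0.
Qed.

Lemma Lint_neg f : Lint m f -> Lint m (fun x => Num.max (- f x) 0).
Proof.
move=> fi; apply: Lint_pos; have := LintZ (-1) fi.
by apply: eq_integrable => // x _; rewrite /= mulN1r.
Qed.

Lemma Rint_posneg f : Lint m f ->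
  \int[m]_x f x = \int[m]_x Num.max (f x) 0 - \int[m]_x Num.max (- f x) 0.
Proof.
move=> fi; have pi := Lint_pos fi; have ni := Lint_neg fi.
rewrite -RintegralB//; apply: eq_Rintegral => x _; rewrite /= /Num.max.
by case: ifPn; case: ifPn; rewrite ?oppr_lt0 -?leNgt ?subr0 ?sub0r ?opprK //; lra.
Qed.

End Lint.

Arguments Lint_bddM {d0 T R} m c h f.

(** An integrable extended-valued function is finite almost everywhere, so the default 0 that [fine]
    gives to infinities is invisible to the integral. This keeps the inner integrals of Fubini
    real-valued. *)
Lemma fine_Lint {R : realType} d (T : measurableType d) (m : {measure set T -> \bar R}) (F : T -> \bar R) :
  m.-integrable setT F -> Lint m (fine \o F) /\
  \int[m]_x fine (F x) = fine (\int[m]_x F x)%E.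
Proof.
move=> Fi; have mF := measurable_int _ Fi.
have mF' : measurable_fun setT (fine \o F) by exact: measurableT_comp.
split.
  apply: le_integrable Fi => //; first exact/measurable_EFinP.
  by move=> x _ /=; case: (F x) => //= *; rewrite ?normr0 ?leey.
congr fine; apply: ae_eq_integral => //; first exact/measurable_EFinP.
apply: filterS (integrable_ae measurableT Fi) => x /= h _.
by rewrite fineK// h.
Qed.

Section Lint_prod.
Context {d1 d2 : measure_display} {T1 : measurableType d1} {T2 : measurableType d2}
  {R : realType}.
Variables (m1 : {sigma_finite_measure set T1 -> \bar R})
  (m2 : {sigma_finite_measure set T2 -> \bar R}).
Lemma Lint_prod (f : T1 * T2 -> R) : measurable_fun setT f ->
  (\int[m1]_x \int[m2]_y `|f (x, y)|%:E < +oo)%E -> Lint (m1 \x m2)%E f.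
Proof.
move=> mf h; apply/(@integrable12ltyP _ _ _ _ _ m1 m2); first exact/measurable_EFinP.
exact: h.
Qed.

Lemma Lint_prod2 (f : T1 * T2 -> R) : measurable_fun setT f ->
  (\int[m2]_y \int[m1]_x `|f (x, y)|%:E < +oo)%E -> Lint (m1 \x m2)%E f.
Proof.
move=> mf h; apply/(@integrable21ltyP _ _ _ _ _ m1 m2); first exact/measurable_EFinP.
exact: h.
Qed.

End Lint_prod.

Section Rfubini.
Context {d1 d2 : measure_display} {T1 : measurableType d1} {T2 : measurableType d2}
  {R : realType}.
Variables (m1 : {sigma_finite_measure set T1 -> \bar R})
  (m2 : {sigma_finite_measure set T2 -> \bar R}).
Variable f : T1 * T2 -> R.
Hypothesis fi : Lint (m1 \x m2)%E f.

Lemma Rfubini1 : Lint m1 (fun x => \int[m2]_y f (x, y)) /\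
  \int[m1]_x (\int[m2]_y f (x, y)) = \int[(m1 \x m2)%E]_z f z.
Proof.
have [h1 h2] := fine_Lint (integrable_fubini_F fi).
split; first exact: h1.
by rewrite [LHS]h2 integral12_prod_meas1.
Qed.

Lemma Rfubini2 : Lint m2 (fun y => \int[m1]_x f (x, y)) /\
  \int[m2]_y (\int[m1]_x f (x, y)) = \int[(m1 \x m2)%E]_z f z.
Proof.
have mf : measurable_fun setT f by exact: Lint_meas fi.
have si : (m2 \x m1)%E.-integrable setT (EFin \o (fun p => f (p.2, p.1))).
  apply: Lint_prod.
    have ms : measurable_fun setT (fun p : T2 * T1 => (p.2, p.1)) by exact: measurable_fun_pair.
    exact: (measurableT_comp mf ms).
  have /(@integrable21ltyP _ _ _ _ _ m1 m2) := fi.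
  by apply; exact/measurable_EFinP.
have [h1 h2] := fine_Lint (integrable_fubini_F si).
split; first exact: h1.
rewrite [LHS]h2; congr fine.
exact: (@integral21_prod_meas1 _ _ _ _ _ m1 m2 _ fi).
Qed.

Lemma Rfubini : \int[m1]_x (\int[m2]_y f (x, y)) = \int[m2]_y (\int[m1]_x f (x, y)).
Proof. by rewrite Rfubini1.2 Rfubini2.2. Qed.

End Rfubini.

(** Positive and negative parts have measurable Tonelli integrals, so their difference and its
    [fine] are measurable, also across those x whose section is not integrable. *)
Lemma measurable_Rint_param {R : realType} d1 d2 (T1 : measurableType d1) (T2 : measurableType d2)
  (m2 : {sigma_finite_measure set T2 -> \bar R}) (f : T1 * T2 -> R) :
  measurable_fun setT f -> measurable_fun setT (fun x => \int[m2]_y f (x, y)).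
Proof.
move=> mf; apply: measurableT_comp => //.
have mF : measurable_fun setT (EFin \o f) by exact/measurable_EFinP.
rewrite [X in measurable_fun _ X](_ : _ = fun x =>
  (\int[m2]_y (EFin \o f)^\+ (x, y) - \int[m2]_y (EFin \o f)^\- (x, y))%E); last first.
  apply/funext => x; rewrite [LHS]integralE; by congr (_ - _)%E; apply: eq_integral => y _; rewrite ?funeposE ?funenegE.
by apply: emeasurable_funB; apply: measurable_fun_fubini_tonelli_F => //;
  [exact: measurable_funepos|exact: measurable_funeneg].
Qed.

Lemma lip_max0 {R : realType} (a b : R) : `|Num.max a 0 - Num.max b 0| <= `|a - b|.
Proof.
have := ler_norm (a - b); have := ler_norm (b - a); rewrite distrC.
rewrite ler_norml; move: `|a - b| => n h1 h2.
by apply/andP; case: (lerP a 0); case: (lerP b 0) => *; split; lra.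
Qed.

Lemma Lint_eq {R : realType} d (T : measurableType d) (m : {measure set T -> \bar R}) (f g : T -> R) :
  (forall x, f x = g x) -> Lint m f -> Lint m g.
Proof. by move=> /funext ->. Qed.

Section vector_measurability.
Context {R : realType} {d : nat} {d0 : measure_display} {T : measurableType d0}.
Implicit Types f g : T -> 'rV[R]_d.

Definition vmeas f := measurable_fun setT (f : T -> Borel R d).

Lemma vmeas_coord f i : vmeas f -> measurable_fun setT (fun t => f t 0 i).
Proof. by move=> mf; have := measurableT_comp (measurable_coord i) mf. Qed.

Lemma vmeasD f g : vmeas f -> vmeas g -> vmeas (fun t => f t + g t).
Proof.
move=> mf mg; apply: measurable_fun_rV => i; under eq_fun do rewrite mxE.
by apply: measurable_funD; exact: vmeas_coord.
Qed.

Lemma vmeasN f : vmeas f -> vmeas (fun t => - f t).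
Proof.
move=> mf; apply: measurable_fun_rV => i; under eq_fun do rewrite mxE.
by apply: measurable_funN; exact: vmeas_coord.
Qed.

Lemma vmeasB f g : vmeas f -> vmeas g -> vmeas (fun t => f t - g t).
Proof. by move=> mf mg; apply: vmeasD => //; exact: vmeasN. Qed.

Lemma vmeasZ (c : T -> R) f : measurable_fun setT c -> vmeas f -> vmeas (fun t => c t *: f t).
Proof.
move=> mc mf; apply: measurable_fun_rV => i; under eq_fun do rewrite mxE.
by apply: measurable_funM => //; exact: vmeas_coord.
Qed.

Lemma vmeas_cst v : vmeas (fun _ => v).
Proof. exact: measurable_cst. Qed.

Lemma vmeas_dotp f g : vmeas f -> vmeas g -> measurable_fun setT (fun t => dotp (f t) (g t)).
Proof.
move=> mf mg; apply: measurable_sum => i.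
by apply: measurable_funM; exact: vmeas_coord.
Qed.

Lemma vmeas_comp (h : 'rV[R]_d -> R) f : Bmeas h -> vmeas f -> measurable_fun setT (fun t => h (f t)).
Proof. by move=> mh mf; exact: (measurableT_comp mh mf). Qed.

End vector_measurability.

Lemma vmeas_id {R : realType} {d : nat} : @vmeas R d _ (Borel R d) id.
Proof. exact: measurable_id. Qed.

Ltac vmeas := apply: vmeas_comp => //; repeat first [exact: vmeas_cst | exact: vmeas_id
  | exact: measurable_fst | exact: measurable_snd | apply: vmeasZ => // | apply: vmeasB | apply: vmeasD].

Section integrals.
Context {R : realType} {d : nat}.
Local Notation mud := (mu R d).
Implicit Types f g : 'rV[R]_d -> R.

Lemma iint_ge0E (f : 'rV[R]_d -> R) : Bmeas f -> (forall x, 0 <= f x) ->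
  iint (fun x => (f x)%:E) = (\int[mud]_x (f x)%:E)%E.
Proof.
move=> mf f0; rewrite integral_mu//; last exact/measurable_EFinP.
Qed.

Lemma integrableE f : Defs.integrable f <-> Lint mud f.
Proof.
split=> [[mf fi]|fi].
  apply/LintP; split => //; rewrite -iint_ge0E//.
  exact: measurableT_comp.
have mf := Lint_meas fi; split => //.
by rewrite iint_ge0E//; [have [] := (LintP mud f).1 fi|exact: measurableT_comp].
Qed.

Lemma integ_posneg f : Bmeas f ->
  integ f = fine (\int[mud]_x (Num.max (f x) 0)%:E)%E - fine (\int[mud]_x (Num.max (- f x) 0)%:E)%E.
Proof.
move=> mf; rewrite /integ !iint_ge0E//.
- by apply: measurable_maxr => //; exact: measurable_funN.
- by move=> x; exact: max0_ge0.
- exact: measurable_maxr.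
- by move=> x; exact: max0_ge0.
Qed.

Lemma integE f : Lint mud f -> integ f = \int[mud]_x f x.
Proof. by move=> fi; rewrite (integ_posneg (Lint_meas fi)) (Rint_posneg fi). Qed.

Lemma Lint_aff (r : R) (a : 'rV[R]_d) f : r != 0 -> Lint mud f ->
  Lint mud (fun x => f (r *: x + a)) /\
  \int[mud]_x f (r *: x + a) = (`|r|^-1) ^+ d * \int[mud]_x f x.
Proof.
move=> r0 fi; have mf : Bmeas f := Lint_meas fi.
have maff : @vmeas R d _ (Borel R d) (fun x => r *: x + a) by exact: measurable_aff.
have mg : measurable_fun setT ((fun x => f (r *: x + a)) : Borel R d -> R).
  exact: vmeas_comp.
have gi : Lint mud (fun x => f (r *: x + a)).
  apply/LintP; split => //.
  have -> : (\int[mud]_x `|f (r *: x + a)|%:E = ((`|r|^-1) ^+ d)%:E * \int[mud]_x `|f x|%:E)%E.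
    apply: (@integral_aff R d r a (fun x => `|f x|%:E)) => //.
    by apply/measurable_EFinP; exact: measurableT_comp.
  by apply: lte_mul_pinfty => //; have [] := (LintP mud f).1 fi.
split => //; rewrite -!integE// !integ_posneg//.
have key (h : 'rV[R]_d -> R) : Bmeas h -> (forall x, 0 <= h x) ->
  fine (\int[mud]_x (h (r *: x + a))%:E)%E = (`|r|^-1) ^+ d * fine (\int[mud]_x (h x)%:E)%E.
  move=> mh h0; have -> : (\int[mud]_x (h (r *: x + a))%:E = ((`|r|^-1) ^+ d)%:E * \int[mud]_x (h x)%:E)%E.
    by apply: (@integral_aff R d r a (fun x => (h x)%:E)) => //; exact/measurable_EFinP.
  have rd0 : 0 < `|r|^-1 ^+ d by rewrite exprn_gt0// invr_gt0 normr_gt0.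
  have : (0 <= \int[mud]_x (h x)%:E)%E by apply: integral_ge0 => x _; rewrite lee_fin.
  case: (\int[mud]_x (h x)%:E)%E => [z| |]//= _.
  (* An infinite integral becomes 0 on both sides. *)
  by rewrite gt0_muley ?lte_fin// mulr0.
rewrite mulrBr -!key//.
- by apply: measurable_maxr => //; exact: measurable_funN.
- by move=> x; exact: max0_ge0.
- exact: measurable_maxr.
- by move=> x; exact: max0_ge0.
Qed.

Lemma Lint_scale (r : R) f : r != 0 -> Lint mud f -> Lint mud (fun x => f (r *: x)) /\
  \int[mud]_x f (r *: x) = (`|r|^-1) ^+ d * \int[mud]_x f x.
Proof.
move=> r0 fi; have [h1 h2] := Lint_aff 0 r0 fi.
split; first by apply: (Lint_eq _ h1) => x; rewrite addr0.
by rewrite -h2; apply: eq_Rintegral => x _; rewrite addr0.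
Qed.

Lemma ge0_integral_shift (a : 'rV[R]_d) (f : 'rV[R]_d -> R) : Bmeas f -> (forall x, 0 <= f x) ->
  (\int[mud]_x (f (x + a))%:E = \int[mud]_x (f x)%:E)%E.
Proof.
move=> mf f0; have := @integral_aff R d 1 a (fun x => (f x)%:E) (oner_neq0 _).
rewrite normr1 invr1 expr1n mul1e => <-//; last exact/measurable_EFinP.
by apply: eq_integral => x _; rewrite scale1r.
Qed.

End integrals.

(** * Weak formulation of mild solutions *)

Section joint_measurability.
Context {R : realType} {d : nat}.
Local Notation mud := (mu R d).
Local Notation V := 'rV[R]_d.
Local Notation TX := (measurableTypeR R * Borel R d)%type.

Definition L1cont (v : R -> V -> R) := forall t0 : R,
  (\int[mud]_x `|v t x - v t0 x|) @[t --> t0] --> (0 : R).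

Lemma L1cont_cst (f : V -> R) : L1cont (fun _ : R => f).
Proof.
move=> t0; rewrite (_ : (fun _ => _) = cst 0); first exact: cvg_cst.
apply/funext => t; under eq_Rintegral do rewrite subrr normr0.
by rewrite Rintegral_cst// mul0r.
Qed.

(** On each of the countably many time slabs of width 1/(n+1) the function depends on x alone. *)
Lemma measurable_floor_param (n : nat) (G : int -> V -> \bar R) :
  (forall j, measurable_fun setT (G j : Borel R d -> \bar R)) ->
  measurable_fun setT (fun p : TX => G (Num.floor (p.1 * n.+1%:R)) p.2).
Proof.
move=> mG _ B mB; rewrite setTI.
pose A (j : int) : set (TX) :=
  (fun p : TX => p.1 * n.+1%:R) @^-1` `[j%:~R, (j + 1)%:~R[%classic `&`
  (fun p : TX => G j p.2) @^-1` B.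
have mA j : measurable (A j).
  apply: measurableI.
    rewrite -[X in measurable X]setTI.
    by apply: (_ : measurable_fun setT _) => //; exact: measurable_funM.
  rewrite -[X in measurable X]setTI.
  by apply: (measurableT_comp (mG j) (@measurable_snd _ _ _ _)).
rewrite [X in measurable X](_ : _ = \bigcup_n (if unpickle n is Some j then A j else set0)).
  by apply: bigcupT_measurable => k; case: unpickle.
apply/seteqP; split => -[t x] /=.
  have : (Num.floor (t * n.+1%:R))%:~R <= t * n.+1%:R < (Num.floor (t * n.+1%:R) + 1)%:~R.
    by rewrite floor_le_tmp floorD1_gt.
  move: (Num.floor _) => j hj Bt; exists (pickle j); first by []; rewrite pickleK; split; last exact: Bt.
  by rewrite /= in_itv.
move=> [k _]; case: unpickle => // j [/=]; rewrite in_itv /= => h.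
by rewrite (floor_def h).
Qed.

(** Each [v t] is measurable in x, but nothing is known jointly in (t, x). Freezing time on a grid
    gives jointly measurable functions; since [v] is continuous in L^1 and [K] is bounded, they
    converge pointwise as the grid is refined. *)
Lemma measurable_bounded_conv (c : R) (K : V -> R) (v : R -> V -> R) :
  Bmeas K -> (forall x, `|K x| <= c) -> (forall t, Lint mud (v t)) -> L1cont v ->
  measurable_fun setT (fun p : TX =>
    (\int[mud]_y (K ((p.2 : V) - y) * v p.1 y))%:E).
Proof.
move=> mK Kc vi vc.
have mKx (x : V) : measurable_fun setT (fun y : Borel R d => K (x - (y : V))).
  by vmeas.
have Kvi (x : V) (f : V -> R) : Lint mud f -> Lint mud (fun y => K (x - y) * f y).
  by move=> fi; apply: (Lint_bddM _ c).
pose tn (n : nat) (t : R) : R := (Num.floor (t * n.+1%:R))%:~R / n.+1%:R.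
have tnE n t : `|tn n t - t| <= n.+1%:R^-1.
  have n0 : 0 < n.+1%:R :> R by rewrite ltr0n.
  rewrite -(ler_pM2r n0) -[X in _ * X]gtr0_norm// -normrM mulrBl /tn mulfVK ?gt_eqF//.
  rewrite mulVf ?gt_eqF// ler_norml.
  have := floor_le_tmp (t * n.+1%:R); have := floorD1_gt (t * n.+1%:R).
  rewrite intrD => h1 h2; apply/andP; split; lra.
have tncvg t : tn n t @[n --> \oo] --> t.
  apply/cvgrPdist_le => e e0; near=> n.
  rewrite distrC (le_trans (tnE n t))//.
  near: n; apply: filterS (near_infty_natSinv_lt (PosNum e0)) => n /=; exact: ltW.
apply: (emeasurable_fun_cvg (fun n (p : TX) =>
    (\int[mud]_y (K ((p.2 : V) - y) * v (tn n p.1) y))%:E)).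
  move=> n; apply: (@measurable_floor_param n
    (fun j x => (\int[mud]_y (K (x - y) * v (j%:~R / n.+1%:R) y))%:E)) => j.
  apply/measurable_EFinP.
  have mF : measurable_fun setT (fun p : Borel R d * Borel R d =>
     K ((p.1 : V) - p.2) * v (j%:~R / n.+1%:R) p.2).
    apply: measurable_funM.
      by vmeas.
    apply: vmeas_comp; last exact: measurable_snd.
    exact: Lint_meas (vi _).
  exact: (@measurable_Rint_param _ _ _ _ _ mud _ mF).
move=> [t x] _ /=; apply: cvg_EFin; first exact: nearW.
rewrite /comp /=.
have c0 : 0 <= c by exact: le_trans (normr_ge0 _) (Kc 0).
apply/cvgrPdist_le => e e0.
have e1 : 0 < e / (c + 1) by rewrite divr_gt0// ltr_wpDl.
have /cvgrPdist_le/(_ _ e1) := cvg_comp _ _ (tncvg t) (vc t).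
apply: filterS => n /=; rewrite sub0r normrN ger0_norm ?Rintegral_ge0// => h.
rewrite -RintegralB//; [|exact: Kvi|exact: Kvi].
have di : Lint mud (fun y => `|v (tn n t) y - v t y|) by apply/Lint_norm/LintB.
apply: (@le_trans _ _ (\int[mud]_y (c * `|v (tn n t) y - v t y|))).
  apply: norm_Rint_le; first exact: LintZ.
    by apply: measurable_funB; apply: Lint_meas; exact: Kvi.
  by move=> y; rewrite -mulrBr normrM distrC ler_pM// Kc.
rewrite RintegralZl// (le_trans (ler_wpM2l c0 h))//.
rewrite mulrA ler_pdivrMr ?ltr_wpDl// mulrC ler_pM2l// lerDl//.
Unshelve. all: by end_near.
Qed.

(** Truncating [K] at height j reduces to the bounded case; monotone convergence removes the
    truncation, with the value +oo allowed. *)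
Lemma measurable_ge0_conv (K : V -> R) (v : R -> V -> R) :
  Bmeas K -> (forall x, 0 <= K x) -> (forall t, Lint mud (v t)) -> (forall t x, 0 <= v t x) ->
  L1cont v ->
  measurable_fun setT (fun p : TX =>
    (\int[mud]_y (K ((p.2 : V) - y) * v p.1 y)%:E)%E).
Proof.
move=> mK K0 vi v0 vc.
pose Kj (j : nat) (x : V) := Num.min (K x) j%:R.
have mKj j : Bmeas (Kj j) by exact: measurable_minr.
have Kj0 j x : 0 <= Kj j x by rewrite le_min K0 ler0n.
have Kjc j x : `|Kj j x| <= j%:R by rewrite ger0_norm// ge_min lexx orbT.
have mKx j (x : V) : measurable_fun setT (fun y : Borel R d => Kj j (x - (y : V))).
  by vmeas.
have Kvi j (x : V) (f : V -> R) : Lint mud f -> Lint mud (fun y => Kj j (x - y) * f y).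
  by move=> fi; apply: (Lint_bddM _ j%:R).
apply: (emeasurable_fun_cvg (fun j (p : TX) =>
    (\int[mud]_y (Kj j ((p.2 : V) - y) * v p.1 y)%:E)%E)).
  move=> j; rewrite [X in measurable_fun _ X](_ : _ = fun p : TX =>
    (\int[mud]_y (Kj j ((p.2 : V) - y) * v p.1 y))%:E); last first.
    by apply/funext => p; rewrite RintE//; exact: Kvi.
  exact: measurable_bounded_conv (Kjc j) _ _.
move=> [t x] _ /=.
rewrite [X in _ --> X](_ : _ = (\int[mud]_y limn (fun j => (Kj j (x - y) * v t y)%:E))%E); last first.
  apply: eq_integral => y _; apply/esym/cvg_lim => //; apply: cvg_EFin; first exact: nearW.
  rewrite /comp /=; apply: cvgM; last exact: cvg_cst.
  apply: cvg_near_cst; near=> j; rewrite /Kj; apply: min_l.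
  by near: j; exact: nbhs_infty_ger.
apply: cvg_monotone_convergence => //.
- by move=> j; apply/measurable_EFinP; exact: Lint_meas (Kvi _ _ _ (vi _)).
- by move=> j y _; rewrite lee_fin mulr_ge0.
- move=> y _ i j ij; rewrite lee_fin ler_wpM2r// /Kj le_min !ge_min lexx /= ler_nat ij orbT //.
Unshelve. all: by end_near.
Qed.

Lemma L1cont_lip (phi : R -> R) (v : R -> V -> R) :
  measurable_fun setT phi -> (forall a b, `|phi a - phi b| <= `|a - b|) ->
  (forall t, Lint mud (v t)) -> (forall t, Lint mud (fun x => phi (v t x))) ->
  L1cont v -> L1cont (fun t x => phi (v t x)).
Proof.
move=> mphi lip vi pvi vc t0.
apply: (@squeeze_cvgr _ _ _ _ (cst 0) (fun t => \int[mud]_x `|v t x - v t0 x|)).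
- apply: nearW => t; rewrite Rintegral_ge0//=.
  by apply: le_Rint => //; apply: Lint_norm; exact: LintB.
- exact: cvg_cst.
- exact: vc.
Qed.

(** [conv] is by definition a difference of two [fine] parts, so the parts of [v] are treated
    separately and the points where the integral diverges need no special care. *)
Lemma measurable_conv (K : V -> R) (v : R -> V -> R) :
  Bmeas K -> (forall x, 0 <= K x) -> (forall t, Lint mud (v t)) -> L1cont v ->
  measurable_fun setT (fun p : TX => Defs.conv K (v p.1) (p.2 : V)).
Proof.
move=> mK K0 vi vc.
have mKx (x : V) : measurable_fun setT (fun y : Borel R d => K (x - (y : V))).
  by vmeas.
pose vp (t : R) (x : V) := Num.max (v t x) 0.
pose vn (t : R) (x : V) := Num.max (- v t x) 0.
have vpi t : Lint mud (vp t) := Lint_pos (vi t).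
have vni t : Lint mud (vn t) := Lint_neg (vi t).
rewrite (_ : (fun p => _) = fun p : TX =>
   fine (\int[mud]_y (K ((p.2 : V) - y) * vp p.1 y)%:E)%E -
   fine (\int[mud]_y (K ((p.2 : V) - y) * vn p.1 y)%:E)%E).
  apply: measurable_funB; apply: measurableT_comp => //.
    apply: measurable_ge0_conv => //; first by move=> t x; exact: max0_ge0.
    apply: (@L1cont_lip (fun a => Num.max a 0)) => //; last exact: lip_max0.
    exact: measurable_maxr.
  apply: measurable_ge0_conv => //; first by move=> t x; exact: max0_ge0.
  apply: (@L1cont_lip (fun a => Num.max (- a) 0)) => //.
    by apply: measurable_maxr => //; exact: oppr_measurable.
  by move=> a b; rewrite (le_trans (lip_max0 _ _))// (_ : - a - - b = - (a - b)) ?normrN//; ring.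
apply/funext => p; rewrite /Defs.conv integ_posneg//; last first.
  by apply: measurable_funM => //; exact: Lint_meas (vi _).
congr (fine _ - fine _); apply: eq_integral => y _; congr EFin.
  by rewrite /vp maxr_pMr// mulr0.
by rewrite /vn maxr_pMr// mulr0 mulrN.
Qed.

End joint_measurability.

Lemma bmeas_cst {R : realType} {d : nat} (c : R) : Bmeas (fun _ : 'rV[R]_d => c).
Proof. exact: measurable_cst. Qed.

Lemma norm_one_le {R : realType} {d : nat} (x : 'rV[R]_d) : `|(fun _ : 'rV[R]_d => 1 : R) x| <= 1.
Proof. by rewrite normr1. Qed.

(** * Convolution with a nonnegative integrable kernel *)

Section convolution.
Context {R : realType} {d : nat}.
Local Notation mud := (mu R d).
Local Notation V := 'rV[R]_d.
Variables (K f : V -> R).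
Hypotheses (Ki : Lint mud K) (K0 : forall x, 0 <= K x) (fi : Lint mud f).

Let mK : Bmeas K := Lint_meas Ki.
Let mf : Bmeas f := Lint_meas fi.

Lemma measurable_conv1 : Bmeas (Defs.conv K f).
Proof.
have h := measurable_conv mK K0 (fun _ => fi) (L1cont_cst f).
exact: (@measurable_fun_pair2 _ _ _ (measurableTypeR R) (Borel R d) _ _ 0 h).
Qed.

(** Integrating in x first, translation invariance turns the kernel into its mass times |f y|. *)
Lemma Lint_conv_kernel (psi : V -> R) (c : R) : Bmeas psi -> (forall x, `|psi x| <= c) ->
  Lint (mud \x mud)%E (fun p : Borel R d * Borel R d => psi (p.1 : V) * (K ((p.1 : V) - p.2) * f p.2)).
Proof.
move=> mpsi pc; apply: (Lint_bddM _ c (fun p : Borel R d * Borel R d => psi (p.1 : V))).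
- by vmeas.
- by move=> p.
apply: Lint_prod2.
  apply: measurable_funM.
    by vmeas.
  by vmeas.
have -> : (\int[mud]_y \int[mud]_x `|K ((x : V) - y) * f y|%:E =
  \int[mud]_y (`|f y|%:E * \int[mud]_x (K x)%:E))%E.
  apply: eq_integral => y _.
  rewrite -(@ge0_integral_shift _ _ (- (y : V)) K)//.
  rewrite -ge0_integralZl//.
  - by apply: eq_integral => x _; rewrite normrM ger0_norm// EFinM muleC.
  - apply/measurable_EFinP.
    by vmeas.
  - by move=> x _; rewrite lee_fin.
rewrite RintE// ge0_integralZr//; last 2 first.
  - by apply/measurable_EFinP; exact: measurableT_comp.
  - by rewrite lee_fin Rintegral_ge0.
by rewrite muleC lte_mul_pinfty ?lee_fin ?Rintegral_ge0//; have [] := (LintP mud f).1 fi.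
Qed.

(** Only almost everywhere: where the integrand is not integrable, [conv] has a default value
    without meaning. *)
Lemma ae_conv : {ae mud, forall x : Borel R d, Defs.conv K f x = \int[mud]_y (K (x - y) * f y) /\
  Lint mud (fun y => K (x - y) * f y)}.
Proof.
have := ae_integrable1 (Lint_conv_kernel (bmeas_cst 1) norm_one_le).
apply: filterS => x /= hx.
have hx' : Lint mud (fun y => K ((x : V) - y) * f y).
  by apply: eq_integrable hx => // y _ /=; rewrite mul1r.
by split => //; rewrite /Defs.conv integE.
Qed.

(** Fubini and x = y + z move the convolution onto the test function, where the inner integral
    converges for every y because [psi] is bounded. *)
Lemma conv_pairing (psi : V -> R) (c : R) : Bmeas psi -> (forall x, `|psi x| <= c) ->
  Lint mud (fun x => psi x * Defs.conv K f x) /\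
  \int[mud]_x (psi x * Defs.conv K f x) = \int[mud]_y (f y * \int[mud]_z (psi (y + z) * K z)).
Proof.
move=> mpsi pc; have Fi := Lint_conv_kernel mpsi pc.
have mpc : measurable_fun setT (fun x : Borel R d => psi x * Defs.conv K f x).
  by apply: measurable_funM => //; exact: measurable_conv1.
have aeE : {ae mud, forall x : Borel R d, psi x * Defs.conv K f x = \int[mud]_y (psi x * (K (x - y) * f y))}.
  by apply: filterS ae_conv => x /= [-> hx]; rewrite RintegralZl.
have [i1 e1] := Rfubini1 Fi.
split.
  apply/LintP; split => //.
  have [_] := (LintP _ _).1 i1; congr (_ < _)%E.
  apply: ae_eq_integral => //.
  - by apply/measurable_EFinP; apply: measurableT_comp => //; exact: Lint_meas i1.
  - by apply/measurable_EFinP; apply: measurableT_comp.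
  - by apply: filterS aeE => x /= -> _.
transitivity (\int[mud]_x (\int[mud]_y (psi x * (K (x - y) * f y)))).
  apply: Rint_ae_eq => //; exact: Lint_meas i1.
rewrite [LHS](Rfubini Fi) /=; apply: eq_Rintegral => y _.
have pKi : Lint mud (fun z : V => psi ((y : V) + z) * K z).
  apply: (Lint_bddM mud c (fun z : V => psi ((y : V) + z)) K) => //.
  by vmeas.
have [_] := @Lint_aff R d 1 (- (y : V)) _ (oner_neq0 _) pKi.
rewrite normr1 invr1 expr1n mul1r => <-.
rewrite -RintegralZl//.
  by apply: eq_Rintegral => x _; rewrite scale1r [(y : V) + _]addrC subrK; ring.
have [+ _] := @Lint_aff R d 1 (- (y : V)) _ (oner_neq0 _) pKi; exact.
Qed.

(** Young's inequality by duality: the test function in [conv_pairing] is the sign of the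
    convolution itself. *)
Lemma conv_L1 : Lint mud (Defs.conv K f) /\
  \int[mud]_x `|Defs.conv K f x| <= \int[mud]_x K x * \int[mud]_x `|f x|.
Proof.
pose psi x := Num.sg (Defs.conv K f x).
have mpsi : Bmeas psi.
  rewrite /psi /Num.sg; apply: measurable_fun_ifT => //.
    apply: measurable_fun_eqr => //; exact: measurable_conv1.
  apply: measurable_fun_ifT => //.
  apply: measurable_fun_ltr => //; exact: measurable_conv1.
have pc x : `|psi x| <= 1 by rewrite normr_sg lern1 leq_b1.
have [i1 _] := conv_pairing (bmeas_cst 1) norm_one_le.
have ci : Lint mud (Defs.conv K f).
  by apply: eq_integrable i1 => // x _ /=; rewrite mul1r.
split => //.
have [i2 e2] := conv_pairing mpsi pc.
rewrite (_ : \int[mud]_x _ = \int[mud]_x (psi x * Defs.conv K f x)); last first.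
  by apply: eq_Rintegral => x _; rewrite normrEsg.
rewrite e2 (le_trans (ler_norm _))// -RintegralZl//; last exact: Lint_norm.
have pKi (y : V) : Lint mud (fun z : V => psi (y + z) * K z).
  apply: (Lint_bddM mud 1 (fun z : V => psi (y + z)) K) => //.
  by vmeas.
apply: norm_Rint_le.
- by apply: LintZ; exact: Lint_norm.
- apply: measurable_funM => //.
  apply: (@measurable_Rint_param _ _ _ _ _ mud (fun p : Borel R d * Borel R d => psi ((p.1 : V) + p.2) * K p.2)).
  apply: measurable_funM.
    by vmeas.
  by vmeas.
move=> y; rewrite normrM mulrC ler_wpM2r//; apply: norm_Rint_le => //.
  exact: Lint_meas (pKi y).
by move=> z; rewrite normrM (ger0_norm (K0 z)) -[leRHS]mul1r ler_wpM2r.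
Qed.

End convolution.

Section L1cont.
Context {R : realType} {d : nat}.
Local Notation mud := (mu R d).
Local Notation V := 'rV[R]_d.
Variable v : R -> V -> R.
Hypotheses (vi : forall t, Lint mud (v t)) (vc : L1cont v).

Lemma L1cont_norm : continuous (fun t : R => \int[mud]_x `|v t x|).
Proof.
move=> t0; apply/cvgrPdist_le => e e0.
have /cvgrPdist_le/(_ _ e0) := @vc t0.
apply: filterS => t /=; rewrite sub0r normrN ger0_norm ?Rintegral_ge0//.
apply: le_trans; rewrite -RintegralB//; [|exact: Lint_norm|exact: Lint_norm].
apply: norm_Rint_le.
- by apply: Lint_norm; exact: LintB.
- by apply: measurable_funB; apply: Lint_meas; exact: Lint_norm.
- by move=> x; rewrite [leRHS]distrC ler_dist_dist.
Qed.

Lemma L1cont_bounded (t : R) : exists2 N : R, 0 <= N & forall s, 0 <= s <= t -> \int[mud]_x `|v s x| <= N.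
Proof.
have [t0|t0] := lerP 0 t; last first.
  by exists 0 => // s /andP[/le_trans h /h]; rewrite leNgt t0.
have cw : {within `[0, t], continuous (fun t : R => \int[mud]_x `|v t x|)}.
  by apply: continuous_subspaceT; exact: L1cont_norm.
have [c cI hc] := EVT_max t0 cw.
exists (\int[mud]_x `|v c x|); first exact: Rintegral_ge0.
by move=> s s0; apply: hc; rewrite in_itv.
Qed.

End L1cont.

Lemma indic_patch {T : Type} {R : realType} (A : set T) (f : T -> R) :
  (fun x => \1_A x * f x) = f \_ A.
Proof.
by apply/funext => x; rewrite patchE indicE; case: ifPn => _; rewrite ?mul1r ?mul0r.
Qed.

Lemma leb_indic_Lint {R : realType} (a b c : R) :
  Lint (@lebesgue_measure R) (fun x => \1_`[a, b]%classic x * c).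
Proof.
apply: (@Lint_eq R _ (measurableTypeR R) (@lebesgue_measure R) (fun x => c * \1_`[a, b]%classic x)); first by move=> x; rewrite mulrC.
by apply: LintZ; exact: integrable_indic_itv.
Qed.

Section weak_form.
Context {R : realType} {d : nat}.
Local Notation mud := (mu R d).
Local Notation leb := (@lebesgue_measure R).
Local Notation V := 'rV[R]_d.
Local Notation TX := (measurableTypeR R * Borel R d)%type.
Variables (a : R) (K u0 : V -> R) (v : R -> V -> R).

(** What is kept of a mild solution: unweighted L^1 continuity and Duhamel's formula almost
    everywhere. Moments are recovered later from [weak_form]. *)
Record weak_sol : Prop := WeakSol {
  ws_a : 0 <= a;
  ws_K : Lint mud K;
  ws_K0 : forall x, 0 <= K x;
  ws_u0 : Lint mud u0;
  ws_v : forall t, Lint mud (v t);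
  ws_c : L1cont v;
  ws_D : forall t, 0 <= t -> iint (fun x => `|v t x - duhamel a K u0 v t x|%:E) = 0%E }.

Hypothesis W : weak_sol.
Let Ki := ws_K W. Let K0 := ws_K0 W. Let vi := ws_v W. Let vc := ws_c W.
Let mK : Bmeas K := Lint_meas Ki.

(** The semigroup of Duhamel's formula: damping e^(- a t) times the mass-preserving dilation e^(d t)
    h(e^t x). [pairing] is the integral of [psi (e^-t x)] against K convolved with v(s), with the
    convolution already moved onto [psi]. *)
Local Notation flow t h x := (expR ((d%:R - a) * t) * h (expR t *: x)).
Local Notation pairing psi t s := (\int[mud]_y (v s y * \int[mud]_z (psi (expR (- t) *: ((y : V) + (z : V))) * K z))).

Definition source (t : R) (p : TX) : R :=
  \1_`[0, t]%classic (p.1 : R) * (expR ((d%:R - a) * (t - p.1)) * Defs.conv K (v p.1) (expR (t - p.1) *: (p.2 : V))).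

Lemma measurable_source t : measurable_fun setT (source t).
Proof.
apply: measurable_funM.
  by apply: measurableT_comp => //; exact: measurable_indic.
apply: measurable_funM.
  apply: measurableT_comp; first exact: measurable_expR.
  by apply: measurable_funM => //; apply: measurable_funB => //; exact: measurable_fst.
have mc := measurable_conv mK K0 vi vc.
have mp : measurable_fun setT (fun p : TX =>
   (p.1, (expR (t - p.1) *: (p.2 : V) : Borel R d))).
  apply: measurable_fun_pair; first exact: measurable_fst.
  apply: vmeasZ; last exact: measurable_snd.
  apply: measurableT_comp; first exact: measurable_expR.
  by apply: measurable_funB => //; exact: measurable_fst.
exact: (measurableT_comp mc mp).
Qed.

Lemma expR_neq0 (t : R) : expR t != 0.
Proof. by rewrite gt_eqF// expR_gt0. Qed.

(** The Jacobian e^(- d t) of the dilation cancels the factor e^(d t), as div(x u) conserves mass;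
    the damping alone survives. *)
Lemma expR_jacobian (t : R) : expR ((d%:R - a) * t) * (`|expR t|^-1) ^+ d = expR (- a * t).
Proof. rewrite gtr0_norm ?expR_gt0// -expRN -expRM_natl -expRD; congr expR; ring. Qed.

Lemma scaled_pairing t (psi h : V -> R) : Lint mud (fun y => psi (expR (- t) *: y) * h y) ->
  Lint mud (fun x => psi x * flow t h x) /\
  \int[mud]_x (psi x * flow t h x) =
  expR (- a * t) * \int[mud]_y (psi (expR (- t) *: y) * h y).
Proof.
move=> i1; have [i2 e2] := Lint_scale (expR_neq0 t) i1.
have E x : psi x * flow t h x =
     expR ((d%:R - a) * t) * (psi (expR (- t) *: (expR t *: x)) * h (expR t *: x)).
  by rewrite scalerA -expRD addNr expR0 scale1r; ring.
split.
  by apply: (Lint_eq _ (LintZ (expR ((d%:R - a) * t)) i2)) => x; rewrite -E.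
under eq_Rintegral do rewrite E.
by rewrite RintegralZl// e2 mulrA expR_jacobian.
Qed.

Lemma scaled_conv (s t : R) psi (c : R) : Bmeas psi -> (forall x, `|psi x| <= c) ->
  Lint mud (fun x => psi x * (flow t (Defs.conv K (v s)) x)) /\
  \int[mud]_x (psi x * (flow t (Defs.conv K (v s)) x)) =
  expR (- a * t) * pairing psi t s.
Proof.
move=> mpsi pc.
have mpsi' : Bmeas (fun x : V => psi (expR (- t) *: x)).
  by vmeas.
have [i1 <-] := @conv_pairing _ _ _ _ Ki K0 (vi s) (fun x : V => psi (expR (- t) *: x)) c mpsi' (fun x => pc _).
exact: scaled_pairing.
Qed.

Lemma scaled_conv_norm (s t : R) :
  Lint mud (fun x => flow t (Defs.conv K (v s)) x) /\
  \int[mud]_x `|flow t (Defs.conv K (v s)) x| <=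
  expR (- a * t) * (\int[mud]_x K x * \int[mud]_x `|v s x|).
Proof.
have [ci cb] := conv_L1 Ki K0 (vi s).
have [i1 _] := Lint_scale (expR_neq0 t) ci; split; first exact: LintZ.
have [i2 e2] := Lint_scale (expR_neq0 t) (Lint_norm ci).
under eq_Rintegral do rewrite normrM (ger0_norm (expR_ge0 _)).
by rewrite RintegralZl// e2 mulrA expR_jacobian ler_wpM2l// expR_ge0.
Qed.

(** On [0, t] the mass of [v] is bounded by continuity, and a >= 0 makes the damping at most 1, so
    each time slice has L^1 norm at most the mass of [K] times that bound. *)
Lemma Lint_source (t : R) : 0 <= t -> Lint (leb \x mud)%E (source t).
Proof.
move=> t0; have ms := measurable_source t.
have [N N0 vN] := L1cont_bounded vi vc t.
apply: Lint_prod => //.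
pose C : R := \int[mud]_x K x * N.
have C0 : 0 <= C by rewrite mulr_ge0// Rintegral_ge0.
apply: (@le_lt_trans _ _ (\int[leb]_x (\1_`[0, t]%classic x * C)%:E)%E).
  apply: ge0_le_integral => //.
  - by move=> x _; exact: integral_ge0.
  - apply: (@measurable_fun_fubini_tonelli_F _ _ _ _ _ mud (fun p => `|source t p|%:E)) => //.
    by apply/measurable_EFinP; exact: measurableT_comp.
  - by apply/measurable_EFinP; exact: Lint_meas (leb_indic_Lint 0 t C).
  - move=> s _; rewrite /source /= indicE; case: (boolP (s \in _)) => hs; last first.
      rewrite mul0r integral0_eq//= => x _; by rewrite mul0r normr0.
    rewrite mul1r; under eq_integral do rewrite mul1r.
    have := hs; rewrite inE /= in_itv /= => /andP[s0 st].
    rewrite RintE; last by apply: Lint_norm; have [] := scaled_conv_norm s (t - s).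
    rewrite lee_fin (le_trans (scaled_conv_norm _ _).2)// /C.
    rewrite -[leRHS]mul1r ler_pM ?expR_ge0// ?mulr_ge0 ?Rintegral_ge0//.
      rewrite -[leRHS]expR0 ler_expR mulNr oppr_le0 mulr_ge0 ?subr_ge0//; exact: ws_a W.
    by rewrite ler_wpM2l ?Rintegral_ge0// vN// s0.
by rewrite (RintE (leb_indic_Lint 0 t C)) ltry.
Qed.

Lemma duhamelE t x : duhamel a K u0 v t x =
  flow t u0 x + a * \int[leb]_s source t (s, x).
Proof.
rewrite /duhamel; congr (_ + _ * _).
rewrite /source /= (indic_patch `[0, t]%classic (fun s => expR ((d%:R - a) * (t - s)) * Defs.conv K (v s) (expR (t - s) *: x))).
rewrite -Rintegral_mkcond; congr fine; apply: congr2 => //.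
Qed.

Lemma scaled_u0 t (psi : V -> R) (c : R) : Bmeas psi -> (forall x, `|psi x| <= c) ->
  Lint mud (fun x => psi x * flow t u0 x) /\
  \int[mud]_x (psi x * flow t u0 x) =
  expR (- a * t) * \int[mud]_y (psi (expR (- t) *: y) * u0 y).
Proof.
move=> mpsi pc; apply: scaled_pairing.
apply: (Lint_bddM mud c (fun y : V => psi (expR (- t) *: y)) u0) => //; last exact: ws_u0 W.
by vmeas.
Qed.

(** Duhamel's formula is integrated against a bounded [psi]; Fubini exchanges time and space, and
    both dilation and convolution pass to [psi]. The resulting identity holds for every t >= 0 and
    no longer mentions [conv]. *)
Lemma weak_form (t : R) (psi : V -> R) (c : R) : 0 <= t -> Bmeas psi -> (forall x, `|psi x| <= c) ->
  Lint leb (fun s => \1_`[0, t]%classic s * (expR (- a * (t - s)) *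
      pairing psi (t - s) s)) /\
  \int[mud]_x (psi x * v t x) = expR (- a * t) * \int[mud]_y (psi (expR (- t) *: y) * u0 y) +
    a * \int[leb]_s (\1_`[0, t]%classic s * (expR (- a * (t - s)) *
      pairing psi (t - s) s)).
Proof.
move=> t0 mpsi pc.
have si := Lint_source t0.
have [si2 _] := Rfubini2 si.
have psi_i : Lint (leb \x mud)%E (fun p => psi (p.2 : V) * source t p).
  apply: (Lint_bddM _ c (fun p : TX => psi (p.2 : V))) => //.
  by vmeas.
have [u0i _] := scaled_u0 t (bmeas_cst 1) norm_one_le.
have Di : Lint mud (fun x => flow t u0 x + a * \int[leb]_s source t (s, x)).
  apply: LintD; last exact: LintZ.
  by apply: eq_integrable u0i => // x _ /=; rewrite mul1r.
have ae_v : {ae mud, forall x : Borel R d, v t x - duhamel a K u0 v t x = 0}.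
  have mD : Bmeas (fun x => v t x - duhamel a K u0 v t x).
    apply: measurable_funB; first exact: Lint_meas (vi t).
    rewrite (_ : duhamel a K u0 v t = fun x => flow t u0 x + a * \int[leb]_s source t (s, x)).
      exact: Lint_meas Di.
    by apply/funext => x; exact: duhamelE.
  apply: Rint_eq0_ae => //; rewrite -(ws_D W t0) iint_ge0E//.
  exact: measurableT_comp.
have pvi : Lint mud (fun x => psi x * v t x) by apply: (Lint_bddM _ c).
have pDi : Lint mud (fun x => psi x * (flow t u0 x + a * \int[leb]_s source t (s, x))).
  exact: (Lint_bddM _ c).
have psi_si2 : Lint mud (fun x => psi x * \int[leb]_s source t (s, x)) by apply: (Lint_bddM _ c).
have [u0i' u0e] := scaled_u0 t mpsi pc.
have inner s : \int[mud]_x (psi x * source t (s, x)) =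
  \1_`[0, t]%classic s * (expR (- a * (t - s)) *
      pairing psi (t - s) s).
  have [si' se'] := scaled_conv s (t - s) mpsi pc.
  rewrite -se' -RintegralZl//; apply: eq_Rintegral => x _.
  by rewrite /source /= mulrCA.
have [fi1 fe1] := Rfubini1 psi_i.
have [fi2 fe2] := Rfubini2 psi_i.
split.
  by apply: eq_integrable fi1 => // s _ /=; rewrite inner.
transitivity (\int[mud]_x (psi x * (flow t u0 x + a * \int[leb]_s source t (s, x)))).
  apply: Rint_ae_eq; [exact: Lint_meas pvi|exact: Lint_meas pDi|].
  by apply: filterS ae_v => x /eqP; rewrite subr_eq0 duhamelE => /eqP ->.
transitivity (\int[mud]_x (psi x * flow t u0 x + a * (psi x * \int[leb]_s source t (s, x)))).
  by apply: eq_Rintegral => x _; rewrite mulrDr; congr (_ + _); rewrite mulrCA.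
rewrite RintegralD//; last exact: LintZ.
rewrite u0e RintegralZl//; congr (_ + _ * _).
under [RHS]eq_Rintegral do rewrite -inner.
rewrite [RHS]fe1 -fe2; apply: Rint_ae_eq; [exact: Lint_meas psi_si2|exact: Lint_meas fi2|].
(* The factor [psi x] leaves the time integral only where that integral converges, which is almost
   every x. *)
apply: filterS (ae_integrable2 si) => x /= hx; rewrite [RHS]RintegralZl//.
Qed.

End weak_form.

(** * Linear differential inequalities *)

Section ode.
Context {R : realType}.
Local Notation leb := (@lebesgue_measure R).

Lemma isd_eq (f : R -> R) (x df df' : R) : is_derive x 1 f df -> df = df' -> is_derive x 1 f df'.
Proof. by move=> h <-. Qed.

Lemma isdD (f g : R -> R) (x df dg : R) : is_derive x 1 f df -> is_derive x 1 g dg ->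
  is_derive x 1 (fun s : R => f s + g s) (df + dg).
Proof. by move=> hf hg; exact: is_deriveD. Qed.

Lemma isdM (f g : R -> R) (x df dg : R) : is_derive x 1 f df -> is_derive x 1 g dg ->
  is_derive x 1 (fun s : R => f s * g s) (f x * dg + g x * df).
Proof. by move=> hf hg; exact: is_deriveM. Qed.

Lemma isdC (c x : R) : is_derive x 1 (fun _ : R => c) 0.
Proof. exact: is_derive_cst. Qed.

Lemma isdI (x : R) : is_derive x 1 (fun s : R => s) 1.
Proof. exact: is_derive_id. Qed.

Lemma isdZ (l : R) (f : R -> R) (x df : R) : is_derive x 1 f df ->
  is_derive x 1 (fun s : R => l * f s) (l * df).
Proof. by move=> hf; apply: isd_eq (isdM (isdC l x) hf) _; rewrite mulr0 addr0. Qed.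

(** Integration starts at -1, so that 0 is an interior point and the derivative there is
    two-sided. *)
Lemma primitive (f : R -> R) : continuous f -> exists F : R -> R,
  (forall t : R, -1 < t -> is_derive t 1 F (f t)) /\ F 0 = 0 /\
  forall t : R, 0 <= t -> F t = \int[leb]_s (\1_`[0, t]%classic s * f s).
Proof.
move=> cf.
have fi (a b : R) : leb.-integrable `[a, b]%classic (EFin \o f).
  apply: continuous_compact_integrable; first exact: segment_compact.
  exact: continuous_subspaceT.
pose F (t : R) : R := \int[leb]_(s in `[-1, t]%classic) f s.
have dF (t : R) : -1 < t -> is_derive t 1 F (f t).
  move=> t1; have tt : t < t + 1 by rewrite ltrDl.
  have [h1 h2] := @continuous_FTC1_closed R f (-1) t (t + 1) tt (fi _ _) t1 (cf t).
  by split; [exact: h1|rewrite -h2 derive1E].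
exists (fun t => F t - F 0); split; [|split]; rewrite ?subrr//.
  by move=> t /dF h; apply: isd_eq (isdD h (isdC (- F 0) t)) _; rewrite addr0.
move=> t t0; rewrite /F.
rewrite (@Rintegral_itvB R f (BLeft (-1)) (BRight t) 0 (fi _ _)) ?bnd_simp// ?lerN10//.
rewrite Rintegral_itv_obnd_cbnd; last first.
  by apply: integrableS (fi 0 t) => //; exact: subset_itv_oc_cc.
by rewrite Rintegral_mkcond indic_patch.
Qed.

Lemma is_derive_expM (l t : R) : is_derive t 1 (fun s : R => expR (l * s)) (l * expR (l * t)).
Proof.
have h : is_derive t 1 (fun s : R => l * s) l by apply: isd_eq (isdZ l (isdI t)) _; rewrite mulr1.
by apply: isd_eq (is_derive1_comp (is_derive_expR (l * t)) h) _; rewrite mulrC.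
Qed.

Lemma derive_le0 (H dH : R -> R) (T : R) :
  (forall x : R, 0 <= x <= T -> is_derive x 1 H (dH x)) ->
  (forall x : R, 0 <= x <= T -> dH x <= 0) ->
  forall t : R, 0 <= t <= T -> H t <= H 0.
Proof.
move=> hd hle t /andP[t0 tT].
have hd' (x : R) : x \in `[0, t]%R -> is_derive x 1 H (dH x).
  by rewrite in_itv /= => /andP[x0 xt]; apply: hd; rewrite x0 (le_trans xt).
have [x xI E] := @MVT_segment R H dH 0 t t0
  (fun x xi => hd' x (subset_itv_oo_cc xi))
  (derivable_within_continuous (fun x xi => @ex_derive _ _ _ _ _ _ _ (hd' x xi))).
rewrite -subr_le0 E subr0 mulr_le0_ge0//; apply: hle.
by move: xI; rewrite in_itv /= => /andP[-> /le_trans->].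
Qed.

(** The function e^(- l t) H(t) - q t is nonincreasing. *)
Lemma gronwall_diff (H dH : R -> R) (l q T : R) :
  (forall x : R, 0 <= x <= T -> is_derive x 1 H (dH x)) ->
  (forall x : R, 0 <= x <= T -> dH x <= l * H x + expR (l * x) * q) ->
  forall t : R, 0 <= t <= T -> H t <= expR (l * t) * (H 0 + q * t).
Proof.
move=> hd hle t tT.
pose G (t : R) := expR (- l * t) * H t + - q * t.
pose dG (x : R) := expR (- l * x) * dH x + H x * (- l * expR (- l * x)) - q.
have hG (x : R) : 0 <= x <= T -> is_derive x 1 G (dG x).
  move=> xT; apply: isd_eq (isdD (isdM (is_derive_expM (- l) x) (hd x xT)) (isdZ (- q) (isdI x))) _.
    by rewrite mulr1.
have := @derive_le0 G dG T hG _ t tT.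
rewrite /G !mulr0 expR0 mul1r addr0 => h.
have {}h : expR (- l * t) * H t + - q * t <= H 0.
  apply: h => x xT; rewrite /dG.
  have := ler_wpM2l (expR_ge0 (- l * x)) (hle x xT).
  rewrite mulrDr mulrA [expR _ * (expR _ * q)]mulrA -expRD (_ : - l * x + l * x = 0) ?expR0; last ring.
  by move=> h'; lra.
have E : expR (l * t) * (expR (- l * t) * H t) = H t.
  by rewrite mulrA -expRD (_ : l * t + - l * t = 0) ?expR0 ?mul1r//; ring.
rewrite -[leLHS]E ler_wpM2l ?expR_ge0//; lra.
Qed.

(** [h] is merely continuous, so the differential form is applied to the right-hand side, which is
    differentiable and dominates [h]. *)
Lemma gronwall (h : R -> R) (a c0 q T : R) : 0 <= a -> continuous h ->
  (forall t : R, 0 <= t <= T -> h t <= c0 + \int[leb]_s (\1_`[0, t]%classic s * (a * h s + expR (a * s) * q))) ->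
  forall t : R, 0 <= t <= T -> h t <= expR (a * t) * (c0 + q * t).
Proof.
move=> a0 ch hh.
have cf : continuous (fun s => a * h s + expR (a * s) * q).
  move=> s; apply: cvgD; first by apply: cvgMr; exact: ch.
  apply: cvgMl; apply: continuous_comp; last exact: continuous_expR.
  by apply: cvgMr; exact: cvg_id.
have [F [dF [F0 FE]]] := primitive cf.
move=> t tT; apply: (le_trans (hh t tT)); have t0 : 0 <= t by have /andP[] := tT.
rewrite -FE// -[c0 in leRHS]addr0 -F0.
apply: (@gronwall_diff (fun t => c0 + F t) (fun s => a * h s + expR (a * s) * q) a q T) => // x xT.
  apply: isd_eq (isdD (isdC c0 x) (dF x _)) (add0r _).
  by have /andP[+ _] := xT; apply: lt_le_trans; rewrite ltrN10.
rewrite lerD2r ler_wpM2l// FE; last by have /andP[] := xT.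
exact: hh.
Qed.

(** [P] obeys the integral equation for t >= 0 only. [Q] extends it to a neighbourhood of 0, so that
    two-sided derivatives make sense at the initial time. *)
Lemma duhamel_derive (P Y : R -> R) (a P0 : R) : continuous Y ->
  (forall t : R, 0 <= t -> expR (a * t) * P t = P0 + a * \int[leb]_s (\1_`[0, t]%classic s * (expR (a * s) * Y s))) ->
  exists Q : R -> R, (forall t : R, 0 <= t -> Q t = P t) /\ Q 0 = P0 /\
    forall t : R, 0 <= t -> is_derive t 1 Q (a * (Y t - Q t)).
Proof.
move=> cY hP.
have cf : continuous (fun s => expR (a * s) * Y s).
  move=> s; apply: cvgM; last exact: cY.
  apply: continuous_comp; last exact: continuous_expR.
  by apply: cvgMr; exact: cvg_id.
have [F [dF [F0 FE]]] := primitive cf.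
exists (fun t : R => expR (- a * t) * (P0 + a * F t)); split; [|split].
- move=> t t0; rewrite FE// -hP// mulrA -expRD (_ : - a * t + a * t = 0) ?expR0 ?mul1r//; ring.
- by rewrite F0 !mulr0 expR0 addr0 mul1r.
- move=> t t0; have t1 : -1 < t by apply: lt_le_trans t0; rewrite ltrN10.
  apply: isd_eq (isdM (is_derive_expM (- a) t) (isdD (isdC P0 t) (isdZ a (dF t t1)))) _.
  rewrite add0r.
  have E : expR (- a * t) * expR (a * t) = 1.
    by rewrite -expRD (_ : - a * t + a * t = 0) ?expR0//; ring.
  transitivity (a * (expR (- a * t) * expR (a * t)) * Y t - a * (expR (- a * t) * (P0 + a * F t))); first by ring.
  by rewrite E; ring.
Qed.

(** In the derivative of x^2 + y^2 the rotation [ga] cancels and [al] only dissipates. Young's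
    inequality 2 u v <= u^2 / T + T v^2 on the forcing gives the growth rate 1/T, hence a factor e
    over [0, T] instead of an exponential in T. *)
Lemma ode_energy (al ga w1 w2 x y : R -> R) (W T : R) : 0 < T -> 0 <= W ->
  (forall t : R, 0 <= t <= T -> is_derive t 1 x (- (al t * x t - ga t * y t) + w1 t)) ->
  (forall t : R, 0 <= t <= T -> is_derive t 1 y (- (al t * y t + ga t * x t) + w2 t)) ->
  (forall t : R, 0 <= t <= T -> 0 <= al t) ->
  (forall t : R, 0 <= t <= T -> w1 t ^+ 2 + w2 t ^+ 2 <= W) ->
  x 0 = 0 -> y 0 = 0 ->
  forall t : R, 0 <= t <= T -> x t ^+ 2 + y t ^+ 2 <= expR 1 * T ^+ 2 * W.
Proof.
move=> T0 W0 dx dy al0 wW x0 y0 t tT.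
pose G (t : R) := x t * x t + y t * y t.
pose dG (t : R) := (x t * (- (al t * x t - ga t * y t) + w1 t) + x t * (- (al t * x t - ga t * y t) + w1 t)) +
  (y t * (- (al t * y t + ga t * x t) + w2 t) + y t * (- (al t * y t + ga t * x t) + w2 t)).
have hG (s : R) : 0 <= s <= T -> is_derive s 1 G (dG s).
  by move=> sT; apply: isdD; apply: isdM; [exact: dx|exact: dx|exact: dy|exact: dy].
have Ti : 0 < T^-1 by rewrite invr_gt0.
have young (u v : R) : 2 * (u * v) <= T^-1 * u ^+ 2 + T * v ^+ 2.
  have := sqr_ge0 (u - T * v) => h.
  have := ler_wpM2l (ltW Ti) h.
  rewrite mulr0 (_ : T^-1 * (u - T * v) ^+ 2 = T^-1 * u ^+ 2 + T * v ^+ 2 - 2 * (u * v)) ?subr_ge0//.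
  by field; rewrite gt_eqF.
have := @gronwall_diff G dG T^-1 (T * W) T hG _ t tT.
rewrite /G -!expr2 x0 y0 expr0n /= addr0 add0r => h.
apply: le_trans (h _) _.
  move=> s sT; rewrite /dG.
  have h1 := young (x s) (w1 s); have h2 := young (y s) (w2 s).
  have h3 := al0 s sT; have h4 := wW s sT.
  have h5 : 0 <= al s * (x s ^+ 2 + y s ^+ 2) by rewrite mulr_ge0// addr_ge0// sqr_ge0.
  have h6 : T * (w1 s ^+ 2 + w2 s ^+ 2) <= T * W by rewrite ler_pM2l.
  have h7 : T * W <= expR (T^-1 * s) * (T * W).
    rewrite ler_peMl// ?mulr_ge0 ?(ltW T0)// -expR0 ler_expR mulr_ge0 ?(ltW Ti)//.
    by have /andP[] := sT.
  nra.
have /andP[t0 tT'] := tT.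
have e1 : expR (T^-1 * t) <= expR 1 by rewrite ler_expR mulrC ler_pdivrMr// mul1r.
rewrite -(mulrA (expR 1)) ler_pM ?expR_ge0// ?mulr_ge0 ?(ltW T0)//.
rewrite (_ : T * W * t = T * t * W); last ring.
by rewrite ler_wpM2r// expr2 ler_pM2l.
Qed.

End ode.

(** * The Fourier transform along characteristics *)

Section dotp.
Context {R : realType} {d : nat}.
Local Notation V := 'rV[R]_d.
Implicit Types x y z : V.

Lemma dotpDl x y z : dotp (x + y) z = dotp x z + dotp y z.
Proof. by rewrite /dotp -big_split; apply: eq_bigr => i _; rewrite !mxE mulrDl. Qed.

Lemma dotpZl (c : R) x z : dotp (c *: x) z = c * dotp x z.
Proof. by rewrite /dotp mulr_sumr; apply: eq_bigr => i _; rewrite !mxE mulrA. Qed.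

Lemma dotpZr (c : R) x z : dotp x (c *: z) = c * dotp x z.
Proof. by rewrite /dotp mulr_sumr; apply: eq_bigr => i _; rewrite !mxE mulrCA. Qed.

Lemma dotp_ge0 x : 0 <= dotp x x.
Proof. by rewrite sumr_ge0// => i _; rewrite -expr2 sqr_ge0. Qed.

Lemma enormZ (c : R) x : 0 <= c -> enorm (c *: x) = c * enorm x.
Proof.
move=> c0; rewrite /enorm dotpZl dotpZr mulrA -expr2 sqrtrM ?sqr_ge0//.
by rewrite sqrtr_sqr ger0_norm.
Qed.

Lemma enorm_ge0 x : 0 <= enorm x. Proof. exact: sqrtr_ge0. Qed.

Lemma bmeas_cos (xi : V) : Bmeas (fun x => cos (dotp x xi)).
Proof.
apply: measurableT_comp; first exact: continuous_measurable_fun (@continuous_cos R).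
by apply: vmeas_dotp; [exact: vmeas_id|exact: vmeas_cst].
Qed.

Lemma bmeas_sin (xi : V) : Bmeas (fun x => sin (dotp x xi)).
Proof.
apply: measurableT_comp; first exact: continuous_measurable_fun (@continuous_sin R).
by apply: vmeas_dotp; [exact: vmeas_id|exact: vmeas_cst].
Qed.

Lemma cos_le1n (x : R) : `|cos x| <= 1.
Proof. by rewrite ler_norml cos_geN1 cos_le1. Qed.

Lemma sin_le1n (x : R) : `|sin x| <= 1.
Proof. by rewrite ler_norml sin_geN1 sin_le1. Qed.

End dotp.

Section fourier.
Context {R : realType} {d : nat}.
Local Notation mud := (mu R d).
Local Notation V := 'rV[R]_d.
Variable f : V -> R.
Hypothesis fi : Lint mud f.

Lemma Lint_cos xi : Lint mud (fun x : V => cos (dotp x xi) * f x).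
Proof.
apply: (Lint_bddM mud 1 (fun x : V => cos (dotp x xi)) f) => //.
  exact: bmeas_cos.
by move=> x; exact: cos_le1n.
Qed.

Lemma Lint_sin xi : Lint mud (fun x : V => sin (dotp x xi) * f x).
Proof.
apply: (Lint_bddM mud 1 (fun x : V => sin (dotp x xi)) f) => //.
  exact: bmeas_sin.
by move=> x; exact: sin_le1n.
Qed.

Lemma fourier_reE xi : fourier_re f xi = \int[mud]_x (cos (dotp (x : V) xi) * f x).
Proof. by rewrite /fourier_re integE//; exact: Lint_cos. Qed.

Lemma fourier_imE xi : fourier_im f xi = - \int[mud]_x (sin (dotp (x : V) xi) * f x).
Proof. by rewrite /fourier_im integE//; exact: Lint_sin. Qed.

(** This is Re (e^(- i y.xi) f^(xi)); the sine version below is the opposite of the imaginary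
    part. *)
Lemma cos_shift_integral (y xi : V) : Lint mud (fun z : V => cos (dotp (y + z) xi) * f z) /\
  \int[mud]_z (cos (dotp (y + (z : V)) xi) * f z) =
  cos (dotp y xi) * fourier_re f xi + sin (dotp y xi) * fourier_im f xi.
Proof.
have E (z : V) : cos (dotp (y + z) xi) * f z =
  cos (dotp y xi) * (cos (dotp z xi) * f z) - sin (dotp y xi) * (sin (dotp z xi) * f z).
  by rewrite dotpDl cosD; ring.
have ic := LintZ (cos (dotp y xi)) (Lint_cos xi).
have is_ := LintZ (sin (dotp y xi)) (Lint_sin xi).
split; first by apply: (Lint_eq _ (LintB ic is_)) => z; rewrite E.
under eq_Rintegral do rewrite E.
rewrite RintegralB// !RintegralZl//; [|exact: Lint_sin|exact: Lint_cos].
by rewrite fourier_reE fourier_imE mulrN.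
Qed.

Lemma sin_shift_integral (y xi : V) : Lint mud (fun z : V => sin (dotp (y + z) xi) * f z) /\
  \int[mud]_z (sin (dotp (y + (z : V)) xi) * f z) =
  sin (dotp y xi) * fourier_re f xi - cos (dotp y xi) * fourier_im f xi.
Proof.
have E (z : V) : sin (dotp (y + z) xi) * f z =
  sin (dotp y xi) * (cos (dotp z xi) * f z) + cos (dotp y xi) * (sin (dotp z xi) * f z).
  by rewrite dotpDl sinD; ring.
have ic := LintZ (sin (dotp y xi)) (Lint_cos xi).
have is_ := LintZ (cos (dotp y xi)) (Lint_sin xi).
split; first by apply: (Lint_eq _ (LintD ic is_)) => z; rewrite E.
under eq_Rintegral do rewrite E.
rewrite RintegralD// !RintegralZl//; [|exact: Lint_sin|exact: Lint_cos].
by rewrite fourier_reE fourier_imE mulrN opprK.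
Qed.

End fourier.

Section continuity.
Context {R : realType} {d : nat}.
Local Notation mud := (mu R d).
Local Notation V := 'rV[R]_d.

(** Write psi_t v_t = psi_t (v_t - v_t0) + psi_t v_t0: the first term is controlled by L^1
    continuity, the second by dominated convergence. *)
Lemma cont_pair (psi v : R -> V -> R) (c : R) :
  (forall t, Bmeas (psi t)) -> (forall t x, `|psi t x| <= c) ->
  (forall x, continuous (psi ^~ x)) -> (forall t, Lint mud (v t)) -> L1cont v ->
  continuous (fun t : R => \int[mud]_x (psi t x * v t x)).
Proof.
move=> mpsi pc cpsi vi vc t0.
have pi (s t : R) : Lint mud (fun x : V => psi s x * v t x).
  by apply: (Lint_bddM mud c (psi s) (v t)) => //; exact: mpsi.
have c0 : 0 <= c by exact: le_trans (normr_ge0 _) (pc 0 0).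
have h1 : (fun t : R => \int[mud]_x (psi t x * v t0 x)) @ t0 --> \int[mud]_x (psi t0 x * v t0 x).
  have := @continuity_under_integral R _ (Borel R d) mud (fun t x => psi t x * v t0 x) setT measurableT
    (t0 - 1) (t0 + 1) (fun t _ => pi t t0) _ (fun x => c * `|v t0 x|) (LintZ c (Lint_norm (vi t0))).
  move=> h; apply: h.
  - apply: aeW => x _ t _; apply: cvgM; [exact: cpsi|exact: cvg_cst].
  - by move=> t _; apply: aeW => x _; rewrite normrM ler_wpM2r.
  - by rewrite inE /= in_itv /= ltrBlDr ltrDl ltr01.
have h2 : (fun t : R => \int[mud]_x (psi t x * (v t x - v t0 x))) @ t0 --> (0 : R).
  apply/norm_cvg0P.
  apply: (@squeeze_cvgr _ _ _ _ (cst 0) (fun t => c * \int[mud]_x `|v t x - v t0 x|)).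
  - apply: nearW => t; rewrite normr_ge0 /= -RintegralZl//; last by apply/Lint_norm/LintB.
    apply: norm_Rint_le; first by apply/LintZ/Lint_norm/LintB.
      by apply: measurable_funM; [exact: mpsi|apply: measurable_funB; exact: Lint_meas].
    by move=> x; rewrite normrM ler_wpM2r.
  - exact: cvg_cst.
  - have : c * \int[mud]_x `|v t x - v t0 x| @[t --> t0] --> c * 0 by apply: cvgMr; exact: vc.
    by rewrite mulr0.
have := cvgD h2 h1; rewrite add0r => h.
rewrite /continuous_at (_ : (fun t : R => \int[mud]_x (psi t x * v t x)) =
  (fun t : R => \int[mud]_x (psi t x * (v t x - v t0 x))) \+
  (fun t : R => \int[mud]_x (psi t x * v t0 x))); first exact: h.
apply/funext => t.
have di : Lint mud (fun x : V => psi t x * (v t x - v t0 x)).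
  by apply: (Lint_bddM mud c (psi t)) => //; [exact: mpsi|exact: LintB].
rewrite -[RHS]RintegralD//; apply: eq_Rintegral => x _; ring.
Qed.

Lemma continuous_scaled_dotp (x z : V) : continuous (fun t : R => dotp x (expR t *: z)).
Proof.
move=> t; under eq_fun do rewrite dotpZr.
by apply: cvgMl; exact: continuous_expR.
Qed.

Lemma cont_cos_pair (v : R -> V -> R) (z : V) : (forall t, Lint mud (v t)) -> L1cont v ->
  continuous (fun t : R => \int[mud]_x (cos (dotp (x : V) (expR t *: z)) * v t x)).
Proof.
move=> vi vc; apply: (@cont_pair (fun t x => cos (dotp x (expR t *: z))) v 1) => //.
- by move=> t; exact: bmeas_cos.
- by move=> t x; exact: cos_le1n.
- by move=> x t; apply: continuous_comp; [exact: continuous_scaled_dotp|exact: continuous_cos].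
Qed.

Lemma cont_sin_pair (v : R -> V -> R) (z : V) : (forall t, Lint mud (v t)) -> L1cont v ->
  continuous (fun t : R => \int[mud]_x (sin (dotp (x : V) (expR t *: z)) * v t x)).
Proof.
move=> vi vc; apply: (@cont_pair (fun t x => sin (dotp x (expR t *: z))) v 1) => //.
- by move=> t; exact: bmeas_sin.
- by move=> t x; exact: sin_le1n.
- by move=> x t; apply: continuous_comp; [exact: continuous_scaled_dotp|exact: continuous_sin].
Qed.

Lemma cont_fourier (v : R -> V -> R) (z : V) : (forall t, Lint mud (v t)) -> L1cont v ->
  continuous (fun t : R => fourier_re (v t) (expR t *: z)) /\
  continuous (fun t : R => fourier_im (v t) (expR t *: z)).
Proof.
move=> vi vc; split.
  by under eq_fun do rewrite fourier_reE//; exact: cont_cos_pair.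
by under eq_fun do rewrite fourier_imE//; move=> t; apply: cvgN; exact: cont_sin_pair.
Qed.

End continuity.

(** * Mass, oscillation and Fourier estimates for weak solutions *)

Section estimates.
Context {R : realType} {d : nat}.
Local Notation mud := (mu R d).
Local Notation leb := (@lebesgue_measure R).
Local Notation V := 'rV[R]_d.
Variables (a : R) (K u0 : V -> R) (v : R -> V -> R).
Hypothesis W : weak_sol a K u0 v.
Hypothesis K1 : \int[mud]_x K x = 1.
Let Ki := ws_K W. Let K0 := ws_K0 W. Let vi := ws_v W. Let vc := ws_c W.
Let a0 := ws_a W. Let u0i := ws_u0 W.
Let mK : Bmeas K := Lint_meas Ki.

Lemma L1cont_abs : L1cont (fun t x => `|v t x|).
Proof.
apply: (@L1cont_lip _ _ (fun r => `|r|)) => //.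
- by move=> b c; exact: ler_dist_dist.
- by move=> t; exact: Lint_norm.
Qed.

Lemma Lint_indic_cont (f : R -> R) (t : R) : continuous f ->
  Lint leb (fun s => \1_`[0, t]%classic s * f s).
Proof.
move=> cf; rewrite indic_patch.
have fi : leb.-integrable `[0, t]%classic (EFin \o f).
  apply: continuous_compact_integrable; first exact: segment_compact.
  exact: continuous_subspaceT.
by have := fi; rewrite integrable_mkcond// restrict_EFin.
Qed.

(** The test function is [th] times the sign of v(t), so the left side is the integral of
    [th |v t|]; since K >= 0 the sign may be dropped on the right. [th1 s] majorizes the dilated
    [th] averaged by [K]. Multiplying by e^(a t) prepares Gronwall's lemma. *)
Lemma weak_abs (t c : R) (th : V -> R) (th1 : R -> V -> R) (c1 : R) : 0 <= t ->
  Bmeas th -> (forall x, 0 <= th x <= c) ->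
  (forall s, Bmeas (th1 s)) -> (forall s x, `|th1 s x| <= c1) ->
  (forall s y, 0 <= s <= t -> \int[mud]_z (th (expR (- (t - s)) *: (y + (z : V))) * K z) <= th1 s y) ->
  continuous (fun s : R => \int[mud]_x (th1 s x * `|v s x|)) ->
  expR (a * t) * \int[mud]_x (th x * `|v t x|) <=
    \int[mud]_x (th (expR (- t) *: (x : V)) * `|u0 x|) +
    \int[leb]_s (\1_`[0, t]%classic s * (a * (expR (a * s) * \int[mud]_x (th1 s x * `|v s x|)))).
Proof.
move=> t0 mth thc mth1 thc1 hth cth.
pose sgv x := Num.sg (v t x).
pose psi x := th x * sgv x.
have th0 x : 0 <= th x by have /andP[] := thc x.
have thle x : th x <= c by have /andP[] := thc x.
have msg : Bmeas sgv.
  have mv : Bmeas (v t) := Lint_meas (vi t).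
  rewrite /sgv /Num.sg; apply: measurable_fun_ifT => //.
    exact: measurable_fun_eqr.
  by apply: measurable_fun_ifT => //; exact: measurable_fun_ltr.
have mpsi : Bmeas psi by exact: measurable_funM.
have psith x : `|psi x| <= th x.
  rewrite /psi normrM ger0_norm// -[leRHS]mulr1 ler_wpM2l//.
  by rewrite normr_sg lern1 leq_b1.
have psic x : `|psi x| <= c by exact: le_trans (psith x) (thle x).
have [wi we] := weak_form W t0 mpsi psic.
have -> : \int[mud]_x (th x * `|v t x|) = \int[mud]_x (psi x * v t x).
  by apply: eq_Rintegral => x _; rewrite /psi normrEsg mulrA.
rewrite we mulrDr mulrA -expRD (_ : a * t + - a * t = 0) ?expR0 ?mul1r; last ring.
have mth' : Bmeas (fun x : V => th (expR (- t) *: x)).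
  by vmeas.
apply: lerD.
  rewrite (le_trans (ler_norm _))//; apply: norm_Rint_le.
  - apply: (Lint_bddM mud c (fun x : V => th (expR (- t) *: x)) (fun x => `|u0 x|)) => //.
      by move=> x; rewrite ger0_norm.
    exact: Lint_norm.
  - apply: measurable_funM; last exact: Lint_meas u0i.
    by vmeas.
  - by move=> x; rewrite normrM ler_wpM2r.
have cf : continuous (fun s => a * (expR (a * s) * \int[mud]_x (th1 s x * `|v s x|))).
  move=> s; apply: cvgMr; apply: cvgM; last exact: cth.
  by apply: continuous_comp; [apply: cvgMr; exact: cvg_id|exact: continuous_expR].
rewrite mulrA -(RintegralZl _ measurableT wi).
apply: le_Rint; [exact: LintZ|exact: Lint_indic_cont|].
move=> s; rewrite indicE; case: (boolP (s \in _)) => hs; rewrite ?mul0r ?mulr0// !mul1r.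
have st : 0 <= s <= t by move: hs; rewrite inE /= in_itv.
rewrite -mulrA [leLHS]mulrCA ler_wpM2l// mulrA -expRD (_ : a * t + - a * (t - s) = a * s); last ring.
rewrite ler_wpM2l ?expR_ge0// (le_trans (ler_norm _))//.
have psiKi (y : V) : Lint mud (fun z : V => psi (expR (- (t - s)) *: (y + z)) * K z).
  apply: (Lint_bddM mud c (fun z : V => psi (expR (- (t - s)) *: (y + z))) K) => //.
  vmeas.
have thKi (y : V) : Lint mud (fun z : V => th (expR (- (t - s)) *: (y + z)) * K z).
  apply: (Lint_bddM mud c (fun z : V => th (expR (- (t - s)) *: (y + z))) K) => //.
    vmeas.
  by move=> z; rewrite ger0_norm.
apply: norm_Rint_le.
- by apply: (Lint_bddM mud c1 (th1 s)) => //; [exact: mth1|exact: Lint_norm].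
- apply: measurable_funM; first exact: Lint_meas (vi s).
  apply: (@measurable_Rint_param _ _ _ _ _ mud (fun p : Borel R d * Borel R d => psi (expR (- (t - s)) *: ((p.1 : V) + p.2)) * K p.2)).
  apply: measurable_funM.
    by vmeas.
  by vmeas.
- move=> y; rewrite normrM mulrC ler_wpM2r//.
  apply: le_trans (hth s y st).
  apply: norm_Rint_le => //; first exact: Lint_meas (psiKi y).
  by move=> z; rewrite normrM (ger0_norm (K0 z)) ler_wpM2r.
Qed.

(** Take th = 1, which averaging by a kernel of mass 1 preserves; the factor e^(a t) of Gronwall's
    lemma appears on both sides and cancels. *)
Lemma mass_bound t : 0 <= t -> \int[mud]_x `|v t x| <= \int[mud]_x `|u0 x|.
Proof.
move=> t0.
have cn : continuous (fun s : R => \int[mud]_x `|v s x|) by exact: L1cont_norm.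
pose h s := expR (a * s) * \int[mud]_x `|v s x|.
have ch : continuous h.
  move=> s; apply: cvgM; last exact: cn.
  by apply: continuous_comp; [apply: cvgMr; exact: cvg_id|exact: continuous_expR].
have E (f : V -> R) : \int[mud]_x (1 * `|f x|) = \int[mud]_x `|f x|.
  by apply: eq_Rintegral => x _; rewrite mul1r.
have := @gronwall R h a (\int[mud]_x `|u0 x|) 0 t a0 ch _ t; rewrite t0 lexx mul0r addr0.
move=> /(_ _ isT) hg; rewrite -(ler_pM2l (expR_gt0 (a * t))); apply: hg.
move=> s /andP[s0 st].
have := @weak_abs s 1 (fun _ => 1) (fun _ _ => 1) 1 s0 (bmeas_cst 1) _ (fun _ => bmeas_cst 1).
rewrite !E => hw; rewrite /h; apply: le_trans (hw _ _ _ _) _ => //.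
- by move=> x; rewrite ler01 lexx.
- by move=> s' x; rewrite normr1.
- by move=> s' y _; under eq_Rintegral do rewrite mul1r; rewrite K1.
- by under eq_fun do rewrite E.
rewrite lerD2l; under eq_Rintegral do rewrite E.
by under [leRHS]eq_Rintegral do rewrite mulr0 addr0.
Qed.

(** Averaging 1 - cos(y.xi) by [K] adds at most |1 - Re K^| + |Im K^| <= q / a, so the quantity
    grows at rate [q] however large [a] is. Dilation keeps the form of the test function and moves
    its frequency along the segment from 0 to [xi], which is why the hypothesis ranges over r in
    [0, 1]. *)
Lemma char_moment (t q : R) (xi : V) : 0 <= t -> 0 < a ->
  (forall r, 0 <= r <= 1 -> a * (`|1 - fourier_re K (r *: xi)| + `|fourier_im K (r *: xi)|) <= q) ->
  \int[mud]_x ((1 - cos (dotp (x : V) xi)) * `|v t x|) <=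
  \int[mud]_x ((1 - cos (dotp (x : V) (expR (- t) *: xi))) * `|u0 x|) + q * t * \int[mud]_x `|u0 x|.
Proof.
move=> t0 ap hq; pose z : V := expR (- t) *: xi.
have mth (x : V) : Bmeas (fun y => 1 - cos (dotp y x)).
  by apply: measurable_funB => //; exact: bmeas_cos.
have thb (x y : V) : 0 <= 1 - cos (dotp y x) <= 2.
  by have := cos_le1 (dotp y x); have := cos_geN1 (dotp y x) => *; apply/andP; split; lra.
have thn (x y : V) : `|1 - cos (dotp y x)| <= 2.
  by have /andP[h1 h2] := thb x y; rewrite ger0_norm.
pose g s := \int[mud]_x ((1 - cos (dotp (x : V) (expR s *: z))) * `|v s x|).
have cg : continuous g.
  apply: (@cont_pair _ _ (fun s x => 1 - cos (dotp x (expR s *: z))) (fun t x => `|v t x|) 2) => //.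
  - move=> x s; apply: cvgB; first exact: cvg_cst.
    by apply: continuous_comp; [exact: continuous_scaled_dotp|exact: continuous_cos].
  - by move=> s; exact: Lint_norm.
  - exact: L1cont_abs.
pose h s := expR (a * s) * g s.
have cexp : continuous (fun s : R => expR (a * s)).
  by move=> s; apply: continuous_comp; [apply: cvgMr; exact: cvg_id|exact: continuous_expR].
have ch : continuous h by move=> s; apply: cvgM; [exact: cexp|exact: cg].
have q0 : 0 <= q.
  by apply: le_trans (hq 0 _); rewrite ?lexx ?ler01// mulr_ge0// addr_ge0.
pose N := \int[mud]_x `|u0 x|.
have gE s : \int[mud]_x ((1 - cos (dotp (x : V) (expR s *: z)) + q / a) * `|v s x|) =
   g s + q / a * \int[mud]_x `|v s x|.
  rewrite -RintegralZl//; last exact: Lint_norm.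
  rewrite -RintegralD//.
  - by apply: eq_Rintegral => x _; rewrite mulrDl.
  - by apply: (Lint_bddM mud 2 (fun y => 1 - cos (dotp y (expR s *: z)))) => //; [exact: mth|exact: Lint_norm].
  - by apply: LintZ; exact: Lint_norm.
have cge : continuous (fun r : R => \int[mud]_x ((1 - cos (dotp (x : V) (expR r *: z)) + q / a) * `|v r x|)).
  rewrite (_ : (fun _ => _) = (fun r => g r + q / a * \int[mud]_x `|v r x|)); last by apply/funext.
  by move=> r; apply: cvgD; [exact: cg|apply: cvgMr; exact: L1cont_norm].
have := @gronwall R h a (\int[mud]_x ((1 - cos (dotp (x : V) z)) * `|u0 x|)) (q * N) t a0 ch _ t.
rewrite t0 lexx => /(_ _ isT) hg.
have {}hg : h t <= expR (a * t) * (\int[mud]_x ((1 - cos (dotp (x : V) z)) * `|u0 x|) + q * N * t).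
  apply: hg => s /andP[s0 st].
  apply: le_trans (@weak_abs s 2 (fun x => 1 - cos (dotp x (expR s *: z)))
    (fun r x => 1 - cos (dotp x (expR r *: z)) + q / a) (2 + q / a) s0 (mth _) (thb _) _ _ _ _) _.
  - by move=> r; apply: measurable_funD => //; exact: mth.
  - move=> r x; rewrite (le_trans (ler_normD _ _))// lerD// ger0_norm// divr_ge0// ltW//.
  - move=> r y /andP[r0 rs].
    have E (y' : V) : dotp (expR (- (s - r)) *: y') (expR s *: z) = dotp y' (expR r *: z).
      by rewrite dotpZl !dotpZr mulrA -expRD; congr (expR _ * _); ring.
    under eq_Rintegral do rewrite E mulrBl mul1r.
    have [ci ce] := cos_shift_integral Ki y (expR r *: z).
    rewrite RintegralB// ce K1.
    have : `|1 - fourier_re K (expR r *: z)| + `|fourier_im K (expR r *: z)| <= q / a.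
      rewrite ler_pdivlMr// mulrC /z scalerA -expRD; apply: hq.
      by rewrite expR_ge0 -[leRHS]expR0 ler_expR; lra.
    have := cos_le1n (dotp y (expR r *: z)); have := sin_le1n (dotp y (expR r *: z)).
    move: (cos _) (sin _) (fourier_re _ _) (fourier_im _ _) => C S F G hS hC hFG.
    (* The averaged test function is 1 - (C F + S G) = (1 - C) + C (1 - F) - S G, with |C|, |S| <=
       1. *)
    have h1 : C * (1 - F) <= `|1 - F|.
      by rewrite (le_trans (ler_norm _))// normrM -[leRHS]mul1r ler_wpM2r.
    have h2 : - (S * G) <= `|G|.
      by rewrite (le_trans (ler_norm _))// normrN normrM -[leRHS]mul1r ler_wpM2r.
    lra.
  - exact: cge.
  have E (y' : V) : dotp (expR (- s) *: y') (expR s *: z) = dotp y' z.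
    by rewrite dotpZl dotpZr mulrA -expRD addNr expR0 mul1r.
  under eq_Rintegral do rewrite E.
  rewrite lerD2l; apply: le_Rint.
  - apply: Lint_indic_cont => r; apply: cvgMr; apply: cvgM; first exact: cexp.
    exact: cge.
  - apply: Lint_indic_cont => r; apply: cvgD; first by apply: cvgMr; exact: ch.
    by apply: cvgMl; exact: cexp.
  move=> r; rewrite indicE; case: (boolP (r \in _)) => hs; rewrite ?mul0r ?mulr0// !mul1r.
  have r0 : 0 <= r by move: hs; rewrite inE /= in_itv /= => /andP[].
  rewrite gE /h; have := mass_bound r0; rewrite -/N => hN.
  have E2 : a * (expR (a * r) * (g r + q / a * \int[mud]_x `|v r x|)) =
    a * (expR (a * r) * g r) + expR (a * r) * (q * \int[mud]_x `|v r x|).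
    by field; rewrite gt_eqF.
  by rewrite E2 lerD2l ler_wpM2l ?expR_ge0// ler_wpM2l.
have gt : g t = \int[mud]_x ((1 - cos (dotp (x : V) xi)) * `|v t x|).
  by apply: eq_Rintegral => x _; rewrite /z scalerA -expRD subrr expR0 scale1r.
by move: hg; rewrite /h ler_pM2l ?expR_gt0// gt -/N [q * t * N]mulrAC.
Qed.

(** P + iQ extends u^(t, e^t z) past t = 0, as in [duhamel_derive]. The equation is - alpha (P + iQ)
    in real coordinates, with alpha = al + i ga, al = a (1 - Re K^), ga = - a Im K^, in the form
    expected by [ode_energy]. *)
Lemma fourier_ode (z : V) : exists P Q : R -> R,
  [/\ forall t, 0 <= t -> P t = fourier_re (v t) (expR t *: z),
      forall t, 0 <= t -> Q t = fourier_im (v t) (expR t *: z),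
      P 0 = fourier_re u0 z, Q 0 = fourier_im u0 z &
      forall t : R, 0 <= t ->
        is_derive t 1 P (- (a * (1 - fourier_re K (expR t *: z)) * P t - (- (a * fourier_im K (expR t *: z))) * Q t)) /\
        is_derive t 1 Q (- (a * (1 - fourier_re K (expR t *: z)) * Q t + (- (a * fourier_im K (expR t *: z))) * P t))].
Proof.
pose p s := fourier_re (v s) (expR s *: z); pose q s := fourier_im (v s) (expR s *: z).
pose k1 s := fourier_re K (expR s *: z); pose k2 s := fourier_im K (expR s *: z).
have [cp cq] : continuous p /\ continuous q := cont_fourier z vi vc.
have [ck1 ck2] : continuous k1 /\ continuous k2 := cont_fourier z (fun _ => Ki) (L1cont_cst K).
have E (s t : R) (y : V) : dotp (expR (- (t - s)) *: y) (expR t *: z) = dotp y (expR s *: z).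
  by rewrite dotpZl !dotpZr mulrA -expRD; congr (expR _ * _); ring.
have E0 (t : R) (y : V) : dotp (expR (- t) *: y) (expR t *: z) = dotp y z.
  by rewrite dotpZl !dotpZr mulrA -expRD addNr expR0 mul1r.
have Kc (s : R) : Lint mud (fun y : V => cos (dotp y (expR s *: z)) * v s y) by exact: Lint_cos.
have Ks (s : R) : Lint mud (fun y : V => sin (dotp y (expR s *: z)) * v s y) by exact: Lint_sin.
have ee (t : R) : expR (a * t) * expR (- a * t) = 1.
  by rewrite -expRD (_ : a * t + - a * t = 0) ?expR0//; ring.
have ees (t s : R) : expR (a * t) * expR (- a * (t - s)) = expR (a * s).
  by rewrite -expRD; congr expR; ring.
have hP t : 0 <= t -> expR (a * t) * p t = fourier_re u0 z +
    a * \int[leb]_s (\1_`[0, t]%classic s * (expR (a * s) * (k1 s * p s - k2 s * q s))).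
  move=> t0; have [wi we] := weak_form W t0 (bmeas_cos (expR t *: z)) (fun x => cos_le1n _).
  rewrite /p fourier_reE// we mulrDr mulrA ee mul1r fourier_reE//.
  congr (_ + _); first by apply: eq_Rintegral => y _; rewrite E0.
  rewrite mulrCA; congr (a * _); rewrite -RintegralZl//; apply: eq_Rintegral => s _.
  rewrite mulrCA; congr (_ * _); rewrite mulrA ees; congr (_ * _).
  transitivity (\int[mud]_y (k1 s * (cos (dotp (y : V) (expR s *: z)) * v s y) + k2 s * (sin (dotp (y : V) (expR s *: z)) * v s y))).
    apply: eq_Rintegral => y _; under eq_Rintegral do rewrite E.
    by have [_ ->] := cos_shift_integral Ki y (expR s *: z); rewrite -/(k1 s) -/(k2 s); ring.
  rewrite RintegralD//; [|exact: LintZ|exact: LintZ].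
  by rewrite !RintegralZl// /p /q fourier_reE// fourier_imE// mulrN opprK.
have hQ t : 0 <= t -> expR (a * t) * q t = fourier_im u0 z +
    a * \int[leb]_s (\1_`[0, t]%classic s * (expR (a * s) * (k1 s * q s + k2 s * p s))).
  move=> t0; have [wi we] := weak_form W t0 (bmeas_sin (expR t *: z)) (fun x => sin_le1n _).
  rewrite /q fourier_imE// we mulrN mulrDr mulrA ee mul1r fourier_imE// opprD.
  congr (- _ + _); first by apply: eq_Rintegral => y _; rewrite E0.
  rewrite mulrCA -mulrN; congr (a * _); rewrite -RintegralZl//.
  rewrite -mulN1r -RintegralZl//; last exact: LintZ.
  apply: eq_Rintegral => s _.
  have R4 (A B C I : R) : -1 * (A * (B * (C * I))) = B * ((A * C) * - I) by ring.
  rewrite R4 ees; congr (_ * (_ * _)).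
  transitivity (- \int[mud]_y (k1 s * (sin (dotp (y : V) (expR s *: z)) * v s y) - k2 s * (cos (dotp (y : V) (expR s *: z)) * v s y))).
    congr (- _); apply: eq_Rintegral => y _; under eq_Rintegral do rewrite E.
    by have [_ ->] := sin_shift_integral Ki y (expR s *: z); rewrite -/(k1 s) -/(k2 s); ring.
  rewrite RintegralB//; [|exact: LintZ|exact: LintZ].
  rewrite !RintegralZl// /p /q fourier_reE// fourier_imE//; ring.
have cYP : continuous (fun s => k1 s * p s - k2 s * q s).
  by move=> s; apply: cvgB; apply: cvgM; [exact: ck1|exact: cp|exact: ck2|exact: cq].
have cYQ : continuous (fun s => k1 s * q s + k2 s * p s).
  by move=> s; apply: cvgD; apply: cvgM; [exact: ck1|exact: cq|exact: ck2|exact: cp].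
have [P [PE [P0 dP]]] := duhamel_derive cYP hP.
have [Q [QE [Q0 dQ]]] := duhamel_derive cYQ hQ.
exists P, Q; split => // t t0; split.
  by apply: isd_eq (dP t t0) _; rewrite -PE// -QE// /k1 /k2; ring.
by apply: isd_eq (dQ t t0) _; rewrite -PE// -QE// /k1 /k2; ring.
Qed.

End estimates.

(** * Continuity of translations in L^1 *)

Lemma Rdct {R : realType} d0 (T : measurableType d0) (m : {measure set T -> \bar R})
  (F : nat -> T -> R) (f g : T -> R) :
  (forall n, measurable_fun setT (F n)) -> (forall n x, `|F n x| <= g x) -> Lint m g ->
  (forall x, F n x @[n --> \oo] --> f x) ->
  \int[m]_x F n x @[n --> \oo] --> \int[m]_x f x.
Proof.
move=> mF Fg gi Ff.
have mf : measurable_fun setT f by apply: (measurable_fun_cvg mF) => x _; exact: Ff.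
have fg x : `|f x| <= g x.
  have h : `|F n x| @[n --> \oo] --> `|f x| by apply: cvg_norm; exact: Ff.
  by rewrite -(cvg_lim _ h)//; apply: limr_le; [apply/cvg_ex; eexists; exact: h|apply: nearW].
have fi : Lint m f by exact: Lint_le gi.
apply: fine_cvg; rewrite fineK; last exact: integrable_fin_num.
apply: (@dominated_cvg _ _ _ m setT measurableT (fun n x => (F n x)%:E) _ (EFin \o g)) => //.
- by move=> n; exact/measurable_EFinP.
- by move=> x _; apply: cvg_EFin; [exact: nearW|exact: Ff].
- by move=> n x _ /=; rewrite lee_fin.
Qed.

Import HBSimple.

Section translation.
Context {R : realType} {d : nat}.
Local Notation mud := (mu R d).
Local Notation V := 'rV[R]_d.

Lemma Lint_shift (h : V) (f : V -> R) : Lint mud f ->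
  Lint mud (fun x : V => f (x - h)) /\ \int[mud]_x f ((x : V) - h) = \int[mud]_x f x.
Proof.
move=> fi; have [i1 e1] := @Lint_aff R d 1 (- h) f (oner_neq0 _) fi.
split; first by apply: (Lint_eq _ i1) => x; rewrite scale1r.
move: e1; rewrite normr1 invr1 expr1n mul1r => <-.
by apply: eq_Rintegral => x _; rewrite scale1r.
Qed.

(** Continuity of translations in L^1, along sequences, since it is used for shifts [kap n *: w]
    tending to 0. *)
Definition transc (f : V -> R) := forall h : nat -> V, h n @[n --> \oo] --> (0 : V) ->
  \int[mud]_x `|f ((x : V) - h n) - f x| @[n --> \oo] --> (0 : R).

(** A point of an open set stays in it after small shifts, so the positive part of 1_O(x) - 1_O(x -
    h) tends to 0 pointwise and, being at most 1_O, in L^1. Both indicators have the same integral,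
    hence the L^1 distance is twice the integral of this positive part. *)
Lemma transc_open (O : set V) : open O -> Lint mud (\1_O : V -> R) -> transc (\1_O : V -> R).
Proof.
move=> oO Oi h h0.
have [sh1 sh2] : (forall n, Lint mud (fun x : V => (\1_O (x - h n) : R))) /\
   (forall n, \int[mud]_x (\1_O ((x : V) - h n) : R) = \int[mud]_x (\1_O x : R)).
  by split => n; have [] := Lint_shift (h n) Oi.
pose D n (x : V) : R := Num.max ((\1_O x : R) - \1_O (x - h n)) 0.
have D0 n x : 0 <= D n x := max0_ge0 _.
have DO n x : `|D n x| <= \1_O x.
  rewrite ger0_norm// ge_max !indicE ler0n andbT.
  by case: (_ \in O); case: (_ \in O); rewrite ?subr0 ?subrr ?sub0r ?ler01 ?lexx ?lerN10// (le_trans (lerN10 _) _)// ler01.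
have mO : Bmeas (\1_O : V -> R) := Lint_meas Oi.
have mD n : Bmeas (D n).
  apply: measurable_maxr => //; apply: measurable_funB => //; exact: Lint_meas (sh1 n).
have Di n : Lint mud (D n) by apply: Lint_le Oi => //; exact: mD.
have Dc : \int[mud]_x D n x @[n --> \oo] --> \int[mud]_x (0 : R).
  apply: (@Rdct _ _ _ mud D (fun _ => 0) (\1_O : V -> R)) => // x.
  have [xO|xO] := pselect (O x); last first.
    rewrite (_ : D ^~ x = fun _ => 0); first exact: cvg_cst.
    apply/funext => n; apply/eqP; rewrite eq_le D0 andbT -(_ : \1_O x = 0 :> R).
      by rewrite (le_trans (ler_norm _) (DO n x)).
    by rewrite indicE memNset.
  apply: cvg_near_cst.
  have xh : (x - h n : V) @[n --> \oo] --> x.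
    rewrite -[X in _ --> X]subr0; apply: cvgB => //; exact: cvg_cst.
  have hO : \forall n \near \oo, O (x - h n) := xh O (open_nbhs_nbhs (conj oO xO)).
  apply: filterS hO => n /= hn.
  by rewrite /D !indicE !mem_set// subrr maxxx.
rewrite Rintegral_cst// mul0r in Dc.
have E n : \int[mud]_x `|(\1_O ((x : V) - h n) : R) - \1_O x| = 2 * \int[mud]_x D n x.
  transitivity (\int[mud]_x (((\1_O ((x : V) - h n) : R) - \1_O x) + 2 * D n x)).
    apply: eq_Rintegral => x _; rewrite /D !indicE.
    case: (_ \in O); case: (_ \in O) => /=.
    - by rewrite !subrr maxxx normr0; lra.
    - by rewrite subr0 sub0r normr1 max_r; lra.
    - by rewrite subr0 sub0r normrN1 max_l; lra.
    - by rewrite !subrr maxxx normr0; lra.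
  rewrite RintegralD//; [|exact: LintB|exact: LintZ].
  by rewrite RintegralB// sh2 subrr add0r RintegralZl.
rewrite (_ : (fun n => _) = fun n => 2 * \int[mud]_x D n x); last exact/funext.
by rewrite -(mulr0 2); apply: cvgMr; exact: Dc.
Qed.

(** Shifting preserves the L^1 norm, so the approximation error is paid twice and the translation of
    [g] once; thus e / 4 is enough. *)
Lemma transc_lim (f : V -> R) : Lint mud f ->
  (forall e, 0 < e -> exists g : V -> R, [/\ Lint mud g, transc g & \int[mud]_x `|f x - g x| <= e]) ->
  transc f.
Proof.
move=> fi hf h h0; apply/cvgrPdist_le => e e0.
have e4 : 0 < e / 4 by rewrite divr_gt0.
have [g [gi gc ge]] := hf _ e4.
have /cvgrPdist_le/(_ _ e4) := gc h h0.
apply: filterS => n; rewrite !sub0r !normrN !ger0_norm ?Rintegral_ge0// => hn.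
have fgi : Lint mud (fun x : V => `|f x - g x|) by apply/Lint_norm/LintB.
have [s1 s2] := Lint_shift (h n) fgi.
have [g1 _] := Lint_shift (h n) gi.
have [f1 _] := Lint_shift (h n) fi.
have g2 : Lint mud (fun x : V => `|g (x - h n) - g x|) by apply/Lint_norm/LintB.
apply: (@le_trans _ _ (\int[mud]_x ((`|f ((x : V) - h n) - g (x - h n)| + `|g (x - h n) - g x|) + `|f x - g x|))).
  apply: le_Rint.
  - by apply/Lint_norm/LintB.
  - by apply: LintD => //; apply: LintD.
  - move=> x; rewrite [`|f x - _|]distrC.
    have -> : f ((x : V) - h n) - f x = (f (x - h n) - g (x - h n)) + (g (x - h n) - g x) + (g x - f x) by ring.
    by rewrite (le_trans (ler_normD _ _))// lerD2r ler_normD.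
rewrite RintegralD//; last exact: LintD.
rewrite RintegralD// s2; lra.
Qed.

Lemma transc_comb (a : R) (f g : V -> R) : Lint mud f -> Lint mud g -> transc f -> transc g ->
  transc (fun x => f x + a * g x).
Proof.
move=> fi gi cf cg h h0.
apply: (@squeeze_cvgr _ _ _ _ (cst 0) (fun n => \int[mud]_x `|f ((x : V) - h n) - f x| +
   `|a| * \int[mud]_x `|g ((x : V) - h n) - g x|)).
- apply: nearW => n; rewrite Rintegral_ge0//=.
  have [g1 _] := Lint_shift (h n) gi.
  have [f1 _] := Lint_shift (h n) fi.
  have g2 : Lint mud (fun x : V => `|g (x - h n) - g x|) by apply/Lint_norm/LintB.
  have f2 : Lint mud (fun x : V => `|f (x - h n) - f x|) by apply/Lint_norm/LintB.
  rewrite -RintegralZl// -RintegralD//; last exact: LintZ.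
  apply: le_Rint.
  + by apply/Lint_norm/LintB; apply: LintD => //; exact: LintZ.
  + by apply: LintD => //; exact: LintZ.
  + move=> x; rewrite -normrM; apply: le_trans (ler_normD _ _).
    by apply: le_of_eq; congr (`|_|); ring.
- exact: cvg_cst.
- rewrite -(addr0 0) -{2}(mulr0 `|a|); apply: cvgD; first exact: cf.
  by apply: cvgMr; exact: cg.
Qed.

Definition box (N : R) : set V := [set x | forall i, `|x 0 i| < N].

Lemma open_box N : open (box N).
Proof.
rewrite openE => x xN; rewrite /interior.
have h : \forall y \near x, forall i : 'I_d, `|(y : V) 0 i| < N.
  apply: (@filter_forall _ 'I_d (fun i (y : V) => `|y 0 i| < N) (nbhs x)) => i.
  have c : `|(y : V) 0 i| @[y --> x] --> `|x 0 i|.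
    exact: (@continuous_comp _ _ _ (fun y : V => y 0 i) Num.norm x (@coord_continuous _ _ _ 0 i x) (@norm_continuous _ _ _)).
  exact: cvgr_lt c _ (xN i).
exact: h.
Qed.

Lemma measurable_box N : measurable (box N : set (Borel R d)).
Proof. by apply: open_borel; exact: open_box. Qed.

(** Established as [Lint_box] once tensor products can be integrated. *)
Hypothesis box_Lint : forall N, Lint mud (\1_(box N) : V -> R).

Lemma Lint_indicI N (A : set (Borel R d)) : measurable A -> Lint mud (\1_(A `&` box N) : V -> R).
Proof.
move=> mA; apply: Lint_le (box_Lint N).
  by apply: measurable_indic; apply: measurableI => //; exact: measurable_box.
move=> x; rewrite ger0_norm// !indicE in_setI; case: (x \in A) => //=; exact: ler0n.
Qed.

(** The sets with this property form a Dynkin class containing the open sets, which are stable under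
    intersection and generate the Borel sets. Intersecting with a cube keeps all indicators
    integrable. *)
Lemma transc_borel N (A : set (Borel R d)) : measurable A -> transc (\1_(A `&` box N) : V -> R).
Proof.
move: A; apply: (@dynkin_induction _ (Borel R d) (@open V) (fun A => transc (\1_(A `&` box N) : V -> R))) => //.
- by move=> A B; exact: openI.
- by rewrite setTI; apply: transc_open => //; exact: open_box.
- move=> A oA; apply: transc_open; first by apply: openI => //; exact: open_box.
  by apply: Lint_indicI; exact: open_borel.
- move=> A mA tA.
  rewrite (_ : \1_(~` A `&` box N) = fun x : V => (\1_(box N) x : R) + (-1) * \1_(A `&` box N) x).
    apply: transc_comb => //; first exact: Lint_indicI.
    by apply: transc_open => //; exact: open_box.
  apply/funext => x; rewrite !indicE !in_setI in_setC.
  by case: (x \in A); case: (x \in box N) => /=; lra.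
- move=> F mF tF PF.
  pose S n (x : V) : R := \1_((\big[setU/set0]_(k < n) F k) `&` box N) x.
  have mS n : measurable (\big[setU/set0]_(k < n) F k : set (Borel R d)) by exact: bigsetU_measurable.
  have Si n : Lint mud (S n) by exact: Lint_indicI.
  have tS n : transc (S n).
    elim: n => [|n IH].
      rewrite /S big_ord0 set0I indic0 => h h0.
      rewrite (_ : (fun n => _) = fun _ => 0); first exact: cvg_cst.
      by apply/funext => k; under eq_Rintegral do rewrite subrr normr0; rewrite Rintegral_cst// mul0r.
    rewrite (_ : S n.+1 = fun x => S n x + 1 * \1_(F n `&` box N) x).
      by apply: transc_comb => //; exact: Lint_indicI.
    apply/funext => x; rewrite /S big_ord_recr /= !indicE !in_setI in_setU mul1r.
    case: (boolP (x \in F n)) => xF; last by rewrite orbF addr0.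
    rewrite orbT /= (_ : (x \in \big[setU/set0]_(i < n) F i) = false) ?add0r//.
    apply/negbTE/negP; rewrite inE -bigcup_mkord => -[k /= kn Fk].
    have /trivIsetP/(_ k n I I) := tF; rewrite neq_ltn kn => /(_ isT) /seteqP[+ _] => /(_ x); apply.
    by split => //; move: xF; rewrite inE.
  have Ui : Lint mud (\1_(\bigcup_k F k `&` box N) : V -> R).
    by apply: Lint_indicI; exact: bigcup_measurable.
  apply: transc_lim => // e e0.
  have : \int[mud]_x `|(\1_(\bigcup_k F k `&` box N) x : R) - S n x| @[n --> \oo] --> \int[mud]_x (0 : R).
    apply: (@Rdct _ _ _ mud (fun n x => `|(\1_(\bigcup_k F k `&` box N) x : R) - S n x|) (fun _ => 0) (\1_(box N) : V -> R)) => //.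
    + by move=> n; apply: (@Lint_meas _ _ _ mud); apply/Lint_norm/LintB.
    + move=> n x; rewrite normr_id /S !indicE !in_setI.
      case: (x \in box N); rewrite ?andbF ?andbT ?subrr ?normr0//.
      by case: (_ \in _); case: (_ \in _); rewrite /= ?subrr ?normr0 ?subr0 ?sub0r ?normrN ?normr1.
    + move=> x; apply: cvg_near_cst.
      have [[k _ Fk]|nF] := pselect ((\bigcup_k F k) x); last first.
        apply: nearW => n; rewrite /S !indicE !in_setI (memNset nF) /= memNset ?subrr ?normr0//.
        by rewrite -bigcup_mkord => -[j _ Fj]; apply: nF; exists j.
      exists k.+1 => // n /= kn; rewrite /S !indicE !in_setI mem_set; last by exists k.
      rewrite (@mem_set _ (\big[setU/set0]_(i < n) F i)) ?subrr ?normr0//.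
      by rewrite -bigcup_mkord; exists k.
  rewrite Rintegral_cst// mul0r => /cvgrPdist_le/(_ _ e0)[n _ hn].
  exists (S n); split => //.
  by have := hn n (leqnn n); rewrite sub0r normrN ger0_norm ?Rintegral_ge0.
Qed.

Lemma box_cover (x : V) : \forall n \near \oo, box n%:R x.
Proof.
apply: (@filter_forall _ _ (fun (i : 'I_d) n => `|x 0 i| < n%:R)) => i.
exact: nbhs_infty_gtr.
Qed.

(** [f] is cut to a large cube and then approximated by a simple function, which inside the cube is
    a finite combination of the indicators of [transc_borel]. *)
Lemma transc_Lint (f : V -> R) : Lint mud f -> transc f.
Proof.
move=> fi; have mf : Bmeas f := Lint_meas fi.
apply: transc_lim => // e e0; have e2 : 0 < e / 2 by rewrite divr_gt0.
pose fN n (x : V) := \1_(box n%:R) x * f x.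
have fNi n : Lint mud (fN n).
  apply: (Lint_bddM mud 1 (\1_(box n%:R) : V -> R)) => //.
    exact: measurable_indic (measurable_box _).
  by move=> x; rewrite indicE ger0_norm// lern1 leq_b1.
have : \int[mud]_x `|f x - fN n x| @[n --> \oo] --> \int[mud]_x (0 : R).
  apply: (@Rdct _ _ _ mud (fun n x => `|f x - fN n x|) (fun _ => 0) (fun x => `|f x|)) => //.
  - by move=> n; apply: (@Lint_meas _ _ _ mud); apply/Lint_norm/LintB.
  - move=> n x; rewrite normr_id /fN indicE.
    by case: (_ \in _); rewrite ?mul1r ?mul0r ?subrr ?subr0 ?normr0.
  - exact: Lint_norm.
  - move=> x; apply: cvg_near_cst; apply: filterS (box_cover x) => n xn.
    by rewrite /fN indicE mem_set// mul1r subrr normr0.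
rewrite Rintegral_cst// mul0r => /cvgrPdist_le/(_ _ e2)[N _ hN].
have {hN} := hN N (leqnn N); rewrite sub0r normrN ger0_norm ?Rintegral_ge0// => hN.
have [g_ [gi _ gc]] := approximation_sfun_integrable measurableT fi.
have gd n : Lint mud (fun x : V => `|f x - g_ n x|) by apply/Lint_norm/LintB.
have [n hn] : exists n, \int[mud]_x `|f x - g_ n x| <= e / 2.
  have /fine_cvgP[_] := gc; move=> /cvgrPdist_le/(_ _ e2)[n _ hn]; exists n.
  by have := hn n (leqnn n); rewrite /= sub0r normrN ger0_norm// fine_ge0// integral_ge0.
pose g (x : V) : R := \1_(box N%:R) x * g_ n x.
have gi' : Lint mud g.
  apply: (Lint_bddM mud 1 (\1_(box N%:R) : V -> R)) => //.
    exact: measurable_indic (measurable_box _).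
  by move=> x; rewrite indicE ger0_norm// lern1 leq_b1.
exists g; split => //; last first.
  apply: (@le_trans _ _ (\int[mud]_x (`|f x - fN N x| + `|f x - g_ n x|))).
    apply: le_Rint.
    - by apply/Lint_norm/LintB.
    - by apply: LintD; [apply/Lint_norm/LintB|exact: gd].
    - move=> x; rewrite /g /fN indicE; case: (_ \in _); rewrite ?mul1r ?mul0r ?subrr ?normr0 ?add0r// subr0.
      by rewrite lerDl.
  rewrite RintegralD//; last by apply/Lint_norm/LintB.
  lra.
have E : g = fun x => \sum_(y \in range (g_ n)) (y * \1_(g_ n @^-1` [set y] `&` box N%:R) x).
  apply/funext => x; rewrite /g (fimfunE (g_ n)) !fsbig_finite//= mulr_sumr; apply: eq_bigr => y _.
  rewrite mulrCA !indicE in_setI; by case: (_ \in _); case: (_ \in _); rewrite /= ?mulr1 ?mulr0.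
rewrite E => {E}.
have mg y : measurable (g_ n @^-1` [set y] : set (Borel R d)).
  by rewrite -[X in measurable X]setTI; exact: measurable_funPT.
rewrite (_ : (fun x => _) = fun x : V => \sum_(y <- finmap.enum_fset (fset_set (range (g_ n)))) (y * \1_(g_ n @^-1` [set y] `&` box N%:R) x)); last first.
  by apply/funext => x; rewrite fsbig_finite.
suff : forall s : seq R, Lint mud (fun x : V => \sum_(y <- s) (y * (\1_(g_ n @^-1` [set y] `&` box N%:R) x : R))) /\
  transc (fun x : V => \sum_(y <- s) (y * (\1_(g_ n @^-1` [set y] `&` box N%:R) x : R))).
  by case/(_ (finmap.enum_fset (fset_set (range (g_ n))))).
elim => [|y s [IH1 IH2]].
  under [fun x => _]eq_fun do rewrite big_nil.
  split; first by exact: integrable0.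
  move=> h h0; rewrite (_ : (fun n => _) = fun _ => 0); first exact: cvg_cst.
  by apply/funext => k; under eq_Rintegral do rewrite subrr normr0; rewrite Rintegral_cst// mul0r.
rewrite (_ : (fun x => _) = fun x : V => \sum_(y <- s) (y * (\1_(g_ n @^-1` [set y] `&` box N%:R) x : R)) +
  y * (\1_(g_ n @^-1` [set y] `&` box N%:R) x : R)); last first.
  by apply/funext => x; rewrite big_cons addrC.
have i1 : Lint mud (\1_(g_ n @^-1` [set y] `&` box N%:R) : V -> R) by exact: Lint_indicI.
split; first by apply: LintD => //; exact: LintZ.
by apply: transc_comb => //; exact: transc_borel.
Qed.

End translation.

(** * Duality with the Cauchy kernel *)

Section line.
Context {R : realType}.
Local Notation leb := (@lebesgue_measure R).

Definition lap (x : R) : R := expR (- `|x|).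

Lemma continuous_lap : continuous lap.
Proof.
move=> x; apply: continuous_comp; last exact: continuous_expR.
by apply: continuousN; exact: norm_continuous.
Qed.

Lemma continuous_cosM (z : R) : continuous (fun x : R => cos (z * x)).
Proof.
move=> x; apply: continuous_comp; last exact: continuous_cos.
exact: mulrl_continuous.
Qed.

Lemma continuous_sinM (z : R) : continuous (fun x : R => sin (z * x)).
Proof.
move=> x; apply: continuous_comp; last exact: continuous_sin.
exact: mulrl_continuous.
Qed.

(** The summand 1 makes the integrand nonnegative, as the fundamental theorem on the half-line
    requires; the case z = 0 then allows it to be subtracted again. *)
Lemma lap_cos_integral (z : R) :
  (\int[leb]_x (lap x * (1 + cos (z * x)))%:E = (2 * (1 + (1 + z ^+ 2)^-1))%:E)%E.
Proof.
have z1 : 1 + z ^+ 2 != 0 by rewrite gt_eqF// ltr_pwDl// sqr_ge0.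
rewrite ge0_symfun_integralT; first last.
- by move=> x /=; rewrite /lap normrN mulrN cosN.
- move=> x; apply: continuousM; first exact: continuous_lap.
  by apply: continuousD; [exact: cst_continuous|exact: continuous_cosM].
- by move=> x; rewrite mulr_ge0 ?expR_ge0// -lerBlDl sub0r cos_geN1.
rewrite -set_itvcy.
(* An explicit primitive on the half-line x >= 0, where |x| = x; it vanishes at infinity. *)
pose F (x : R) : R := expR (-1 * x) * (-1 + (1 + z ^+ 2)^-1 * (z * sin (z * x) - cos (z * x))).
have dF (x : R) : is_derive x 1 F (expR (- x) * (1 + cos (z * x))).
  have hz : is_derive x 1 (fun s : R => z * s) z by apply: isd_eq (isdZ z (isdI x)) _; rewrite mulr1.
  have hs := is_derive1_comp (is_derive_sin (z * x)) hz.
  have hc := is_derive1_comp (is_derive_cos (z * x)) hz.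
  have h := isdM (is_derive_expM (-1) x) (isdD (isdC (-1) x) (isdZ (1 + z ^+ 2)^-1 (isdD (isdZ z hs) (isdZ (-1) hc)))).
  have E : F = fun s : R => expR (-1 * s) * (-1 + (1 + z ^+ 2)^-1 * (z * (sin \o [eta *%R z]) s + -1 * (cos \o [eta *%R z]) s)).
    by apply/funext => s; rewrite /F /=; congr (_ * (_ + _ * (_ + _))); rewrite mulN1r.
  rewrite E; apply: isd_eq h _ => /=; rewrite !mulN1r /GRing.scale /=.
  by field.
rewrite (@ge0_continuous_FTC2y _ _ F 0 0).
- rewrite /F mulr0 expR0 mulr0 sin0 cos0 mulr0 mul1r -EFinB -EFinM; congr EFin; field.
- by rewrite z1.
- by move=> x _; rewrite mulr_ge0 ?expR_ge0// -lerBlDl sub0r cos_geN1.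
- apply: continuous_subspaceT => x; apply: continuousM; first exact: continuous_lap.
  by apply: continuousD; [exact: cst_continuous|exact: continuous_cosM].
- apply: (@squeeze_cvgr _ _ _ _ (fun x : R => - ((2 + `|z|) * expR (- x))) (fun x : R => (2 + `|z|) * expR (- x))).
  + apply: nearW => x; rewrite -ler_norml /F mulN1r normrM (ger0_norm (expR_ge0 _)) mulrC ler_wpM2r ?expR_ge0//.
    apply: le_trans (ler_normD _ _) _; rewrite normrN1 -[2 + _]/(1 + 1 + _) -addrA lerD2l normrM.
    rewrite -[leRHS]mul1r ler_pM//.
      by rewrite normfV ger0_norm ?addr_ge0 ?sqr_ge0// invf_le1 ?ltr_pwDl ?sqr_ge0// lerDl sqr_ge0.
    by rewrite (le_trans (ler_normB _ _))// addrC lerD ?cos_le1n// normrM ler_piMr// sin_le1n.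
  + by rewrite -oppr0 -(mulr0 (2 + `|z|)); apply: cvgN; apply: cvgMr; exact: cvgr_expR.
  + by rewrite -(mulr0 (2 + `|z|)); apply: cvgMr; exact: cvgr_expR.
- by move=> x _; have [] := dF x.
- apply: cvg_at_right_filter; apply: differentiable_continuous; apply/derivable1_diffP.
  by have [] := dF 0.
- move=> x; rewrite in_itv /= andbT => x0.
  by rewrite derive1E derive_val /lap ger0_norm// ltW.
Qed.

Lemma Lint_lap : Lint leb lap /\ \int[leb]_x lap x = 2.
Proof.
have h : (\int[leb]_x (lap x)%:E = 2%:E)%E.
  have := lap_cos_integral 0.
  under eq_integral do rewrite mul0r cos0 mulrC EFinM.
  rewrite ge0_integralZl//; last 2 first.
  - by apply/measurable_EFinP; exact: continuous_measurable_fun continuous_lap.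
  - by move=> x _; rewrite lee_fin expR_ge0.
  rewrite expr0n /= addr0 invr1 => h.
  have {}h : (2%:E * \int[leb]_x (lap x)%:E = 2%:E * 2%:E)%E by rewrite h.
  have : (2^-1%:E * (2%:E * \int[leb]_x (lap x)%:E) = 2%:E)%E.
    by rewrite h -!EFinM mulrA mulVf// mul1r.
  by rewrite muleA -EFinM mulVf// mul1e.
split; last by rewrite /Rintegral h.
apply/LintP; split; first exact: continuous_measurable_fun continuous_lap.
by under eq_integral => x _ do rewrite ger0_norm ?expR_ge0//; rewrite h ltry.
Qed.

Lemma lap_cos (z : R) : Lint leb (fun x => cos (z * x) * lap x) /\
  \int[leb]_x (cos (z * x) * lap x) = 2 * (1 + z ^+ 2)^-1.
Proof.
have [li l2] := Lint_lap.
have ci : Lint leb (fun x => cos (z * x) * lap x).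
  apply: (Lint_bddM leb 1 (fun x => cos (z * x))) => //.
    by apply: continuous_measurable_fun; exact: continuous_cosM.
  by move=> x; exact: cos_le1n.
split => //; have := lap_cos_integral z.
have E x : lap x * (1 + cos (z * x)) = lap x + cos (z * x) * lap x by ring.
under eq_integral do rewrite E.
rewrite RintE; last exact: LintD.
by rewrite RintegralD// l2 => -[]; lra.
Qed.

(** By parity. Invariance under x -> - x is available for nonnegative functions, hence the detour
    through 1 + sin. *)
Lemma lap_sin (z : R) : Lint leb (fun x => sin (z * x) * lap x) /\
  \int[leb]_x (sin (z * x) * lap x) = 0.
Proof.
have [li _] := Lint_lap.
have ci : Lint leb (fun x => sin (z * x) * lap x).
  apply: (Lint_bddM leb 1 (fun x => sin (z * x))) => //.
    by apply: continuous_measurable_fun; exact: continuous_sinM.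
  by move=> x; exact: sin_le1n.
split => //.
have i1 : Lint leb (fun x => (1 + sin (z * x)) * lap x).
  by apply: (Lint_eq _ (LintD li ci)) => x; rewrite mulrDl mul1r.
have : \int[leb]_x ((1 + sin (z * - x)) * lap (- x)) = \int[leb]_x ((1 + sin (z * x)) * lap x).
  congr fine; rewrite (lebesgue_integral_opp (f := fun x => ((1 + sin (z * x)) * lap x)%:E))//.
    by apply/measurable_EFinP; exact: Lint_meas i1.
  by move=> x; rewrite lee_fin mulr_ge0 ?expR_ge0// -lerBlDl sub0r sin_geN1.
rewrite (_ : \int[leb]_x ((1 + sin (z * - x)) * lap (- x)) = \int[leb]_x (lap x) - \int[leb]_x (sin (z * x) * lap x)); last first.
  by rewrite -RintegralB//; apply: eq_Rintegral => x _; rewrite /lap normrN mulrN sinN mulrDl mul1r mulNr.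
rewrite (_ : \int[leb]_x ((1 + sin (z * x)) * lap x) = \int[leb]_x (lap x) + \int[leb]_x (sin (z * x) * lap x)); last first.
  by rewrite -RintegralD//; apply: eq_Rintegral => x _; rewrite mulrDl mul1r.
lra.
Qed.

Definition cauchy_ker (z : R) : R := 2 * (1 + z ^+ 2)^-1.

Lemma cauchy_ker_ge0 z : 0 <= cauchy_ker z.
Proof. by rewrite mulr_ge0// invr_ge0 addr_ge0// sqr_ge0. Qed.

Lemma Lint_cauchy_ker : Lint leb cauchy_ker /\ 0 < \int[leb]_x cauchy_ker x.
Proof.
have c1 : continuous (fun z : R => (1 + z ^+ 2)^-1) by exact: continuous_oneDsqrV.
have h : (\int[leb]_x ((1 + x ^+ 2)^-1)%:E = pi%:E)%E.
  rewrite ge0_symfun_integralT//; last 2 first.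
  - by move=> x; rewrite invr_ge0 addr_ge0// sqr_ge0.
  - by move=> x /=; rewrite sqrrN.
  by rewrite -set_itvcy integral0y_oneDsqr -EFinM mulrCA divff ?mulr1.
have hi : Lint leb (fun z : R => (1 + z ^+ 2)^-1).
  apply/LintP; split; first exact: continuous_measurable_fun.
  by under eq_integral => x _ do rewrite ger0_norm ?invr_ge0 ?addr_ge0 ?sqr_ge0//; rewrite h ltry.
split; first exact: LintZ.
by rewrite RintegralZl// mulr_gt0// /Rintegral h /= pi_gt0.
Qed.

End line.

Lemma Lint_mul_prod {R : realType} d1 d2 (T1 : measurableType d1) (T2 : measurableType d2)
  (m1 : {sigma_finite_measure set T1 -> \bar R}) (m2 : {sigma_finite_measure set T2 -> \bar R})
  (f1 : T1 -> R) (f2 : T2 -> R) : Lint m1 f1 -> Lint m2 f2 ->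
  Lint (m1 \x m2)%E (fun p => f1 p.1 * f2 p.2).
Proof.
move=> i1 i2; apply: Lint_prod.
  apply: measurable_funM.
    by apply: (measurableT_comp (Lint_meas i1)); exact: measurable_fst.
  by apply: (measurableT_comp (Lint_meas i2)); exact: measurable_snd.
rewrite (_ : (\int[m1]_x _)%E = (\int[m1]_x (`|f1 x| * \int[m2]_y `|f2 y|))%:E); first exact: ltry.
rewrite -RintE; last first.
  by apply: (@Lint_eq _ _ _ m1 (fun x => \int[m2]_y `|f2 y| * `|f1 x|)); [move=> x; rewrite mulrC|apply: LintZ; exact: Lint_norm].
apply: eq_integral => x _ /=; under eq_integral do rewrite normrM.
rewrite RintE; last by apply: LintZ; exact: Lint_norm.
by rewrite RintegralZl//; exact: Lint_norm.
Qed.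

Section tensor.
Context {R : realType}.
Local Notation leb := (@lebesgue_measure R).

Lemma Lint_muS d (f : 'rV[R]_d.+1 -> R) : Bmeas f ->
  Lint (leb \x mu R d)%E (fun p => f (row_cons p.1 p.2)) ->
  Lint (mu R d.+1) f /\
  \int[mu R d.+1]_x f x = \int[(leb \x mu R d)%E]_p f (row_cons p.1 p.2).
Proof.
move=> mf fi.
have mrow (h : 'rV[R]_d.+1 -> R) : Bmeas h ->
  measurable_fun setT (fun p : measurableTypeR R * Borel R d => h (row_cons p.1 p.2)).
  by move=> mh; exact: (measurableT_comp mh (@measurable_row_mx R d)).
have key (h : 'rV[R]_d.+1 -> R) : Bmeas h -> (forall x, 0 <= h x) ->
  (\int[mu R d.+1]_x (h x)%:E = \int[leb \x mu R d]_p (h (row_cons p.1 p.2))%:E)%E.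
  move=> mh h0; rewrite (@integral_muS R d (fun x => (h x)%:E))//; last exact/measurable_EFinP.
  rewrite (@fubini_tonelli1 _ _ _ _ R leb (mu R d) (fun p => (h (row_cons p.1 p.2))%:E))//; last by move=> p; rewrite lee_fin.
  by apply/measurable_EFinP; exact: mrow.
have Fi : Lint (mu R d.+1) f.
  apply/LintP; split => //.
  rewrite (key (fun x => `|f x|))//; first by case: ((LintP _ _).1 fi).
  exact: measurableT_comp.
split => //; rewrite (Rint_posneg Fi) (Rint_posneg fi).
congr (_ - _); congr fine.
- apply: (key (fun x => Num.max (f x) 0)); first exact: measurable_maxr.
  by move=> x; exact: max0_ge0.
- apply: (key (fun x => Num.max (- f x) 0)).
    by apply: measurable_maxr => //; exact: measurable_funN.
  by move=> x; exact: max0_ge0.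
Qed.

Lemma tl_row d (x : R) (y : 'rV[R]_d) : tl (row_cons x y) = y.
Proof. exact: row_mxKr. Qed.

Lemma Lint_tensor d (f1 : R -> R) (f2 : 'rV[R]_d -> R) : Lint leb f1 -> Lint (mu R d) f2 ->
  Lint (mu R d.+1) (fun z : 'rV[R]_d.+1 => f1 (hd z) * f2 (tl z)) /\
  \int[mu R d.+1]_z (f1 (hd (z : 'rV[R]_d.+1)) * f2 (tl (z : 'rV[R]_d.+1))) = \int[leb]_x f1 x * \int[mu R d]_y f2 y.
Proof.
move=> i1 i2.
have Fi := Lint_mul_prod i1 i2.
have mF : Bmeas (fun z : 'rV[R]_d.+1 => f1 (hd z) * f2 (tl z)).
  apply: measurable_funM.
    by apply: (measurableT_comp (Lint_meas i1)); exact: measurable_hd.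
  by apply: (measurableT_comp (Lint_meas i2)); exact: measurable_tl.
have [|j1 ->] := @Lint_muS d _ mF.
  by apply: (Lint_eq _ Fi) => p; rewrite hd_row tl_row.
split => //.
under eq_Rintegral do rewrite hd_row tl_row.
rewrite -(Rfubini1 Fi).2 /=.
under eq_Rintegral do rewrite RintegralZl// mulrC.
by rewrite RintegralZl// mulrC.
Qed.

Lemma dotpS d (x z : 'rV[R]_d.+1) : dotp x z = hd x * hd z + dotp (tl x) (tl z).
Proof.
rewrite /dotp big_ord_recl; congr (_ + _); apply: eq_bigr => i _.
by rewrite /tl !mxE; congr (x _ _ * z _ _); exact/val_inj.
Qed.

Definition prodf (phi : R -> R) d (x : 'rV[R]_d) : R := \prod_(i < d) phi (x 0 i).

Lemma prodfS phi d (z : 'rV[R]_d.+1) : prodf phi z = phi (hd z) * prodf phi (tl z).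
Proof.
rewrite /prodf big_ord_recl; congr (_ * _); apply: eq_bigr => i _.
by rewrite /tl !mxE; congr (phi (z _ _)); exact/val_inj.
Qed.

Lemma prodf_ge0 phi d (z : 'rV[R]_d) : (forall x, 0 <= phi x) -> 0 <= prodf phi z.
Proof. by move=> h; apply: prodr_ge0. Qed.

Lemma prodf_le phi c d (z : 'rV[R]_d) : (forall x, 0 <= phi x <= c) -> prodf phi z <= c ^+ d.
Proof.
move=> h; rewrite -[d in c ^+ d]card_ord -prodr_const; exact: ler_prod.
Qed.

Lemma Lint_mu0 (f : 'rV[R]_0 -> R) : Lint (mu R 0) f /\ \int[mu R 0]_x f x = f 0.
Proof.
have E : f = fun _ => f 0 by apply/funext => x; rewrite (thinmx0 x).
have mf : Bmeas f by rewrite E; exact: bmeas_cst.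
have fi : Lint (mu R 0) f.
  apply/LintP; split => //; rewrite (@integral_mu R 0 (fun x => `|f x|%:E))//= ?ltry//.
  by apply/measurable_EFinP; exact: measurableT_comp.
split => //; rewrite (Rint_posneg fi).
have key (h : 'rV[R]_0 -> R) : Bmeas h -> (forall x, 0 <= h x) -> \int[mu R 0]_x h x = h 0.
  by move=> mh h0; rewrite /Rintegral (@integral_mu R 0 (fun x => (h x)%:E))//; exact/measurable_EFinP.
rewrite !key.
- by rewrite /= /Num.max; case: ifPn; case: ifPn; rewrite ?oppr_lt0 -?leNgt ?subr0 ?sub0r ?opprK //; lra.
- by apply: measurable_maxr => //; exact: measurable_funN.
- by move=> x; exact: max0_ge0.
- exact: measurable_maxr.
- by move=> x; exact: max0_ge0.
Qed.

Lemma Lint_prodf phi d : Lint leb phi ->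
  Lint (mu R d) (@prodf phi d) /\ \int[mu R d]_x prodf phi (x : 'rV_d) = (\int[leb]_x phi x) ^+ d.
Proof.
move=> pi; elim: d => [|d [IH1 IH2]].
  have [h1 h2] := Lint_mu0 (@prodf phi 0); split => //.
  by rewrite h2 /prodf big_ord0 expr0.
have [h1 h2] := Lint_tensor pi IH1.
split; first by apply: (Lint_eq _ h1) => z; rewrite prodfS.
by rewrite exprS -IH2 -h2; apply: eq_Rintegral => z _; rewrite prodfS.
Qed.

(** The addition formulas mix cosines and sines, so both integrals are carried through the
    induction. *)
Lemma fourier_prodf_lap d (z : 'rV[R]_d) :
  \int[mu R d]_x (cos (dotp (x : 'rV_d) z) * prodf lap (x : 'rV_d)) = prodf cauchy_ker z /\
  \int[mu R d]_x (sin (dotp (x : 'rV_d) z) * prodf lap (x : 'rV_d)) = 0.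
Proof.
elim: d z => [|d IH] z.
  rewrite (Lint_mu0 _).2 (Lint_mu0 _).2 /dotp !big_ord0 sin0 cos0 /prodf !big_ord0.
  by rewrite mul1r mul0r.
have [c1 c2] := lap_cos (hd z); have [s1 s2] := lap_sin (hd z).
have [c3 s3] := IH (tl z).
have pi : Lint (mu R d) (@prodf lap d) by have [] := Lint_prodf d (Lint_lap (R := R)).1.
have C3 := Lint_cos pi (tl z); have S3 := Lint_sin pi (tl z).
have [i1 e1] := Lint_tensor c1 C3; have [i2 e2] := Lint_tensor s1 S3.
have [i3 e3] := Lint_tensor c1 S3; have [i4 e4] := Lint_tensor s1 C3.
rewrite c2 c3 in e1; rewrite s2 s3 in e2; rewrite c2 s3 in e3; rewrite s2 c3 in e4.
split.
  transitivity (2 * (1 + hd z ^+ 2)^-1 * prodf cauchy_ker (tl z) - 0 * 0 : R); last first.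
    by rewrite mul0r subr0 prodfS.
  rewrite -e1 -e2 -RintegralB//; apply: eq_Rintegral => x _.
  by rewrite prodfS dotpS cosD (mulrC (hd x)); ring.
transitivity (0 * prodf cauchy_ker (tl z) + 2 * (1 + hd z ^+ 2)^-1 * 0 : R); last first.
  by rewrite mul0r mulr0 addr0.
rewrite -e3 -e4 -RintegralD//; apply: eq_Rintegral => x _.
by rewrite prodfS dotpS sinD (mulrC (hd x)); ring.
Qed.

(** The indicator of the open cube is bounded by a tensor product of indicators of closed intervals,
    which gives the volume bound. *)
Lemma box_Lint d (N : R) : 0 <= N -> Lint (mu R d) (\1_(box N) : 'rV[R]_d -> R) /\
  \int[mu R d]_x (\1_(box N) (x : 'rV[R]_d) : R) <= (2 * N) ^+ d.
Proof.
move=> N0.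
pose phi (x : R) : R := \1_`[- N, N]%classic x.
have pi : Lint leb phi.
  by apply: (Lint_eq _ (leb_indic_Lint (- N) N 1)) => x; rewrite mulr1.
have pI : \int[leb]_x phi x = 2 * N.
  rewrite /Rintegral integral_indic// setIT; have := lebesgue_measure_itv `[- N, N]%R.
  move=> /= ->; rewrite lte_fin; case: ltP => h; last first.
    by have -> : N = 0; rewrite ?mulr0//; lra.
  by rewrite -EFinB /=; ring.
have [h1 h2] := Lint_prodf d pi.
have le x : (\1_(box N) (x : 'rV[R]_d) : R) <= prodf phi x.
  rewrite indicE; case: (boolP (x \in _)); last by move=> _; apply: prodf_ge0 => y; rewrite /phi indicE.
  rewrite inE => xN; apply: le_of_eq.
  rewrite /prodf big1// => i _; rewrite /phi indicE mem_set//= in_itv /= -ler_norml.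
  by rewrite ltW//; exact: xN.
have bi : Lint (mu R d) (\1_(box N) : 'rV[R]_d -> R).
  apply: Lint_le h1 => //; first by apply: measurable_indic; exact: measurable_box.
  by move=> x; rewrite ger0_norm.
by split => //; rewrite -pI -h2; apply: le_Rint.
Qed.

Lemma Lint_box d (N : R) : Lint (mu R d) (\1_(box N) : 'rV[R]_d -> R).
Proof.
apply: Lint_le (box_Lint d (normr_ge0 N)).1.
  by apply: measurable_indic; exact: measurable_box.
move=> x; rewrite ger0_norm// !indicE; case: (boolP (x \in box N)) => //.
rewrite inE => xN; rewrite mem_set// => i; apply: lt_le_trans (xN i) _; exact: ler_norm.
Qed.

End tensor.

Notation fourier_sq f xi := (fourier_re f xi ^+ 2 + fourier_im f xi ^+ 2).

Section duality.
Context {R : realType} {d : nat}.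
Local Notation mud := (mu R d).
Local Notation V := 'rV[R]_d.

Lemma pair_fubini (c : R) (b : V -> V -> R) (al be : V -> R) :
  measurable_fun setT (fun p : Borel R d * Borel R d => b p.1 p.2) ->
  (forall x y, `|b x y| <= c) -> Lint mud al -> Lint mud be ->
  Lint mud (fun y => be y * \int[mud]_x (b x y * al x)) /\
  \int[mud]_y (be y * \int[mud]_x (b (x : V) y * al x)) =
  \int[mud]_x (al x * \int[mud]_y (b (x : V) y * be y)).
Proof.
move=> mb bc ai bi.
have Fi : Lint (mud \x mud)%E (fun p : Borel R d * Borel R d => b p.1 p.2 * (al p.1 * be p.2)).
  apply: (Lint_bddM _ c (fun p : Borel R d * Borel R d => b p.1 p.2)) => //.
  exact: Lint_mul_prod.
have mx y : Bmeas (fun x => b x y).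
  have h := @pair2_measurable _ _ (Borel R d) (Borel R d) y.
  by have := measurableT_comp mb h; exact.
have my x : Bmeas (fun y => b x y).
  have h := @pair1_measurable _ _ (Borel R d) (Borel R d) x.
  by have := measurableT_comp mb h; exact.
have E1 (y : V) : \int[mud]_x (b (x : V) y * (al x * be y)) = be y * \int[mud]_x (b (x : V) y * al x).
  rewrite -RintegralZl//; last by apply: (Lint_bddM mud c (fun x => b x y)); [exact: mx|move=> x; exact: bc|exact: ai].
  by apply: eq_Rintegral => x _; ring.
have E2 (x : V) : \int[mud]_y (b x (y : V) * (al x * be y)) = al x * \int[mud]_y (b x (y : V) * be y).
  rewrite -RintegralZl//; last by apply: (Lint_bddM mud c (fun y => b x y)); [exact: my|move=> y; exact: bc|exact: bi].
  by apply: eq_Rintegral => y _; ring.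
have [i2 e2] := Rfubini2 Fi; have [i1 e1] := Rfubini1 Fi.
split; first by apply: (Lint_eq _ i2) => y /=; exact: E1.
transitivity (\int[mud]_y \int[mud]_x (b (x : V) (y : V) * (al x * be y))).
  by apply: eq_Rintegral => y _; rewrite E1.
rewrite [LHS]e2 -e1; apply: eq_Rintegral => x _; exact: E2.
Qed.

Lemma meas_cosdot d0 (T : measurableType d0) (f g : T -> V) : vmeas f -> vmeas g ->
  measurable_fun setT (fun t => cos (dotp (f t) (g t))).
Proof.
move=> mf mg; apply: measurableT_comp; first exact: continuous_measurable_fun (@continuous_cos R).
exact: vmeas_dotp.
Qed.

Lemma meas_sindot d0 (T : measurableType d0) (f g : T -> V) : vmeas f -> vmeas g ->
  measurable_fun setT (fun t => sin (dotp (f t) (g t))).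
Proof.
move=> mf mg; apply: measurableT_comp; first exact: continuous_measurable_fun (@continuous_sin R).
exact: vmeas_dotp.
Qed.

Lemma bmeas_fourier (f : V -> R) : Lint mud f -> Bmeas (fourier_re f) /\ Bmeas (fourier_im f).
Proof.
move=> fi; have mf : Bmeas f := Lint_meas fi.
split.
  rewrite (_ : fourier_re f = fun xi => \int[mud]_x (cos (dotp (x : V) xi) * f x)); last first.
    by apply/funext => xi; exact: fourier_reE.
  apply: (@measurable_Rint_param _ _ _ _ _ mud (fun p : Borel R d * Borel R d => cos (dotp (p.2 : V) (p.1 : V)) * f p.2)).
  apply: measurable_funM; last by vmeas.
  by apply: meas_cosdot; [exact: measurable_snd|exact: measurable_fst].
rewrite (_ : fourier_im f = fun xi => - \int[mud]_x (sin (dotp (x : V) xi) * f x)); last first.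
  by apply/funext => xi; exact: fourier_imE.
apply: measurable_funN.
apply: (@measurable_Rint_param _ _ _ _ _ mud (fun p : Borel R d * Borel R d => sin (dotp (p.2 : V) (p.1 : V)) * f p.2)).
apply: measurable_funM; last by vmeas.
by apply: meas_sindot; [exact: measurable_snd|exact: measurable_fst].
Qed.

Lemma fourier_le (f : V -> R) xi : Lint mud f ->
  `|fourier_re f xi| <= \int[mud]_x `|f x| /\ `|fourier_im f xi| <= \int[mud]_x `|f x|.
Proof.
move=> fi; rewrite fourier_reE// fourier_imE// normrN; split; apply: norm_Rint_le.
- exact: Lint_norm.
- exact: Lint_meas (Lint_cos fi xi).
- by move=> x; rewrite normrM ler_piMl// cos_le1n.
- exact: Lint_norm.
- exact: Lint_meas (Lint_sin fi xi).
- by move=> x; rewrite normrM ler_piMl// sin_le1n.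
Qed.

(** Equals (2 pi)^d, the constant of Plancherel's identity. *)
Definition ker_mass : R := \int[mud]_w prodf cauchy_ker (w : V).

Section scale.
Variable kap : R.
Hypothesis kap0 : 0 < kap.

(** A frequency cutoff, the exponential of - kap times the sum of the |xi_i|, which increases to 1
    as kap decreases to 0; [kerk] is its Fourier transform and has the same mass for all kap. *)
Definition rhok (xi : V) : R := prodf lap (kap *: xi).
Definition kerk (w : V) : R := (kap^-1) ^+ d * prodf cauchy_ker (kap^-1 *: w).

Lemma rhok_Lint : Lint mud rhok.
Proof.
have [pi _] := Lint_prodf d (Lint_lap (R := R)).1.
by have [] := Lint_scale (lt0r_neq0 kap0) pi.
Qed.

Lemma rhok01 xi : 0 <= rhok xi <= 1.
Proof.
rewrite prodf_ge0 /=; last by move=> x; exact: expR_ge0.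
rewrite -(expr1n _ d); apply: prodf_le => x.
by rewrite expR_ge0 /= -expR0 ler_expR oppr_le0.
Qed.

Lemma kerk_fourier (w : V) :
  \int[mud]_xi (cos (dotp (xi : V) w) * rhok xi) = kerk w /\
  \int[mud]_xi (sin (dotp (xi : V) w) * rhok xi) = 0.
Proof.
have [pi _] := Lint_prodf d (Lint_lap (R := R)).1.
have [c1 s1] := fourier_prodf_lap (kap^-1 *: w).
have [_ hc] := Lint_scale (lt0r_neq0 kap0) (Lint_cos pi (kap^-1 *: w)).
have [_ hs] := Lint_scale (lt0r_neq0 kap0) (Lint_sin pi (kap^-1 *: w)).
rewrite c1 (gtr0_norm kap0) in hc; rewrite s1 mulr0 in hs.
split.
  rewrite /kerk -hc; apply: eq_Rintegral => x _.
  by rewrite dotpZl dotpZr mulrA divff ?gt_eqF// mul1r.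
rewrite -hs; apply: eq_Rintegral => x _.
by rewrite dotpZl dotpZr mulrA divff ?gt_eqF// mul1r.
Qed.

Lemma ker_Lint : Lint mud (@prodf R cauchy_ker d) /\ 0 < \int[mud]_w prodf cauchy_ker (w : V).
Proof.
have [ci c0] := Lint_cauchy_ker (R := R).
by have [h ->] := Lint_prodf d ci; rewrite exprn_gt0.
Qed.

Lemma kerk_Lint : Lint mud kerk /\ \int[mud]_w kerk w = \int[mud]_w prodf cauchy_ker (w : V).
Proof.
have [h1 _] := ker_Lint.
have k0 : kap^-1 != 0 by rewrite invr_eq0 gt_eqF.
have [h2 h3] := Lint_scale k0 h1.
split; first exact: LintZ.
rewrite RintegralZl//.
rewrite h3 gtr0_norm ?invr_gt0// mulrA -exprMn invrK mulVf ?gt_eqF//.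
by rewrite expr1n mul1r.
Qed.

Lemma kerk_ge0 w : 0 <= kerk w.
Proof.
rewrite /kerk; apply: mulr_ge0; first by rewrite exprn_ge0// invr_ge0 ltW.
by apply: prodf_ge0 => x; exact: cauchy_ker_ge0.
Qed.

Lemma kerk_le w : `|kerk w| <= (kap^-1) ^+ d * 2 ^+ d.
Proof.
rewrite ger0_norm ?kerk_ge0//; apply: ler_wpM2l; first by rewrite exprn_ge0// invr_ge0 ltW.
apply: prodf_le => x; rewrite cauchy_ker_ge0 /= /cauchy_ker.
by rewrite ler_piMr// invf_le1 ?lerDl ?sqr_ge0// ltr_pwDl// sqr_ge0.
Qed.

Lemma conv_kerk (f : V -> R) x : Lint mud f ->
  Lint mud (fun y => kerk (x - y) * f y) /\ Defs.conv kerk f x = \int[mud]_y (kerk (x - (y : V)) * f y).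
Proof.
move=> fi.
have h : Lint mud (fun y => kerk (x - y) * f y).
  apply: (Lint_bddM mud ((kap^-1) ^+ d * 2 ^+ d) (fun y => kerk (x - y))) => //.
    apply: vmeas_comp; first exact: Lint_meas kerk_Lint.1.
    by apply: vmeasB; [exact: vmeas_cst|exact: vmeas_id].
  by move=> y; exact: kerk_le.
by split => //; rewrite /Defs.conv integE.
Qed.

Lemma conv_kerk_bdd (f : V -> R) x : Lint mud f ->
  `|Defs.conv kerk f x| <= (kap^-1) ^+ d * 2 ^+ d * \int[mud]_y `|f y|.
Proof.
move=> fi; have [h ->] := conv_kerk x fi.
rewrite -RintegralZl//; last exact: Lint_norm.
apply: norm_Rint_le; first by apply: LintZ; exact: Lint_norm.
  exact: Lint_meas h.
by move=> y; rewrite normrM ler_wpM2r// kerk_le.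
Qed.

(** A regularised Parseval identity for Re (p^ conj q^). The transforms are merely bounded; the
    integrable cutoff is what makes the exchanges of integrals legitimate. *)
Lemma fourier_pairing (p q : V -> R) : Lint mud p -> Lint mud q ->
  Lint mud (fun xi => rhok xi * (fourier_re p xi * fourier_re q xi + fourier_im p xi * fourier_im q xi)) /\
  \int[mud]_xi (rhok xi * (fourier_re p xi * fourier_re q xi + fourier_im p xi * fourier_im q xi)) =
  \int[mud]_x (p x * Defs.conv kerk q x).
Proof.
move=> pi qi; have [mr mi] := bmeas_fourier qi.
have ri := rhok_Lint.
have b1 : Lint mud (fun xi => fourier_re q xi * rhok xi).
  by apply: (Lint_bddM mud (\int[mud]_x `|q x|) (fourier_re q)) => // xi; have [] := fourier_le xi qi.
have b2 : Lint mud (fun xi => fourier_im q xi * rhok xi).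
  by apply: (Lint_bddM mud (\int[mud]_x `|q x|) (fourier_im q)) => // xi; have [] := fourier_le xi qi.
have [i1 e1] := pair_fubini (b := fun x y => cos (dotp x y)) (meas_cosdot measurable_fst measurable_snd) (fun x y => cos_le1n _) pi b1.
have [i2 e2] := pair_fubini (b := fun x y => sin (dotp x y)) (meas_sindot measurable_fst measurable_snd) (fun x y => sin_le1n _) pi b2.
have E xi : rhok xi * (fourier_re p xi * fourier_re q xi + fourier_im p xi * fourier_im q xi) =
  fourier_re q xi * rhok xi * \int[mud]_x (cos (dotp (x : V) xi) * p x) -
  fourier_im q xi * rhok xi * \int[mud]_x (sin (dotp (x : V) xi) * p x).
  by rewrite (fourier_reE pi) (fourier_imE pi); ring.
split.
  by apply: (Lint_eq _ (LintB i1 i2)) => xi; rewrite E.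
under eq_Rintegral do rewrite E.
rewrite RintegralB; [|exact: measurableT|exact: i1|exact: i2].
rewrite e1 e2.
have ic x : Lint mud (fun y : V => cos (dotp x y) * (fourier_re q y * rhok y)).
  apply: (Lint_bddM mud 1 (fun y : V => cos (dotp x y))); [|by move=> y; exact: cos_le1n|exact: b1].
  by apply: meas_cosdot; [exact: vmeas_cst|exact: vmeas_id].
have is_ x : Lint mud (fun y : V => sin (dotp x y) * (fourier_im q y * rhok y)).
  apply: (Lint_bddM mud 1 (fun y : V => sin (dotp x y))); [|by move=> y; exact: sin_le1n|exact: b2].
  by apply: meas_sindot; [exact: vmeas_cst|exact: vmeas_id].
have [i3 e3] := pair_fubini (b := fun y x => cos (dotp x y)) (meas_cosdot measurable_snd measurable_fst) (fun x y => cos_le1n _) b1 pi.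
have [i4 e4] := pair_fubini (b := fun y x => sin (dotp x y)) (meas_sindot measurable_snd measurable_fst) (fun x y => sin_le1n _) b2 pi.
rewrite -RintegralB; [|exact: measurableT|exact: i3|exact: i4].
apply: eq_Rintegral => x _; rewrite -mulrBr; congr (_ * _).
rewrite -RintegralB; [|exact: measurableT|exact: ic|exact: is_].
have [_ ->] := conv_kerk x qi.
have mcs : measurable_fun setT (fun z : Borel R d * Borel R d => cos (dotp (z.2 : V) (x - z.1))).
  apply: measurableT_comp; first exact: continuous_measurable_fun (@continuous_cos R).
  apply: vmeas_dotp; first exact: measurable_snd.
  by apply: vmeasB; [exact: vmeas_cst|exact: measurable_fst].
have [_ e5] := pair_fubini (b := fun y xi => cos (dotp xi (x - y))) mcs (fun x y => cos_le1n _) qi ri.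
transitivity (\int[mud]_y (q y * \int[mud]_xi (cos (dotp (xi : V) (x - (y : V))) * rhok xi))); last first.
  by apply: eq_Rintegral => y _; rewrite (kerk_fourier _).1 mulrC.
rewrite -e5; apply: eq_Rintegral => xi _.
rewrite (_ : \int[mud]_y (cos (dotp (xi : V) (x - (y : V))) * q y) =
  cos (dotp x xi) * fourier_re q xi - sin (dotp x xi) * fourier_im q xi); first by ring.
have [_] := cos_shift_integral qi (- x) xi.
have -> : dotp (- x) (xi : V) = - dotp x xi by rewrite -scaleN1r dotpZl mulN1r.
rewrite cosN sinN mulNr => <-.
apply: eq_Rintegral => y _; congr (_ * _); rewrite -cosN; congr cos.
by rewrite /dotp -sumrN; apply: eq_bigr => i _; rewrite !mxE; ring.
Qed.

(** From g(x) g(y) <= (g(x)^2 + g(y)^2) / 2 under the nonnegative kernel. With [fourier_pairing] it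
    bounds the regularised L^2 norm of g^ by that of [g], the half of Plancherel that is needed. *)
Lemma kerk_energy (g : V -> R) (cg : R) : Lint mud g -> (forall x, `|g x| <= cg) ->
  \int[mud]_x (g x * Defs.conv kerk g x) <= \int[mud]_w prodf cauchy_ker (w : V) * \int[mud]_x (g x ^+ 2).
Proof.
move=> gi gb; have mg : Bmeas g := Lint_meas gi.
have g2 : Lint mud (fun x => g x ^+ 2).
  by apply: (@Lint_eq _ _ _ mud (fun x => g x * g x)) => //; apply: (Lint_bddM mud cg g).
have [ki ke] := kerk_Lint.
have [ci ce] := conv_L1 ki kerk_ge0 g2.
set c := \int[mud]_w prodf cauchy_ker (w : V).
have c2 : Lint mud (fun x => 1/2 * (c * g x ^+ 2 + Defs.conv kerk (fun y => g y ^+ 2) x)).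
  by apply: LintZ; apply: LintD => //; apply: LintZ.
apply: (@le_trans _ _ (\int[mud]_x (1/2 * (c * g x ^+ 2 + Defs.conv kerk (fun y => g y ^+ 2) x)))).
  apply: le_Rint => //.
    apply: (@Lint_eq _ _ _ mud (fun x => Defs.conv kerk g x * g x)); first by move=> x; rewrite mulrC.
    apply: (Lint_bddM mud ((kap^-1) ^+ d * 2 ^+ d * \int[mud]_y `|g y|) (Defs.conv kerk g)) => //.
      exact: (measurable_conv1 ki kerk_ge0 gi).
    by move=> x; exact: conv_kerk_bdd.
  move=> x; have [h1 ->] := conv_kerk x gi; have [h2 ->] := conv_kerk x g2.
  have [h3 h4] : Lint mud (fun y => kerk (x - y)) /\ \int[mud]_y kerk (x - (y : V)) = c.
    have n0 : -1 != 0 :> R by rewrite oppr_eq0 oner_eq0.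
    have [k1 k2] := @Lint_aff R d (-1) x _ n0 ki.
    rewrite normrN1 invr1 expr1n mul1r ke in k2.
    split; first by apply: (Lint_eq _ k1) => y; rewrite scaleN1r addrC.
    by rewrite /c -k2; apply: eq_Rintegral => y _; rewrite scaleN1r addrC.
  have h5 : Lint mud (fun y => g x ^+ 2 * kerk (x - y)) by exact: LintZ.
  have -> : 1/2 * (c * g x ^+ 2 + \int[mud]_y (kerk (x - (y : V)) * g y ^+ 2)) =
    \int[mud]_y (1/2 * (g x ^+ 2 * kerk (x - (y : V)) + kerk (x - y) * g y ^+ 2)).
    rewrite RintegralZl//; last exact: LintD.
    by rewrite RintegralD// RintegralZl// h4 (mulrC c).
  rewrite -RintegralZl//; apply: le_Rint.
  - exact: LintZ.
  - by apply: LintZ; exact: LintD.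
  move=> y; have := mulr_ge0 (kerk_ge0 (x - y)) (sqr_ge0 (g x - g y)); nra.
rewrite RintegralZl//; last by apply: LintD => //; apply: LintZ.
rewrite RintegralD//; last by apply: LintZ.
rewrite RintegralZl//.
have : \int[mud]_x Defs.conv kerk (fun y => g y ^+ 2) x <= c * \int[mud]_x (g x ^+ 2).
  apply: le_trans (le_trans ce _); first by apply: le_Rint => //; [exact: Lint_norm|move=> x; exact: ler_norm].
  rewrite ke; apply: le_of_eq; congr (_ * _).
  by apply: eq_Rintegral => x _; rewrite ger0_norm ?sqr_ge0.
lra.
Qed.

End scale.

(* [kerk kap] is an approximate identity as [kap -> 0], and it is the Fourier transform of [rhok kap <= 1]: a substitute for Plancherel. *)
Lemma fourier_duality (f g : V -> R) (A cg la : R) : Lint mud f ->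
  Lint mud (fun xi => fourier_sq f xi) ->
  \int[mud]_xi (fourier_sq f xi) <= A ->
  Lint mud g -> (forall x, `|g x| <= cg) -> 0 < la ->
  ker_mass * \int[mud]_x (f x * g x) <= 1/2 * (la * A + la^-1 * (ker_mass * \int[mud]_x (g x ^+ 2))).
Proof.
move=> fi f2 fA gi gb la0; set c := ker_mass; have mg : Bmeas g := Lint_meas gi.
have g0 : 0 <= cg by apply: le_trans (gb 0).
have [keri _] := ker_Lint.
(* At fixed kap: [fourier_pairing], then Young's inequality with weight [la] at each frequency, then
   [kerk_energy] for the part in [g]. *)
have bound kap : 0 < kap -> \int[mud]_x (g x * Defs.conv (kerk kap) f x) <= 1/2 * (la * A + la^-1 * (c * \int[mud]_x (g x ^+ 2))).
  move=> k0; have [i1 e1] := fourier_pairing k0 gi fi; have [i2 e2] := fourier_pairing k0 gi gi.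
  have en := kerk_energy k0 gi gb.
  rewrite -e1; rewrite -e2 in en.
  have la1 : 0 < la^-1 by rewrite invr_gt0.
  apply: (@le_trans _ _ (1/2 * (la * A + la^-1 * \int[mud]_xi (rhok kap xi * (fourier_re g xi * fourier_re g xi + fourier_im g xi * fourier_im g xi))))); last first.
    by rewrite ler_wpM2l// lerD2l; apply: (ler_wpM2l (ltW la1)); exact: en.
  apply: (@le_trans _ _ (1/2 * (la * \int[mud]_xi (fourier_sq f xi) + la^-1 * \int[mud]_xi (rhok kap xi * (fourier_re g xi * fourier_re g xi + fourier_im g xi * fourier_im g xi))))); last first.
    by rewrite ler_wpM2l// lerD2r; apply: (ler_wpM2l (ltW la0)); exact: fA.
  have i3 := LintZ la f2; have i4 := LintZ la^-1 i2; have i5 := LintD i3 i4.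
  have z1 := RintegralZl la measurableT f2; have z2 := RintegralZl la^-1 measurableT i2.
  have z3 := RintegralD measurableT i3 i4; have z4 := RintegralZl (1/2) measurableT i5.
  rewrite -z1 -z2 -z3 -z4.
  apply: le_Rint => //; first exact: LintZ.
  move=> xi; have /andP[r0 r1] := rhok01 kap xi.
  set a := fourier_re f xi; set b := fourier_im f xi; set p := fourier_re g xi; set q := fourier_im g xi.
  set r := rhok kap xi in r0 r1 *.
  have h (x y : R) : x * y <= 1/2 * (la * y ^+ 2 + la^-1 * x ^+ 2).
    have e : la * la^-1 = 1 by rewrite divff ?gt_eqF.
    have := mulr_ge0 (ltW la0) (sqr_ge0 (y - la^-1 * x)).
    rewrite (_ : la * (y - la^-1 * x) ^+ 2 = la * y ^+ 2 - 2 * (la * la^-1) * (x * y) + (la * la^-1) * la^-1 * x ^+ 2); last by ring.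
    by rewrite e; lra.
  have h1 : r * (p * a + q * b) <= r * (1/2 * (la * a ^+ 2 + la^-1 * p ^+ 2) + 1/2 * (la * b ^+ 2 + la^-1 * q ^+ 2)).
    by rewrite ler_wpM2l// lerD.
  apply: le_trans h1 _.
  have h2 : 0 <= (1 - r) * (la * (a ^+ 2 + b ^+ 2)).
    by rewrite mulr_ge0 ?subr_ge0// mulr_ge0 ?(ltW la0)// addr_ge0 ?sqr_ge0.
  nra.
pose kap (n : nat) : R := n.+1%:R^-1.
have kap0 n : 0 < kap n by rewrite invr_gt0.
have tf : transc f by apply: transc_Lint => // N; exact: Lint_box.
(* After the substitution z = kap w the kernel is fixed and the shift tends to 0. *)
pose F n (w : V) : R := prodf cauchy_ker w * \int[mud]_y (g ((y : V) + kap n *: w) * f y).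
have E n : \int[mud]_x (g x * Defs.conv (kerk (kap n)) f x) = \int[mud]_w F n w.
  have [ki _] := kerk_Lint (kap0 n).
  have [_ ->] := conv_pairing ki (kerk_ge0 (kap0 n)) fi mg gb.
  have mb : measurable_fun setT (fun p : Borel R d * Borel R d => g ((p.1 : V) + kap n *: p.2)).
    by vmeas.
  have [_ ->] := pair_fubini (b := fun y w => g (y + kap n *: w)) mb (fun x y => gb _) fi keri.
  apply: eq_Rintegral => y _; congr (_ * _).
  have pi : Lint mud (fun z : V => g ((y : V) + z) * kerk (kap n) z).
    apply: (Lint_bddM mud cg (fun z : V => g ((y : V) + z))) => //.
    by vmeas.
  have [_] := Lint_scale (lt0r_neq0 (kap0 n)) pi.
  rewrite (gtr0_norm (kap0 n)) => h.
  rewrite -[LHS]mul1r -(expr1n _ d) -(divff (lt0r_neq0 (kap0 n))) exprMn -mulrA -h.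
  rewrite -RintegralZl//.
    apply: eq_Rintegral => w _; rewrite /kerk scalerA mulVf ?gt_eqF// scale1r.
    have e : kap n ^+ d * (kap n)^-1 ^+ d = 1 by rewrite -exprMn divff ?gt_eqF// expr1n.
    by rewrite -[RHS]mul1r -e; ring.
  by have [+ _] := Lint_scale (lt0r_neq0 (kap0 n)) pi; exact.
have gf : Lint mud (fun y => g y * f y) by apply: (Lint_bddM mud cg g).
have gsh (h : V) : Lint mud (fun y => g (y + h) * f y).
  apply: (Lint_bddM mud cg (fun y => g (y + h))) => //.
  by vmeas.
have Fc : \int[mud]_w F n w @[n --> \oo] --> \int[mud]_w (prodf cauchy_ker (w : V) * \int[mud]_y (g y * f y)).
  apply: (@Rdct _ _ _ mud F _ (fun w => (cg * \int[mud]_y `|f y|) * prodf cauchy_ker (w : V))).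
  - move=> n; apply: measurable_funM; first exact: Lint_meas keri.
    apply: (@measurable_Rint_param _ _ _ _ _ mud (fun p : Borel R d * Borel R d => g ((p.2 : V) + kap n *: p.1) * f p.2)).
    apply: measurable_funM.
      by vmeas.
    by apply: vmeas_comp; [exact: Lint_meas fi|exact: measurable_snd].
  - move=> n w; have p0 : 0 <= prodf cauchy_ker (w : V) by apply: prodf_ge0 => x; exact: cauchy_ker_ge0.
    rewrite /F normrM mulrC (ger0_norm p0); apply: (ler_wpM2r p0).
    rewrite -RintegralZl//; last exact: Lint_norm.
    apply: norm_Rint_le; first by apply: LintZ; exact: Lint_norm.
      exact: Lint_meas (gsh _).
    by move=> y; rewrite normrM ler_wpM2r.
  - exact: LintZ.
  - move=> w; apply: cvgMr.
    have hw : kap n *: w @[n --> \oo] --> (0 : V).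
      rewrite -(scale0r w); apply: cvgZl; exact: cvg_harmonic.
    have := tf _ hw => hf.
    apply/cvgrPdist_le => e e0.
    have e1 : 0 < e / (cg + 1) by rewrite divr_gt0// ltr_wpDl.
    have /cvgrPdist_le/(_ _ e1) := hf.
    apply: filterS => n; rewrite sub0r normrN ger0_norm ?Rintegral_ge0// => hn.
    (* Translation invariance moves the shift from [g] onto [f]: the boundedness of [g] then
       combines with the L^1 continuity of translations of [f]. *)
    have [s1 s2] := Lint_shift (kap n *: w) (gsh (kap n *: w)).
    rewrite -s2 -RintegralB//.
    have [f1 _] := Lint_shift (kap n *: w) fi.
    have f3 : Lint mud (fun x : V => `|f (x - kap n *: w) - f x|) by apply/Lint_norm/LintB.
    apply: (@le_trans _ _ (\int[mud]_x ((cg + 1) * `|f ((x : V) - kap n *: w) - f x|))).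
      apply: norm_Rint_le; first exact: LintZ.
        exact: (@Lint_meas _ _ _ mud _ (LintB gf s1)).
      move=> x; rewrite subrK -mulrBr normrM distrC ler_wpM2r//.
      by rewrite (le_trans (gb _))// lerDl.
    rewrite RintegralZl//.
    by rewrite mulrC -ler_pdivlMr// ltr_wpDl.
rewrite (_ : c * \int[mud]_x (f x * g x) = \int[mud]_w (prodf cauchy_ker (w : V) * \int[mud]_y (g y * f y))); last first.
  rewrite /c mulrC -RintegralZl//; apply: eq_Rintegral => w _; rewrite mulrC; congr (_ * _).
  by apply: eq_Rintegral => x _; rewrite mulrC.
rewrite -(cvg_lim _ Fc)//; apply: limr_le; first by apply/cvg_ex; eexists; exact: Fc.
by apply: nearW => n; rewrite -E; exact: bound.
Qed.

End duality.

(** * Uniform moment bounds *)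

Section reals.
Context {R : realType}.

Lemma one_minus_cos_ge0 (z : R) : 0 <= 1 - cos z.
Proof. by rewrite subr_ge0 cos_le1. Qed.

(** 1 - cos z is at most 2 and at most |z|; the first bound suffices for |z| >= 1, the second for
    |z| < 1 because M <= 1. *)
Lemma one_minus_cos_le (z M : R) : 0 < M <= 1 -> 1 - cos z <= 2 * `|z| `^ M.
Proof.
move=> /andP[M0 M1].
have h2 : 1 - cos z <= 2 by have := cos_geN1 z; lra.
have [z1|z1] := leP 1 `|z|.
  apply: le_trans h2 _; rewrite ler_peMr// -(powRr0 `|z|); apply: ler_powR => //; exact: ltW.
have [z0|z0] := eqVneq z 0.
  by rewrite z0 cos0 subrr mulr_ge0// powR_ge0.
have hz : 1 - cos z <= `|z|.
  rewrite -cos_norm.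
  have d (x : R) : 0 <= x <= 1 -> is_derive x 1 (fun x : R => 1 + -1 * cos x + -1 * x) (0 + -1 * - sin x + -1 * 1).
    by move=> _; exact: (isdD (isdD (isdC 1 x) (isdZ (-1) (is_derive_cos x))) (isdZ (-1) (isdI x))).
  have := derive_le0 d _ (t := `|z|); rewrite cos0 => h.
  have : 1 + -1 * cos `|z| + -1 * `|z| <= 1 + -1 * 1 + -1 * 0.
    apply: h; last by rewrite normr_ge0 ltW.
    by move=> x _; have := sin_le1 x; lra.
  lra.
apply: le_trans hz (le_trans (ger1_powR _ M1) _); first by rewrite normr_gt0 z0 ltW.
by rewrite ler_peMl ?powR_ge0// ler1n.
Qed.

Lemma one_minus_cos_half (y : R) : 1/2 < y <= 1 -> 0 < 1 - cos (1/2 : R) <= 1 - cos y.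
Proof.
move=> /andP[y1 y2]; have pi2 := @pi_ge2 R.
have i0 : (0 : R) \in `[0, pi] by rewrite in_itv/= lexx; lra.
have ih : (1/2 : R) \in `[0, pi] by rewrite in_itv/=; apply/andP; split; lra.
have iy : y \in `[0, pi] by rewrite in_itv/=; apply/andP; split; lra.
apply/andP; split.
  by have h := ltr_cos i0 ih; rewrite cos0 in h; rewrite subr_gt0 h; lra.
by rewrite lerD2l lerN2 ltW// ltr_cos.
Qed.

(** The least j with y <= 2^j: minimality gives the lower bound 1/2, and y >= 1 settles j = 0. *)
Lemma dyadic_scale (y : R) (N : nat) : 1 <= y -> y <= 2 ^+ N ->
  exists2 j, (j <= N)%N & (y <= 2 ^+ j) && (1/2 < (2^-1) ^+ j * y <= 1).
Proof.
move=> y1 yN; have ex : exists n, y <= 2 ^+ n by exists N.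
case: (ex_minnP ex) => j yj jmin; exists j; first exact: jmin.
have p2 : 0 < (2 ^+ j : R) by rewrite exprn_gt0.
have E : (2^-1) ^+ j * y = y / 2 ^+ j by rewrite exprVn mulrC.
apply/and3P; split => //; last by rewrite E ler_pdivrMr// mul1r.
rewrite E ltr_pdivlMr//.
case: j yj jmin p2 {E} => [|j] yj jmin p2; first by rewrite expr0 mulr1; lra.
rewrite ltNge; apply/negP => h; suff : (j < j)%N by rewrite ltnn.
by apply: jmin; move: h; rewrite exprS; lra.
Qed.

Lemma geom_le (q : R) n : 0 <= q < 1 -> \sum_(j < n) q ^+ j <= (1 - q)^-1.
Proof.
move=> /andP[q0 q1]; have q2 : 0 < 1 - q by rewrite subr_gt0.
rewrite -[leRHS]mul1r ler_pdivlMr//.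
have := subrX1 q n; have : 0 <= q ^+ n by rewrite exprn_ge0.
set S := \sum_(_ < _) _; nra.
Qed.

End reals.

Lemma Lint_bigsum {R : realType} d0 (T : measurableType d0) (m : {measure set T -> \bar R}) n (F : 'I_n -> T -> R) :
  (forall i, Lint m (F i)) -> Lint m (fun x => \sum_(i < n) F i x) /\
  \int[m]_x (\sum_(i < n) F i x) = \sum_(i < n) \int[m]_x F i x.
Proof.
elim: n F => [|n IH] F Fi.
  split; first by apply: (@Lint_eq _ _ _ m (fun _ => 0)) => [x|]; [rewrite big_ord0|exact: integrable0].
  by rewrite big_ord0; under eq_Rintegral do rewrite big_ord0; rewrite Rintegral_cst// mul0r.
have [h1 h2] := IH (fun i => F (widen_ord (leqnSn n) i)) (fun i => Fi _).
split.
  by apply: (Lint_eq _ (LintD h1 (Fi ord_max))) => x; rewrite big_ord_recr.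
rewrite big_ord_recr /= -h2 -RintegralD//.
by apply: eq_Rintegral => x _; rewrite big_ord_recr.
Qed.

Notation jap_ball r := [set y : 'M[_]_(1, _) | jap y <= r].

Section moment.
Context {R : realType} {d : nat}.
Local Notation mud := (mu R d).
Local Notation V := 'rV[R]_d.

(** The cut to a ball makes the moment finite before any bound is known; the estimates do not depend
    on [N]. *)
Definition trunc_moment (m : R) (f : V -> R) (N : nat) : R :=
  \int[mud]_x (\1_(jap_ball (2 ^+ N)) (x : V) * (jap (x : V) `^ m * `|f x|)).

(** The factors come from the dominating coordinate (1 + d), the lower bound 1 - cos(1/2) at the
    right dyadic scale, the number d of coordinates and the geometric series of ratio 2^(m - M).
    Neither the rate nor the kernel enters, whence uniformity in s and eps. *)
Definition moment_const (u0 : V -> R) (m M B T : R) : R :=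
  (1 + d%:R) * (\int[mud]_x `|u0 x| + (1 - cos (1/2))^-1 *
    (d%:R * ((2 * (\int[mud]_x (`|u0 x| * jap (x : V) `^ M)) + B * T * \int[mud]_x `|u0 x|) * (1 - 2 `^ (m - M))^-1))).

Lemma jap_ge1 (x : V) : 1 <= jap x.
Proof. by rewrite -[leLHS]sqrtr1 ler_sqrt ?addr_ge0 ?dotp_ge0// lerDl dotp_ge0. Qed.

Lemma jap_sqr (x : V) : jap x ^+ 2 = 1 + dotp x x.
Proof. by rewrite sqr_sqrtr// addr_ge0// dotp_ge0. Qed.

Lemma coord_le_jap (x : V) i : `|x 0 i| <= jap x.
Proof.
rewrite -sqrtr_sqr ler_sqrt ?addr_ge0 ?dotp_ge0// /dotp (bigD1 i)//= expr2.
by rewrite addrCA lerDl addr_ge0// sumr_ge0// => j _; rewrite -expr2 sqr_ge0.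
Qed.

Lemma bmeas_jap : Bmeas (@jap R d).
Proof.
apply: measurableT_comp; first by apply: continuous_measurable_fun; exact: sqrt_continuous.
by apply: measurable_funD => //; apply: vmeas_dotp; exact: vmeas_id.
Qed.

Lemma bmeas_jap_pow (m : R) : Bmeas (fun x : V => jap x `^ m).
Proof. by apply: (@measurableT_comp _ _ _ _ _ _ (@powR R ^~ m)) => //; exact: bmeas_jap. Qed.

(** Otherwise every x_i^2 is at most q = <x>^2 / (1 + d). Summing, (1 + d) q = <x>^2 <= 1 + d q, so
    q <= 1, whereas <x> > 1 + d forces q > 1. *)
Lemma jap_le_coord (x : V) : jap x <= 1 + d%:R \/ exists i, 1 <= `|x 0 i| /\ jap x <= (1 + d%:R) * `|x 0 i|.
Proof.
have d1 : 1 <= 1 + d%:R :> R by rewrite lerDl.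
have d0 : 0 < 1 + d%:R :> R by lra.
have [h|h] := pselect (exists i, 1 <= `|x 0 i| /\ jap x <= (1 + d%:R) * `|x 0 i|); [by right|left].
rewrite leNgt; apply/negP => hx.
have xi i : x 0 i * x 0 i <= jap x ^+ 2 / (1 + d%:R).
  rewrite ler_pdivlMr// -expr2 -real_normK ?num_real//.
  have j0 := jap_ge1 x; have n0 := normr_ge0 (x 0 i).
  have [x1|x1] := leP 1 `|x 0 i|; last first.
    have : `|x 0 i| ^+ 2 <= 1 by rewrite expr_le1// ltW.
    nra.
  have : (1 + d%:R) * `|x 0 i| < jap x.
    by rewrite ltNge; apply/negP => h'; apply: h; exists i.
  have := coord_le_jap x i; nra.
have : \sum_(i < d) x 0 i * x 0 i <= \sum_(i < d) (jap x ^+ 2 / (1 + d%:R)) by apply: ler_sum => i _; exact: xi.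
rewrite sumr_const card_ord -[\sum_(_ < _) _]/(dotp x x) => h2.
have := jap_sqr x; move: h2; rewrite -[_ *+ d]mulr_natr.
set q := jap x ^+ 2 / (1 + d%:R) => h2 h3.
have h4 : jap x ^+ 2 = q * (1 + d%:R) by rewrite /q divfK// gt_eqF.
have : 1 < q by rewrite ltr_pdivlMr// mul1r; have := jap_ge1 x; nra.
nra.
Qed.

(* The dyadic scale with [2^-j |x_i|] in (1/2, 1], for the dominating coordinate [i], already accounts for [jap x ^ m]. *)
Lemma jap_pow_le (x : V) (m : R) (N : nat) : 0 <= m <= 1 -> jap x <= 2 ^+ N ->
  jap x `^ m <= (1 + d%:R) * (1 + (1 - cos (1/2))^-1 *
    \sum_(i < d) \sum_(j < N.+1) (2 `^ m) ^+ j * (1 - cos ((2^-1) ^+ j * x 0 i))).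
Proof.
move=> /andP[m0 m1] xN.
have k0 : 0 < 1 - cos (1/2) :> R by have /andP[] := @one_minus_cos_half R 1 ltac:(lra).
have t0 i (j : nat) : 0 <= (2 `^ m) ^+ j * (1 - cos ((2^-1) ^+ j * x 0 i)).
  by rewrite mulr_ge0 ?one_minus_cos_ge0// exprn_ge0// powR_ge0.
have s0 i : 0 <= \sum_(j < N.+1) (2 `^ m) ^+ j * (1 - cos ((2^-1) ^+ j * x 0 i)) by apply: sumr_ge0.
have d1 : 1 <= 1 + d%:R :> R by rewrite lerDl.
have d0 : 0 < 1 + d%:R :> R by lra.
have j0 : 0 <= jap x by have := jap_ge1 x; lra.
have [h|[i [h1 h2]]] := jap_le_coord x.
  rewrite (@le_trans _ _ (1 + d%:R))//.
    by apply: le_trans h; rewrite ler1_powR// jap_ge1.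
  rewrite ler_peMr ?(ltW d0)// lerDl mulr_ge0 ?invr_ge0 ?(ltW k0)// sumr_ge0//.
apply: (@le_trans _ _ ((1 + d%:R) * `|x 0 i| `^ m)).
  apply: (@le_trans _ _ (((1 + d%:R) * `|x 0 i|) `^ m)).
    by apply: ge0_ler_powR; rewrite ?nnegrE// mulr_ge0// ltW.
  by rewrite powRM ?(ltW d0)// ler_wpM2r ?powR_ge0// ler1_powR.
apply: (ler_wpM2l (ltW d0)).
have [|j jN /andP[xj hj]] := dyadic_scale h1 (N := N); first exact: le_trans (coord_le_jap x i) xN.
have /andP[_ hc] := one_minus_cos_half hj.
have ec : cos ((2^-1) ^+ j * `|x 0 i|) = cos ((2^-1) ^+ j * x 0 i).
  by rewrite -[RHS]cos_norm normrM [`|_ ^+ j|]ger0_norm// exprn_ge0// invr_ge0.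
rewrite ec in hc.
apply: ler_wpDl => //; rewrite mulrC ler_pdivlMr//.
apply: (@le_trans _ _ ((2 `^ m) ^+ j * (1 - cos ((2^-1) ^+ j * x 0 i)))); last first.
  rewrite (bigD1 i)//= (bigD1 (Ordinal (n := N.+1) (m := j) jN))//= -addrA lerDl.
  by rewrite addr_ge0// sumr_ge0.
apply: ler_pM; [exact: powR_ge0|exact: ltW| |exact: hc].
rewrite -powR_mulrn ?powR_ge0// -powRrM mulrC powRrM powR_mulrn//.
by apply: ge0_ler_powR; rewrite ?nnegrE// exprn_ge0.
Qed.

(** [jap_pow_le] bounds <x>^m by oscillations at the frequencies 2^-j along each axis, and
    [char_moment] makes each of them O(2^(- j M)) uniformly in time. Against the weights 2^(j m) the
    sum over j is geometric. *)
Lemma moment_bound (a : R) (K u0 : V -> R) (v : R -> V -> R) (B p T m M : R) :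
  weak_sol a K u0 v -> \int[mud]_x K x = 1 -> 0 < a -> 1 <= p -> 0 <= B ->
  (forall xi, a * (`|1 - fourier_re K xi| + `|fourier_im K xi|) <= B * enorm xi `^ p) ->
  0 <= m -> m < M -> M <= 1 -> Lint mud (fun x => `|u0 x| * jap x `^ M) ->
  forall t, 0 <= t <= T -> forall N : nat, trunc_moment m (v t) N <= moment_const u0 m M B T.
Proof.
move=> W K1 a0 p1 B0 hB m0 mM M1 uM t /andP[t0 tT] N.
rewrite /trunc_moment /moment_const; set U := \int[mud]_x `|u0 x|; set D := 2 * _ + _.
have M0 : 0 < M := le_lt_trans m0 mM.
have vi := ws_v W t; have vn := Lint_norm vi; have un := Lint_norm (ws_u0 W).
have k0 : 0 < 1 - cos (1/2) :> R by have /andP[] := @one_minus_cos_half R 1 ltac:(lra).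
have U0 : 0 <= U by apply: Rintegral_ge0.
pose e (j : nat) (i : 'I_d) : V := (2^-1) ^+ j *: delta_mx 0 i.
have dote x j i : dotp x (e j i) = (2^-1) ^+ j * x 0 i.
  rewrite dotpZr; congr (_ * _); rewrite /dotp (bigD1 i)//= mxE !eqxx mulr1 big1 ?addr0// => k ki.
  by rewrite mxE eqxx (negbTE ki) mulr0.
have h20 (j : nat) : 0 < (2^-1 : R) ^+ j by rewrite exprn_gt0.
have h21 (j : nat) : (2^-1 : R) ^+ j <= 1 by rewrite exprn_ile1// invf_le1// ler1n.
have norme j i : enorm (e j i) = (2^-1) ^+ j.
  rewrite /e enormZ ?(ltW (h20 j))// /enorm (_ : dotp _ _ = 1) ?sqrtr1 ?mulr1//.
  have := dote (delta_mx 0 i) 0%N i; rewrite /e expr0 scale1r => ->.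
  by rewrite mul1r mxE !eqxx.
have hI (j : nat) (i : 'I_d) : Lint mud (fun x : V => (1 - cos ((2^-1) ^+ j * x 0 i)) * `|v t x|) /\
  \int[mud]_x ((1 - cos ((2^-1) ^+ j * (x : V) 0 i)) * `|v t x|) <= ((2^-1) ^+ j) `^ M * D.
  have cm (xi : V) : Bmeas (fun x => 1 - cos (dotp x xi)) by apply: measurable_funB => //; exact: bmeas_cos.
  have cb (xi : V) (x : V) : `|1 - cos (dotp x xi)| <= 2.
    by rewrite ger0_norm ?one_minus_cos_ge0//; have := cos_geN1 (dotp x xi); lra.
  split.
    apply: (@Lint_eq _ _ _ mud (fun x => (1 - cos (dotp x (e j i))) * `|v t x|)); first by move=> x; rewrite dote.
    by apply: (Lint_bddM mud 2 (fun x => 1 - cos (dotp x (e j i)))); [exact: cm|exact: cb|exact: vn].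
  (* All frequencies involved have norm at most 1, and M <= 1 <= p, so |xi|^p <= 2^(- j M). *)
  have hq r : 0 <= r <= 1 -> a * (`|1 - fourier_re K (r *: e j i)| + `|fourier_im K (r *: e j i)|) <= B * ((2^-1) ^+ j) `^ M.
    move=> /andP[r0 r1]; apply: le_trans (hB _) _; apply: ler_wpM2l => //.
    rewrite enormZ// norme; apply: (@le_trans _ _ (((2^-1) ^+ j) `^ p)).
      by apply: ge0_ler_powR; rewrite ?nnegrE ?mulr_ge0 ?(ltW (h20 j))// ?ler_piMl ?(ltW (h20 j))//; lra.
    by apply: ger_powR; [rewrite h20 h21|lra].
  have := char_moment W K1 t0 a0 hq.
  under eq_Rintegral do rewrite dote.
  move=> /le_trans; apply.
  rewrite (_ : _ * D = (2 * ((2^-1) ^+ j) `^ M) * \int[mud]_x (`|u0 x| * jap (x : V) `^ M) + B * ((2^-1) ^+ j) `^ M * T * U); last by rewrite /D; ring.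
  have BM : 0 <= B * ((2^-1) ^+ j) `^ M by rewrite mulr_ge0// powR_ge0.
  apply: lerD; last by apply: ler_wpM2r => //; exact: ler_wpM2l.
  rewrite -RintegralZl//; apply: le_Rint.
  - by apply: (Lint_bddM mud 2 (fun x => 1 - cos (dotp x _))); [exact: cm|exact: cb|exact: un].
  - exact: LintZ.
  move=> x; rewrite (mulrC `|u0 x|) mulrA; apply: ler_wpM2r => //.
  have M01 : 0 < M <= 1 by rewrite M0.
  apply: le_trans (one_minus_cos_le _ M01) _; rewrite -mulrA; apply: ler_wpM2l => //.
  rewrite -powRM ?(ltW (h20 j))//; last by have := jap_ge1 x; lra.
  apply: ge0_ler_powR; rewrite ?nnegrE ?(ltW M0)//.
    by rewrite mulr_ge0 ?(ltW (h20 j))//; have := jap_ge1 x; lra.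
  rewrite dotpZr dote mulrA normrM ler_pM// ?coord_le_jap//.
  rewrite ger0_norm ?mulr_ge0 ?expR_ge0 ?(ltW (h20 j))// ler_piMl ?(ltW (h20 j))//.
  by rewrite -expR0 ler_expR oppr_le0.
pose F (i : 'I_d) (x : V) := \sum_(j < N.+1) (2 `^ m) ^+ j * ((1 - cos ((2^-1) ^+ j * x 0 i)) * `|v t x|).
have Fi i : Lint mud (F i) /\ \int[mud]_x F i x <= D * (1 - 2 `^ (m - M))^-1.
  have [h1 h2] := @Lint_bigsum _ _ _ mud N.+1 (fun (j : 'I_N.+1) (x : V) => (2 `^ m) ^+ j * ((1 - cos ((2^-1) ^+ j * x 0 i)) * `|v t x|))
    (fun j => LintZ _ (hI j i).1).
  split => //; rewrite h2.
  have D0 : 0 <= D.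
    rewrite /D addr_ge0 ?mulr_ge0//; last by rewrite (le_trans t0).
    by apply: Rintegral_ge0 => x _; rewrite mulr_ge0// powR_ge0.
  have q1 : 0 <= (2 : R) `^ (m - M) < 1.
    rewrite powR_ge0 /= /powR ifF; last by apply/negbTE.
    by rewrite expR_lt1 pmulr_llt0 ?subr_lt0// ln_gt0// ltr1n.
  apply: (@le_trans _ _ (\sum_(j < N.+1) D * (2 `^ (m - M)) ^+ j)); last first.
    by rewrite -mulr_sumr; apply: ler_wpM2l => //; exact: geom_le.
  apply: ler_sum => j _; rewrite RintegralZl//; last exact: (hI j i).1.
  apply: le_trans (ler_wpM2l (exprn_ge0 _ (powR_ge0 _ _)) (hI j i).2) _.
  rewrite mulrA [leLHS]mulrC; apply: le_of_eq; congr (_ * _).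
  rewrite -powR_mulrn ?powR_ge0// -(powR_mulrn _ (powR_ge0 _ _)) -!powRrM.
  rewrite exprVn -powR_invn// -powRrM -powRD; last by rewrite pnatr_eq0 implybT.
  by congr (_ `^ _); ring.
have [Gi Ge] := @Lint_bigsum _ _ _ mud d F (fun i => (Fi i).1).
apply: (@le_trans _ _ (\int[mud]_x ((1 + d%:R) * (`|v t x| + (1 - cos (1/2))^-1 * \sum_(i < d) F i x)))).
  have RI : Lint mud (fun x => (1 + d%:R) * (`|v t x| + (1 - cos (1/2))^-1 * \sum_(i < d) F i x)).
    by apply: LintZ; apply: LintD => //; exact: LintZ.
  have pw (x : V) : \1_(jap_ball (2 ^+ N)) x * (jap x `^ m * `|v t x|) <= (1 + d%:R) * (`|v t x| + (1 - cos (1/2))^-1 * \sum_(i < d) F i x).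
    have E : (1 + d%:R) * (`|v t x| + (1 - cos (1/2))^-1 * \sum_(i < d) F i x) = (1 + d%:R) * (1 + (1 - cos (1/2))^-1 *
      \sum_(i < d) \sum_(j < N.+1) (2 `^ m) ^+ j * (1 - cos ((2^-1) ^+ j * x 0 i))) * `|v t x|.
      rewrite (_ : \sum_(i < d) F i x = (\sum_(i < d) \sum_(j < N.+1) (2 `^ m) ^+ j * (1 - cos ((2^-1) ^+ j * x 0 i))) * `|v t x|).
        by move: (\sum_(i < d) _) (_^-1) => S k; ring.
      rewrite mulr_suml; apply: eq_bigr => i _; rewrite mulr_suml; apply: eq_bigr => j _.
      by rewrite mulrA.
    rewrite E mulrA; apply: ler_wpM2r => //.
    rewrite indicE; case: (boolP (x \in _)) => hx; last first.
      rewrite mul0r mulr_ge0// addr_ge0// mulr_ge0 ?invr_ge0 ?(ltW k0)//.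
      apply: sumr_ge0 => i _; apply: sumr_ge0 => j _.
      by rewrite mulr_ge0 ?one_minus_cos_ge0// exprn_ge0// powR_ge0.
    rewrite [_%:R * _]mul1r; apply: jap_pow_le; first by rewrite m0 ltW// (lt_le_trans mM).
    by move: hx; rewrite inE.
  apply: le_Rint => //.
  apply: Lint_le RI => //.
    apply: measurable_funM.
      apply: measurable_indic; rewrite -[X in measurable X]setTI.
      exact: (@measurable_fun_le _ (Borel R d) R setT (@jap R d) (fun _ => 2 ^+ N) measurableT bmeas_jap (measurable_cst _)).
    by apply: measurable_funM; [exact: bmeas_jap_pow|exact: Lint_meas vn].
  move=> x; rewrite ger0_norm; first exact: pw.
  by rewrite mulr_ge0// mulr_ge0// powR_ge0.
rewrite RintegralZl//; last by apply: LintD => //; exact: LintZ.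
rewrite RintegralD//; last exact: LintZ.
rewrite RintegralZl// Ge; apply: ler_wpM2l; first by rewrite addr_ge0.
apply: lerD; first exact: (mass_bound W K1 t0).
apply: ler_wpM2l; first by rewrite invr_ge0 ltW.
apply: (@le_trans _ _ (\sum_(i < d) D * (1 - 2 `^ (m - M))^-1)).
  by apply: ler_sum => i _; exact: (Fi i).2.
by rewrite sumr_const card_ord [leRHS]mulr_natl.
Qed.

End moment.

(** * Comparison of the symbols *)

Section powers.
Context {R : realType}.

Lemma powRE (r t : R) : 0 < r -> r `^ t = expR (t * ln r).
Proof. by move=> r0; rewrite /powR gt_eqF. Qed.

Lemma ln_le_powR (r g : R) : 0 < g -> 1 <= r -> ln r <= g^-1 * r `^ g.
Proof.
move=> g0 r1; rewrite mulrC ler_pdivlMr// mulrC -ln_powR ltW// ln_sublinear// powR_gt0; lra.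
Qed.

Lemma mulr_ln_le1 (r : R) : 0 < r <= 1 -> r * `|ln r| <= 1.
Proof.
move=> /andP[r0 r1]; rewrite ler0_norm ?ln_le0// -lnV ?posrE// mulrC -ler_pdivlMr// mul1r.
by rewrite ltW// ln_sublinear// invr_gt0.
Qed.

Lemma expR_diff_le (x : R) : `|1 - expR x| <= `|x| * Num.max 1 (expR x).
Proof.
have [x0|x0] := leP 0 x.
  have h : 1 <= expR x by rewrite -expR0 ler_expR.
  rewrite ler0_norm ?subr_le0// (ger0_norm x0) max_r//.
  have := expR_ge1Dx (- x); rewrite expRN => h2.
  have h3 : expR x * (1 - x) <= 1.
    by rewrite -[leRHS](mulfV (lt0r_neq0 (expR_gt0 x))) ler_wpM2l// expR_ge0.
  lra.
have h : expR x <= 1 by rewrite -expR0 ler_expR ltW.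
rewrite ger0_norm ?subr_ge0// (ltr0_norm x0) max_l// mulr1.
have := expR_ge1Dx x; lra.
Qed.

(** The difference is r^(2s) (1 - e^(2 (1 - s) ln r)), and |1 - e^x| <= |x| max(1, e^x); this is
    where replacing |xi|^(2s) by |xi|^2 yields the factor 1 - s. *)
Lemma powR_diff_le (r s : R) : 0 < r -> s <= 1 ->
  `|r `^ (2 * s) - r ^+ 2| <= 2 * (1 - s) * (`|ln r| * Num.max (r `^ (2 * s)) (r ^+ 2)).
Proof.
move=> r0 s1; rewrite -powR_mulrn ?(ltW r0)// !powRE//.
have -> : expR (2 * ln r) = expR (2 * s * ln r) * expR (2 * (1 - s) * ln r).
  by rewrite -expRD; congr expR; ring.
set E := expR (2 * s * ln r); have E0 : 0 < E by exact: expR_gt0.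
have -> : E - E * expR (2 * (1 - s) * ln r) = E * (1 - expR (2 * (1 - s) * ln r)) by ring.
rewrite normrM (gtr0_norm E0) -[X in Num.max X]mulr1 -maxr_pMr ?(ltW E0)//.
have := expR_diff_le (2 * (1 - s) * ln r); rewrite normrM ger0_norm; last lra.
move=> /(ler_wpM2l (ltW E0)) h; apply: le_trans h _.
by apply: le_of_eq; ring.
Qed.

Lemma jap_power_ge (r eta : R) : 0 < r -> 0 <= eta ->
  1 <= (1 + r ^+ 2) `^ (eta / 2) /\ r `^ eta <= (1 + r ^+ 2) `^ (eta / 2).
Proof.
move=> r0 e0; have e2 : 0 <= eta / 2 by rewrite divr_ge0.
split.
  by rewrite -[leLHS](powRr0 (1 + r ^+ 2)) ler_powR// lerDl sqr_ge0.
have -> : r `^ eta = (r ^+ 2) `^ (eta / 2).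
  by rewrite -powR_mulrn ?(ltW r0)// -powRrM; congr (_ `^ _); field.
by apply: ge0_ler_powR; rewrite ?nnegrE ?addr_ge0 ?sqr_ge0// lerDr.
Qed.

(** For r <= 1 the power 2s + dl > 1 leaves a factor r that beats the logarithm. For r > 1 the
    logarithm costs r^g / g, the margin of the Sobolev weight over 2 + dl. *)
Lemma low_power_ln (r s dl g : R) : 0 < r -> 1/2 < s < 1 -> 0 < dl -> 0 < g ->
  r `^ (2 * s + dl) * (1 + `|ln r|) <= (2 + g^-1) * (1 + r ^+ 2) `^ ((2 + dl + g) / 2).
Proof.
move=> r0 /andP[s1 s2] d0 g0; have gi : 0 < g^-1 by rewrite invr_gt0.
have [|J1 J2] := @jap_power_ge r (2 + dl + g) r0; first lra.
set J := _ `^ _ in J1 J2 *.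
have [r1|r1] := leP r 1.
  have h1 : r `^ (2 * s + dl) <= r.
    by rewrite -[leRHS]powRr1 ?(ltW r0)//; apply: ger_powR; [rewrite r0|lra].
  have h2 : r * (1 + `|ln r|) <= 2.
    by rewrite mulrDr mulr1; have := @mulr_ln_le1 r; rewrite r0 r1 => /(_ isT); lra.
  apply: (@le_trans _ _ (r * (1 + `|ln r|))); first by rewrite ler_wpM2r// addr_ge0.
  apply: (le_trans h2); nra.
have l0 : 0 <= ln r by rewrite ln_ge0// ltW.
rewrite (ger0_norm l0).
apply: (@le_trans _ _ (r `^ (2 + dl) * ((1 + g^-1) * r `^ g))).
  apply: ler_pM; rewrite ?powR_ge0 ?addr_ge0//.
    by apply: ler_powR; lra.
  have p1 : 1 <= r `^ g by rewrite -[leLHS](powRr0 r); apply: ler_powR; lra.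
  by rewrite mulrDl mul1r lerD// ln_le_powR// ltW.
rewrite mulrCA -powRD; last by rewrite (gt_eqF r0) implybT.
by apply: ler_pM => //; rewrite ?powR_ge0; lra.
Qed.

Lemma ln_max_power (r s dl g : R) : 0 < r -> 1/2 < s < 1 -> 0 < dl -> 0 < g ->
  `|ln r| * Num.max (r `^ (2 * s)) (r ^+ 2) <= (2 + g^-1) * (1 + r ^+ 2) `^ ((2 + dl + g) / 2).
Proof.
move=> r0 /andP[s1 s2] d0 g0; have gi : 0 < g^-1 by rewrite invr_gt0.
have [|J1 J2] := @jap_power_ge r (2 + dl + g) r0; first lra.
set J := _ `^ _ in J1 J2 *.
have [r1|r1] := leP r 1.
  have h1 : Num.max (r `^ (2 * s)) (r ^+ 2) <= r.
    rewrite ge_max; apply/andP; split.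
      by rewrite -[leRHS]powRr1 ?(ltW r0)//; apply: ger_powR; [rewrite r0|lra].
    by rewrite expr2 ger_pMl.
  have h2 := @mulr_ln_le1 r; rewrite r0 r1 in h2; have {}h2 := h2 isT.
  apply: (@le_trans _ _ (`|ln r| * r)); first by rewrite ler_wpM2l.
  rewrite mulrC; apply: (le_trans h2); nra.
have l0 : 0 <= ln r by rewrite ln_ge0// ltW.
have h1 : Num.max (r `^ (2 * s)) (r ^+ 2) <= r `^ (2 + dl).
  rewrite -powR_mulrn ?(ltW r0)// ge_max; apply/andP; split; apply: ler_powR; lra.
rewrite (ger0_norm l0).
apply: (@le_trans _ _ ((g^-1 * r `^ g) * r `^ (2 + dl))).
  apply: ler_pM => //; first by rewrite le_max powR_ge0.
  by rewrite ln_le_powR// ltW.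
rewrite -mulrA -powRD; last by rewrite (gt_eqF r0) implybT.
rewrite (addrC g); apply: ler_pM => //; rewrite ?powR_ge0 ?(ltW gi)//; lra.
Qed.

(* [f / (eps r)^(2s)] and [f1 / (eps r)^2] are the rescaled symbols; the difference splits as
   [r^(2s) (m_s - m_1) + (r^(2s) - r^2) m_1]. *)
Lemma symbol_diff (eps r s dl g cc B f f1 : R) : 0 < eps < 1 -> 0 < r -> 1/2 < s < 1 -> 0 < dl -> 0 < g ->
  0 <= cc -> 0 <= B ->
  `|f / (eps * r) `^ (2 * s) - f1 / (eps * r) ^+ 2| <=
     cc * (1 - s) * (eps * r) `^ dl * Num.max 1 `|ln (eps * r)| ->
  `|f1| <= B * (eps * r) ^+ 2 ->
  `|eps `^ (- (2 * s)) * f - eps `^ (- 2) * f1| <=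
  (1 - s) * (1 + eps `^ dl * `|ln eps|) * ((cc + 2 * B) * (2 + g^-1)) * (1 + r ^+ 2) `^ ((2 + dl + g) / 2).
Proof.
move=> /andP[e0 e1] r0 s12 d0 g0 c0 B0 h1 h2; have /andP[s1 s2] := s12.
have er0 : 0 < eps * r by rewrite mulr_gt0.
set m := f / _ in h1; set m1 := f1 / _ in h1.
have -> : eps `^ (- (2 * s)) * f = r `^ (2 * s) * m.
  rewrite /m powRM ?(ltW e0) ?(ltW r0)// powRN; field.
  by rewrite !gt_eqF ?powR_gt0.
have -> : eps `^ (- 2) * f1 = r ^+ 2 * m1.
  rewrite /m1 powRN powR_mulrn ?(ltW e0)//; field.
  by rewrite !gt_eqF.
have hm1 : `|m1| <= B by rewrite /m1 normrM normfV (gtr0_norm (exprn_gt0 _ er0)) ler_pdivrMr ?exprn_gt0.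
have -> : r `^ (2 * s) * m - r ^+ 2 * m1 = r `^ (2 * s) * (m - m1) + (r `^ (2 * s) - r ^+ 2) * m1 by ring.
clearbody m m1.
apply: le_trans (ler_normD _ _) _; rewrite !normrM (ger0_norm (powR_ge0 _ _)).
set J := (1 + r ^+ 2) `^ _; set G := 2 + g^-1; set L := 1 + _ * `|ln eps|.
have G0 : 0 < G by rewrite addr_gt0// invr_gt0.
have J0 : 0 <= J by exact: powR_ge0.
have ed : 0 <= eps `^ dl <= 1.
  by rewrite powR_ge0 /= -[leRHS](powRr0 eps); apply: ger_powR; [rewrite e0 ltW|exact: ltW].
have /andP[ed0 ed1] := ed.
have L1 : 1 <= L by rewrite lerDl mulr_ge0.
have s0 : 0 <= 1 - s by lra.
have t1 : r `^ (2 * s) * `|m - m1| <= (1 - s) * L * (cc * G) * J.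
  apply: le_trans (ler_wpM2l (powR_ge0 _ _) h1) _.
  (* Separates eps from r: the factor in eps goes into the rate, the factor in r into the Sobolev
     weight. *)
  have hmax : Num.max 1 `|ln (eps * r)| <= (1 + `|ln eps|) * (1 + `|ln r|).
    have p1 := normr_ge0 (ln eps); have p2 := normr_ge0 (ln r).
    rewrite ge_max lnM ?posrE//; apply/andP; split; first by nra.
    by apply: le_trans (ler_normD _ _) _; nra.
  have hA := low_power_ln r0 s12 d0 g0; rewrite -/J -/G in hA.
  have hL : eps `^ dl * (1 + `|ln eps|) <= L by rewrite /L mulrDr mulr1 lerD2r.
  apply: (@le_trans _ _ (r `^ (2 * s) * (cc * (1 - s) * (eps * r) `^ dl * ((1 + `|ln eps|) * (1 + `|ln r|))))).
    apply: ler_wpM2l; first exact: powR_ge0.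
    by apply: ler_wpM2l => //; rewrite mulr_ge0 ?powR_ge0// mulr_ge0.
  rewrite powRM ?(ltW e0) ?(ltW r0)//.
  rewrite (_ : _ * _ = (cc * (1 - s)) * ((eps `^ dl * (1 + `|ln eps|)) * (r `^ (2 * s + dl) * (1 + `|ln r|)))); last first.
    by rewrite powRD; [ring|rewrite (gt_eqF r0) implybT].
  rewrite (_ : (1 - s) * L * (cc * G) * J = (cc * (1 - s)) * (L * (G * J))); last by ring.
  apply: ler_wpM2l; first by rewrite mulr_ge0.
  by apply: ler_pM => //; rewrite mulr_ge0 ?powR_ge0// addr_ge0.
have t2 : `|r `^ (2 * s) - r ^+ 2| * `|m1| <= (1 - s) * L * (2 * B * G) * J.
  have hA := ln_max_power r0 s12 d0 g0; rewrite -/J -/G in hA.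
  have hd := powR_diff_le r0 (ltW s2).
  apply: (@le_trans _ _ ((2 * (1 - s) * (G * J)) * B)).
    apply: ler_pM => //; apply: le_trans hd _; apply: ler_wpM2l => //; lra.
  have GJ : 0 <= (1 - s) * (2 * B * G * J) by rewrite !mulr_ge0// ltW.
  nra.
apply: le_trans (lerD t1 t2) _.
by apply: le_of_eq; ring.
Qed.

End powers.

(** * Rescaled kernels and the difference of two solutions *)

Section solutions.
Context {R : realType} {d : nat}.
Local Notation mud := (mu R d).
Local Notation V := 'rV[R]_d.

Lemma Lint_resc (eps : R) (h : V -> R) : 0 < eps -> Lint mud h ->
  Lint mud (resc eps h) /\ \int[mud]_x resc eps h x = \int[mud]_x h x.
Proof.
move=> e0 hi; have ei : eps^-1 != 0 by rewrite invr_eq0 gt_eqF.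
have [h1 h2] := Lint_scale ei hi; split; first exact: LintZ.
rewrite RintegralZl//.
rewrite h2 gtr0_norm ?invr_gt0// invrK powR_invn ?(ltW e0)// mulrA mulVf ?mul1r//.
by rewrite expf_neq0// gt_eqF.
Qed.

Lemma fourier_resc (eps : R) (J : V -> R) xi : 0 < eps -> Lint mud J ->
  fourier_re (resc eps J) xi = fourier_re J (eps *: xi) /\
  fourier_im (resc eps J) xi = fourier_im J (eps *: xi).
Proof.
move=> e0 Ji; have [Ki _] := Lint_resc e0 Ji.
have E (x : V) : dotp (eps^-1 *: x) (eps *: xi) = dotp x xi.
  by rewrite dotpZl dotpZr mulrA mulVf ?gt_eqF// mul1r.
rewrite !fourier_reE// !fourier_imE//; split.
  have [_ <-] := Lint_resc e0 (Lint_cos Ji (eps *: xi)).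
  by apply: eq_Rintegral => x _; rewrite /resc E; ring.
have [_ <-] := Lint_resc e0 (Lint_sin Ji (eps *: xi)).
by congr (- _); apply: eq_Rintegral => x _; rewrite /resc E; ring.
Qed.

Lemma prob_density_Lint (J : V -> R) : prob_density J ->
  [/\ Lint mud J, forall x, 0 <= J x & \int[mud]_x J x = 1].
Proof. by move=> [/integrableE Ji [J0 J1]]; split => //; rewrite -integE. Qed.

Lemma cmod_ge (a b : R) : `|a| <= cmod a b /\ `|b| <= cmod a b.
Proof.
rewrite /cmod -!sqrtr_sqr !ler_sqrt ?addr_ge0 ?sqr_ge0//.
by rewrite lerDl lerDr !sqr_ge0.
Qed.

(** For |xi| <= 1 the expansion gives 1 + 2 C0. For |xi| > 1 the trivial bound |J^| <= 1 on both
    parts gives 3 <= 3 |xi|^p. *)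
Lemma symbol_bound (J : V -> R) (p dl C0 : R) : Lint mud J -> (forall x, 0 <= J x) ->
  \int[mud]_x J x = 1 -> 0 < p -> 0 < dl -> 0 < C0 ->
  (forall xi, enorm xi <= 1 ->
     cmod (fourier_re J xi - (1 - enorm xi `^ p)) (fourier_im J xi) <= C0 * enorm xi `^ (p + dl)) ->
  forall xi, `|1 - fourier_re J xi| + `|fourier_im J xi| <= (3 + 2 * C0) * enorm xi `^ p.
Proof.
move=> Ji J0 J1 p0 d0 C0p h xi.
have r0 : 0 <= enorm xi := enorm_ge0 xi.
have P0 : 0 <= enorm xi `^ p by exact: powR_ge0.
have [r1|r1] := leP (enorm xi) 1.
  have [h1 h2] := cmod_ge (fourier_re J xi - (1 - enorm xi `^ p)) (fourier_im J xi).
  have h3 := h xi r1.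
  have h4 : enorm xi `^ (p + dl) <= enorm xi `^ p.
    have [->|rn0] := eqVneq (enorm xi) 0.
      by rewrite !powR0 ?gt_eqF// addr_gt0.
    by apply: ger_powR; [rewrite r1 andbT lt_neqAle eq_sym rn0|rewrite lerDl ltW].
  have h5 := ler_wpM2l (ltW C0p) h4.
  have h6 : `|1 - fourier_re J xi| <= `|fourier_re J xi - (1 - enorm xi `^ p)| + enorm xi `^ p.
    rewrite -{2}(ger0_norm P0) -[`|fourier_re _ _ - _|]normrN; apply: le_trans _ (ler_normD _ _).
    by apply: le_of_eq; congr (`|_|); ring.
  nra.
have [f1 f2] := fourier_le xi Ji.
have JJ : \int[mud]_x `|J x| = 1 by rewrite -J1; apply: eq_Rintegral => x _; rewrite ger0_norm.
rewrite JJ in f1 f2.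
have h1 : 1 <= enorm xi `^ p by rewrite -[leLHS](powRr0 (enorm xi)); apply: ler_powR; [exact: ltW|exact: ltW].
have h2 : `|1 - fourier_re J xi| <= 2 by apply: le_trans (ler_normB _ _) _; rewrite normr1; lra.
nra.
Qed.

(** The rate eps^(- p) exactly compensates (eps |xi|)^p, so the bound is free of eps. *)
Lemma resc_symbol_bound (J : V -> R) (p B eps : R) : Lint mud J -> 0 < eps ->
  (forall xi, `|1 - fourier_re J xi| + `|fourier_im J xi| <= B * enorm xi `^ p) ->
  forall xi, eps `^ (- p) * (`|1 - fourier_re (resc eps J) xi| + `|fourier_im (resc eps J) xi|) <= B * enorm xi `^ p.
Proof.
move=> Ji e0 h xi; have [-> ->] := fourier_resc xi e0 Ji.
apply: le_trans (ler_wpM2l (powR_ge0 _ _) (h (eps *: xi))) _.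
rewrite enormZ ?(ltW e0)// powRM ?(ltW e0) ?enorm_ge0// powRN.
apply: le_of_eq; field.
by rewrite gt_eqF// powR_gt0.
Qed.

Lemma fourier0 (J : V -> R) : Lint mud J -> \int[mud]_x J x = 1 -> fourier_re J 0 = 1 /\ fourier_im J 0 = 0.
Proof.
move=> Ji J1; rewrite fourier_reE// fourier_imE//.
have E (x : V) : dotp x 0 = 0 by rewrite /dotp big1// => i _; rewrite mxE mulr0.
split; first by rewrite -[RHS]J1; apply: eq_Rintegral => x _; rewrite E cos0 mul1r.
under eq_Rintegral do rewrite E sin0 mul0r.
by rewrite Rintegral_cst// mul0r oppr0.
Qed.

Lemma fourierB (f g : V -> R) xi : Lint mud f -> Lint mud g ->
  fourier_re (fun x => f x - g x) xi = fourier_re f xi - fourier_re g xi /\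
  fourier_im (fun x => f x - g x) xi = fourier_im f xi - fourier_im g xi.
Proof.
move=> fi gi; have fgi := LintB fi gi.
rewrite !fourier_reE// !fourier_imE//; split.
  rewrite -RintegralB//; [|exact: Lint_cos|exact: Lint_cos].
  by apply: eq_Rintegral => x _; rewrite mulrBr.
rewrite -opprD -RintegralB//; [|exact: Lint_sin|exact: Lint_sin].
by congr (- _); apply: eq_Rintegral => x _; rewrite mulrBr.
Qed.

(** The difference of the two transforms solves the first ODE with zero initial value and forcing -
    (alpha - alpha1) u1^, so [ode_energy] applies; the factor 2 collects the real and imaginary
    parts of alpha - alpha1. *)
Lemma fourier_diff (a a1 : R) (K K1 u0 : V -> R) (v v1 : R -> V -> R) (T b : R) (z : V) :
  weak_sol a K u0 v -> weak_sol a1 K1 u0 v1 ->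
  \int[mud]_x K x = 1 -> \int[mud]_x K1 x = 1 -> 0 < T ->
  (forall tau, 0 <= tau <= T ->
    `|a * (1 - fourier_re K (expR tau *: z)) - a1 * (1 - fourier_re K1 (expR tau *: z))| <= b /\
    `|a * (- fourier_im K (expR tau *: z)) - a1 * (- fourier_im K1 (expR tau *: z))| <= b) ->
  forall t, 0 <= t <= T ->
    (fourier_re (v t) (expR t *: z) - fourier_re (v1 t) (expR t *: z)) ^+ 2 +
    (fourier_im (v t) (expR t *: z) - fourier_im (v1 t) (expR t *: z)) ^+ 2 <=
    expR 1 * T ^+ 2 * (2 * b ^+ 2 * (fourier_sq u0 z)).
Proof.
move=> W W1 i1 i2 T0 hb t tT.
have [P [Q [PE QE P0 Q0 dPQ]]] := fourier_ode W z.
have [P1 [Q1 [PE1 QE1 P10 Q10 dPQ1]]] := fourier_ode W1 z.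
have re1 (L : V -> R) (xi : V) : Lint mud L -> (forall x, 0 <= L x) -> \int[mud]_x L x = 1 -> 0 <= 1 - fourier_re L xi.
  move=> Li L0 L1; rewrite subr_ge0; apply: le_trans (ler_norm _) _.
  have [+ _] := fourier_le xi Li => /le_trans; apply.
  by rewrite -L1; apply: le_of_eq; apply: eq_Rintegral => x _; rewrite ger0_norm.
pose al s := a * (1 - fourier_re K (expR s *: z)); pose ga s := - (a * fourier_im K (expR s *: z)).
pose al1 s := a1 * (1 - fourier_re K1 (expR s *: z)); pose ga1 s := - (a1 * fourier_im K1 (expR s *: z)).
have al0 s : 0 <= al s by rewrite mulr_ge0 ?(ws_a W)//; apply: re1 => //; [exact: (ws_K W)|exact: (ws_K0 W)].
have al10 s : 0 <= al1 s by rewrite mulr_ge0 ?(ws_a W1)//; apply: re1 => //; [exact: (ws_K W1)|exact: (ws_K0 W1)].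
set U := fourier_re u0 z ^+ 2 + _.
have U0 : 0 <= U by rewrite addr_ge0 ?sqr_ge0.
(* Re alpha1 >= 0, so |u1^| decreases along the characteristic and the forcing is controlled by u0^
   alone. *)
have decay s : 0 <= s <= T -> P1 s ^+ 2 + Q1 s ^+ 2 <= U.
  move=> sT; rewrite /U -P10 -Q10.
  pose H (s : R) := P1 s * P1 s + Q1 s * Q1 s.
  pose dH (s : R) := (P1 s * (- (al1 s * P1 s - ga1 s * Q1 s)) + P1 s * (- (al1 s * P1 s - ga1 s * Q1 s))) +
    (Q1 s * (- (al1 s * Q1 s + ga1 s * P1 s)) + Q1 s * (- (al1 s * Q1 s + ga1 s * P1 s))).
  have := @derive_le0 R H dH T _ _ s sT; rewrite /H -!expr2; apply.
    move=> x /andP[x0 _]; have [h1 h2] := dPQ1 x x0.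
    by apply: isdD; apply: isdM.
  move=> x _; have h := al10 x.
  have -> : dH x = - (2 * (al1 x * (P1 x ^+ 2 + Q1 x ^+ 2))) by rewrite /dH; ring.
  by rewrite oppr_le0 mulr_ge0// mulr_ge0// addr_ge0// sqr_ge0.
pose w1 s := - ((al s - al1 s) * P1 s - (ga s - ga1 s) * Q1 s).
pose w2 s := - ((al s - al1 s) * Q1 s + (ga s - ga1 s) * P1 s).
have t0 : 0 <= t by case/andP: tT.
rewrite -PE// -QE// -PE1// -QE1//.
have E := @ode_energy R al ga w1 w2 (fun s => P s + -1 * P1 s) (fun s => Q s + -1 * Q1 s) (2 * b ^+ 2 * U) T T0.
rewrite -[P t - _]/(P t + - P1 t) -[Q t - _]/(Q t + - Q1 t) -(mulN1r (P1 t)) -(mulN1r (Q1 t)).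
apply: E => //.
- by rewrite mulr_ge0// mulr_ge0// sqr_ge0.
- move=> x /andP[x0 _]; have [h1 _] := dPQ x x0; have [h2 _] := dPQ1 x x0.
  apply: isd_eq (isdD h1 (isdZ (-1) h2)) _; rewrite /w1 /al /ga /al1 /ga1; ring.
- move=> x /andP[x0 _]; have [_ h1] := dPQ x x0; have [_ h2] := dPQ1 x x0.
  apply: isd_eq (isdD h1 (isdZ (-1) h2)) _; rewrite /w2 /al /ga /al1 /ga1; ring.
- move=> x xT; have [b1 b2] := hb x xT; have dc := decay x xT.
  have -> : w1 x ^+ 2 + w2 x ^+ 2 = ((al x - al1 x) ^+ 2 + (ga x - ga1 x) ^+ 2) * (P1 x ^+ 2 + Q1 x ^+ 2).
    by rewrite /w1 /w2; ring.
  have sq (y : R) : `|y| <= b -> y ^+ 2 <= b ^+ 2.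
    by move=> yb; rewrite -real_normK ?num_real// lerXn2r ?nnegrE// (le_trans _ yb).
  apply: ler_pM => //; rewrite ?addr_ge0 ?sqr_ge0//.
  have s1 : (al x - al1 x) ^+ 2 <= b ^+ 2 by exact: sq b1.
  have s2 : (ga x - ga1 x) ^+ 2 <= b ^+ 2.
    have -> : ga x - ga1 x = a * - fourier_im K (expR x *: z) - a1 * - fourier_im K1 (expR x *: z) by rewrite /ga /ga1; ring.
    exact: sq b2.
  by rewrite (_ : 2 * b ^+ 2 = b ^+ 2 + b ^+ 2) ?lerD//; ring.
- by rewrite P0 P10 mulN1r subrr.
- by rewrite Q0 Q10 mulN1r subrr.
Qed.

(** * Interpolation *)

Lemma L1kE (k : R) (f : V -> R) : L1k k f -> Bmeas f /\ Lint mud (fun x => `|f x| * jap x `^ k).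
Proof.
move=> [mf fi]; split => //; apply/LintP.
have mh : Bmeas (fun x => `|f x| * jap x `^ k).
  by apply: measurable_funM; [exact: measurableT_comp|exact: bmeas_jap_pow].
split => //; under eq_integral => x _ do rewrite ger0_norm ?mulr_ge0 ?powR_ge0//.
by rewrite -iint_ge0E// => x; rewrite mulr_ge0// powR_ge0.
Qed.

Lemma L1k_normE (k : R) (f : V -> R) : Bmeas f -> L1k_norm k f = \int[mud]_x (`|f x| * jap (x : V) `^ k).
Proof.
move=> mf; rewrite /L1k_norm iint_ge0E//.
  by apply: measurable_funM; [exact: measurableT_comp|exact: bmeas_jap_pow].
by move=> x; rewrite mulr_ge0// powR_ge0.
Qed.

Lemma jap_pow_ge1 (k : R) (x : V) : 0 <= k -> 1 <= jap x `^ k.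
Proof. by move=> k0; rewrite -[leLHS](powRr0 (jap x)) ler_powR// jap_ge1. Qed.

Lemma L1k_Lint (k : R) (f : V -> R) : 0 <= k -> L1k k f -> Lint mud f.
Proof.
move=> k0 /L1kE[mf fi]; apply: Lint_le fi => // x.
by rewrite ler_peMr// jap_pow_ge1.
Qed.

Lemma L1kB (k : R) (f g : V -> R) : L1k k f -> L1k k g ->
  Lint mud (fun x => `|f x - g x| * jap x `^ k).
Proof.
move=> /L1kE[mf fi] /L1kE[mg gi]; apply: Lint_le (LintD fi gi).
  apply: measurable_funM; last exact: bmeas_jap_pow.
  by apply: measurableT_comp => //; exact: measurable_funB.
move=> x; rewrite ger0_norm ?mulr_ge0 ?powR_ge0// -mulrDl ler_wpM2r ?powR_ge0//.
exact: ler_normB.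
Qed.

(* The mild solution is only specified for nonnegative times, whereas [L1cont] is a statement on the whole line. *)
Lemma mild_weak (k a : R) (K u0 : V -> R) (u : R -> V -> R) : 0 <= k -> mild_sol k a K u0 u ->
  0 <= a -> Lint mud K -> (forall x, 0 <= K x) -> Lint mud u0 ->
  weak_sol a K u0 (fun t => u (Num.max t 0)).
Proof.
move=> k0 [uk [uc uD]] a0 Ki K0 u0i.
have m0 (t : R) : 0 <= Num.max t 0 := max0_ge0 t.
have ui t : Lint mud (u (Num.max t 0)) by apply: L1k_Lint k0 _; exact: uk.
split => //.
- move=> t0; apply/cvgrPdist_le => e e0.
  have /cvgrPdist_le/(_ _ e0) := uc _ (m0 t0).
  move=> /nbhs_ballP[r /= r0 hr].
  apply/nbhs_ballP; exists r => //= t tr.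
  have := hr (Num.max t 0); rewrite /ball /= => /(_ _ (m0 t)).
  rewrite !sub0r !normrN => h.
  have {}h := h (le_lt_trans (lip_max0 t0 t) tr).
  move: h; rewrite L1k_normE; last by apply: measurable_funB; exact: Lint_meas (ui _).
  rewrite ger0_norm; last by apply: Rintegral_ge0 => x _; rewrite mulr_ge0// powR_ge0.
  apply: le_trans; rewrite ger0_norm ?Rintegral_ge0//.
  apply: le_Rint.
  + by apply/Lint_norm/LintB.
  + by apply: L1kB; exact: uk.
  + by move=> x; rewrite ler_peMr// jap_pow_ge1.
- move=> t t0; have := uD t t0; congr (_ = _); congr iint; apply/funext => x.
  have -> : Num.max t 0 = t by rewrite max_l.
  congr (`|_ - _|%:E); rewrite /duhamel; congr (_ + _ * fine _).
  by apply: eq_integral => s; rewrite inE /= => /andP[s0 _]; rewrite max_l.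
Qed.

Lemma measurable_jap_le (r : R) : measurable (jap_ball r : set (Borel R d)).
Proof.
rewrite -[X in measurable X]setTI.
exact: (@measurable_fun_le _ (Borel R d) R setT (@jap R d) (fun _ => r) measurableT bmeas_jap (measurable_cst _)).
Qed.

Lemma Lint_trunc_moment (m : R) (f : V -> R) (n : nat) : 0 <= m -> Lint mud f ->
  Lint mud (fun x : V => \1_(jap_ball (2 ^+ n)) x * (jap x `^ m * `|f x|)).
Proof.
move=> m0 fi.
apply: (@Lint_eq _ _ _ mud (fun x : V => (\1_(jap_ball (2 ^+ n)) x * jap x `^ m) * `|f x|)); first by move=> x; rewrite mulrA.
apply: (Lint_bddM mud ((2 ^+ n) `^ m) (fun x : V => \1_(jap_ball (2 ^+ n)) x * jap x `^ m)).
- by apply: measurable_funM; [apply: measurable_indic; exact: measurable_jap_le|exact: bmeas_jap_pow].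
- move=> x; rewrite ger0_norm; last by rewrite mulr_ge0// powR_ge0.
  rewrite indicE; case: (boolP (x \in _)) => hx; last by rewrite mul0r powR_ge0.
  rewrite [_%:R * _]mul1r; move: hx; rewrite inE /= => hx.
  by apply: ge0_ler_powR; rewrite ?nnegrE ?exprn_ge0//; have := jap_ge1 x; lra.
- exact: Lint_norm.
Qed.

(** Inside the ball of radius rho the norm is a pairing with a bounded, compactly supported function
    and [fourier_duality] applies. Outside, <x>^k <= rho^(k - m) <x>^m. *)
Lemma interpolation (f : V -> R) (k m Cm A rho la : R) : Lint mud f ->
  Lint mud (fun x => `|f x| * jap x `^ k) -> 0 <= k -> k < m ->
  Lint mud (fun xi => fourier_sq f xi) ->
  \int[mud]_xi (fourier_sq f xi) <= A ->
  (forall N, trunc_moment m f N <= Cm) ->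
  0 < rho -> 0 < la ->
  \int[mud]_x (`|f x| * jap (x : V) `^ k) <=
  (@ker_mass R d)^-1 * (1/2 * (la * A + la^-1 * (@ker_mass R d * (rho `^ (2 * k) * (2 * (2 * rho)) ^+ d)))) + rho `^ (k - m) * Cm.
Proof.
move=> fi fk k0 km f2 fA hC rho0 la0.
set X := _^-1 * _.
have c0 : 0 < @ker_mass R d by have [] := @ker_Lint R d.
have mf : Bmeas f := Lint_meas fi.
have j0 (x : V) : 0 <= jap x by have := jap_ge1 x; lra.
(* Pairing [f] with [g] gives exactly the weighted norm on the ball. The support lies in the open
   cube of half-side 2 rho, the factor 2 making the coordinate inequality strict; hence the volume
   (4 rho)^d. *)
pose g (x : V) : R := \1_(jap_ball rho) x * (Num.sg (f x) * jap x `^ k).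
have msg : Bmeas (fun x => Num.sg (f x)).
  rewrite /Num.sg; apply: measurable_fun_ifT => //; first exact: measurable_fun_eqr.
  by apply: measurable_fun_ifT => //; exact: measurable_fun_ltr.
have mg : Bmeas g.
  apply: measurable_funM; first by apply: measurable_indic; exact: measurable_jap_le.
  by apply: measurable_funM => //; exact: bmeas_jap_pow.
have gbox x : `|g x| <= rho `^ k * \1_(box (2 * rho)) x.
  rewrite /g indicE; case: (boolP (x \in _)) => hx; last first.
    by rewrite mul0r normr0 mulr_ge0 ?powR_ge0// indicE ler0n.
  rewrite [_%:R * _]mul1r normrM (ger0_norm (powR_ge0 _ _)).
  move: hx; rewrite inE /= => hx.
  rewrite indicE mem_set; last first.
    move=> i; apply: le_lt_trans (coord_le_jap x i) _; apply: le_lt_trans hx _; lra.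
  rewrite mulr1 -[leRHS]mul1r; apply: ler_pM => //; first exact: powR_ge0.
    by rewrite normr_sg lern1 leq_b1.
  by apply: ge0_ler_powR; rewrite ?nnegrE// ltW.
have rho2 : 0 <= 2 * rho by rewrite mulr_ge0// ltW.
have [bi bI] := @box_Lint R d (2 * rho) rho2.
have gi : Lint mud g by apply: Lint_le (LintZ (rho `^ k) bi).
have gb x : `|g x| <= rho `^ k.
  apply: le_trans (gbox x) _; rewrite ler_piMr ?powR_ge0// indicE lern1 leq_b1//.
have g2 : Lint mud (fun x => g x ^+ 2).
  apply: (@Lint_eq _ _ _ mud (fun x => g x * g x)) => //.
  by apply: (Lint_bddM mud (rho `^ k) g).
have G : \int[mud]_x (g x ^+ 2) <= rho `^ (2 * k) * (2 * (2 * rho)) ^+ d.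
  apply: (@le_trans _ _ (\int[mud]_x (rho `^ (2 * k) * \1_(box (2 * rho)) (x : V)))).
    apply: le_Rint => //; first exact: LintZ.
    move=> x; have h := gbox x.
    rewrite -real_normK ?num_real//.
    apply: (@le_trans _ _ ((rho `^ k * \1_(box (2 * rho)) x) ^+ 2)).
      by rewrite lerXn2r ?nnegrE// (le_trans _ h).
    rewrite exprMn (mulrC 2 k) powRrM powR_mulrn ?powR_ge0//.
    rewrite ler_wpM2l ?exprn_ge0 ?powR_ge0// indicE.
    by case: (_ \in _); rewrite ?expr1n ?expr0n.
  by rewrite RintegralZl// ler_wpM2l// powR_ge0.
have dual := fourier_duality fi f2 fA gi gb la0.
have fg : Lint mud (fun x => f x * g x).
  apply: (@Lint_eq _ _ _ mud (fun x => g x * f x)); first by move=> x; rewrite mulrC.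
  exact: (Lint_bddM mud (rho `^ k) g).
have main : \int[mud]_x (f x * g x) <= X.
  rewrite /X mulrC ler_pdivlMr// mulrC; apply: le_trans dual _.
  rewrite ler_wpM2l// lerD2l ler_wpM2l ?invr_ge0 ?(ltW la0)// ler_wpM2l ?(ltW c0)//.
(* The bound on moments concerns truncations, so the weighted norm is reached as a limit over
   growing balls. *)
pose F (n : nat) (x : V) : R := \1_(jap_ball (2 ^+ n)) x * (`|f x| * jap x `^ k).
have F01 (n : nat) (x : V) : 0 <= (\1_(jap_ball (2 ^+ n)) x : R) <= 1 by rewrite indicE ler0n lern1 leq_b1.
have Fi n : Lint mud (F n).
  apply: (Lint_bddM mud 1 (\1_(jap_ball (2 ^+ n)) : V -> R)) => //.
    by apply: measurable_indic; exact: measurable_jap_le.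
  by move=> x; have /andP[h1 h2] := F01 n x; rewrite ger0_norm.
have Hi n := @Lint_trunc_moment m f n (le_trans k0 (ltW km)) fi.
have Fb n : \int[mud]_x F n x <= X + rho `^ (k - m) * Cm.
  apply: (@le_trans _ _ (\int[mud]_x (f x * g x + rho `^ (k - m) * (\1_(jap_ball (2 ^+ n)) (x : V) * (jap (x : V) `^ m * `|f x|))))).
    apply: le_Rint => //; first by apply: LintD => //; exact: LintZ.
    move=> x; have /andP[h1 h2] := F01 n x; rewrite /F.
    have p0 : 0 <= `|f x| * jap x `^ k by rewrite mulr_ge0// powR_ge0.
    have [hr|hr] := leP (jap x) rho.
      have -> : f x * g x = `|f x| * jap x `^ k.
        by rewrite /g indicE mem_set// [_%:R * _]mul1r mulrA normrEsg (mulrC (f x)).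
      apply: (@le_trans _ _ (`|f x| * jap x `^ k)); first by rewrite ler_piMl.
      by rewrite lerDl mulr_ge0 ?powR_ge0// mulr_ge0// mulr_ge0// powR_ge0.
    have -> : g x = 0 by rewrite /g indicE memNset ?mul0r//=; apply/negP; rewrite -ltNge.
    rewrite mulr0 add0r [leRHS](_ : _ = \1_(jap_ball (2 ^+ n)) x * (`|f x| * (rho `^ (k - m) * jap x `^ m))); last by ring.
    apply: ler_wpM2l => //; apply: ler_wpM2l => //.
    have jp : 0 < jap x := lt_le_trans ltr01 (jap_ge1 x).
    rewrite (_ : jap x `^ k = jap x `^ (k - m) * jap x `^ m); last by rewrite -powRD ?subrK// (gt_eqF jp) implybT.
    apply: ler_wpM2r; first exact: powR_ge0.
    rewrite -(opprB m k) !powRN lef_pV2 ?posrE ?powR_gt0//.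
    by apply: ge0_ler_powR; rewrite ?nnegrE ?(ltW rho0)// ?subr_ge0 ltW.
  rewrite RintegralD//; last exact: LintZ.
  rewrite RintegralZl//; apply: lerD => //.
  by apply: ler_wpM2l; [exact: powR_ge0|exact: hC].
have Fc : \int[mud]_x F n x @[n --> \oo] --> \int[mud]_x (`|f x| * jap (x : V) `^ k).
  apply: (@Rdct _ _ _ mud F _ (fun x => `|f x| * jap x `^ k)) => //.
  - by move=> n; exact: Lint_meas (Fi n).
  - move=> n x; have /andP[h1 h2] := F01 n x.
    have p0 : 0 <= `|f x| * jap x `^ k by rewrite mulr_ge0// powR_ge0.
    rewrite /F ger0_norm; last exact: mulr_ge0 h1 p0.
    exact: ler_piMl p0 h2.
  - move=> x; apply: cvg_near_cst.
    exists (Num.truncn (jap x)).+1 => // n /= hn.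
    rewrite /F indicE mem_set ?mul1r//=.
    apply: (@le_trans _ _ n%:R).
      by apply: ltW; apply: lt_le_trans (truncnS_gt _) _; rewrite ler_nat.
    by rewrite -natrX ler_nat ltnW// ltn_expl.
rewrite -(cvg_lim _ Fc)//; apply: limr_le; first by apply/cvg_ex; eexists; exact: Fc.
by apply: nearW => n; exact: Fb.
Qed.

(** Put x = eps^dl |ln eps|. If x <= 1, then (1 + x)^th <= 2. Otherwise |ln eps| >= 1, hence |ln
    eps|^th <= |ln eps| and (2 x)^th <= 2 eps^(dl th) |ln eps|. *)
Lemma rate_power (s eps dl th : R) : s < 1 -> 0 < eps < 1 -> 0 < dl -> 0 < th <= 1 ->
  ((1 - s) * (1 + eps `^ dl * `|ln eps|)) `^ th <= 2 * ((1 - s) `^ th * (1 + eps `^ (dl * th) * `|ln eps|)).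
Proof.
move=> s1 /andP[e0 e1] d0 /andP[t0 t1].
have ed : 0 <= eps `^ dl <= 1.
  by rewrite powR_ge0 /= -[leRHS](powRr0 eps); apply: ger_powR; [rewrite e0 ltW|exact: ltW].
have /andP[ed0 ed1] := ed.
set L := `|ln eps|; have L0 : 0 <= L := normr_ge0 _.
set x := eps `^ dl * L; have x0 : 0 <= x by rewrite mulr_ge0.
have y0 : 0 <= eps `^ (dl * th) * L by rewrite mulr_ge0// powR_ge0.
rewrite powRM ?subr_ge0 ?(ltW s1)// ?addr_ge0// mulrCA; apply: ler_wpM2l; first exact: powR_ge0.
have [x1|x1] := leP x 1.
  apply: (@le_trans _ _ (1 + x)); last lra.
  by rewrite ler1_powR// lerDl.
have L1 : 1 <= L by rewrite /x in x1; nra.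
apply: (@le_trans _ _ ((2 * x) `^ th)).
  by apply: ge0_ler_powR; rewrite ?nnegrE; lra.
rewrite powRM// /x powRM// -powRrM.
apply: (@le_trans _ _ (2 * (eps `^ (dl * th) * L))); last lra.
apply: ler_pM; rewrite ?powR_ge0 ?mulr_ge0 ?powR_ge0// ?ler1_powR ?ler1n//.
by apply: ler_wpM2l; rewrite ?powR_ge0// ler1_powR.
Qed.

(** [la] equalizes the powers in the two terms of Young's inequality, la Q^2 and la^-1 rho^(2k + D),
    both becoming rho^(k + D/2) Q; [rho] then makes this equal to rho^(k - m), the tail. All three
    are Q^theta. *)
Lemma optimize (c A0 Cm q Q k m D : R) : 0 < c -> 0 < Q -> 0 <= k -> k < m -> 0 < D ->
  let rho := Q `^ (- (m + D / 2)^-1) in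
  let la := rho `^ (k + D / 2) / Q in
  forall P, P = q * rho `^ D ->
  c^-1 * (1/2 * (la * (A0 * Q ^+ 2) + la^-1 * (c * (rho `^ (2 * k) * P)))) + rho `^ (k - m) * Cm =
  (c^-1 * (1/2 * A0) + 1/2 * q + Cm) * Q `^ ((m - k) / (m + D / 2)).
Proof.
move=> c0 Q0 k0 km D0 rho la P ->.
set sg := m + D / 2; have sg0 : 0 < sg by rewrite /sg; lra.
have rho0 : 0 < rho by rewrite powR_gt0.
have E1 : rho `^ (k - m) = Q `^ ((m - k) / sg).
  by rewrite /rho -powRrM; congr (_ `^ _); rewrite -/sg; ring.
have E2 : rho `^ (k + D / 2) * Q = Q `^ ((m - k) / sg).
  rewrite /rho -powRrM -/sg -{2}(powRr1 (ltW Q0)) -powRD; last by rewrite (gt_eqF Q0) implybT.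
  by congr (_ `^ _); rewrite /sg; field; rewrite gt_eqF//; lra.
have r1 : 0 < rho `^ (k + D / 2) by rewrite powR_gt0.
have E3 : rho `^ (2 * k) * rho `^ D = (rho `^ (k + D / 2)) ^+ 2.
  rewrite -powR_mulrn ?powR_ge0// -powRrM -powRD; last by rewrite (gt_eqF rho0) implybT.
  by congr (_ `^ _); field.
rewrite (mulrCA _ q) E1 E3 -E2 /la; field.
by rewrite !gt_eqF.
Qed.

Lemma enorm_gt0 (x : V) : x != 0 -> 0 < enorm x.
Proof.
move=> x0; rewrite sqrtr_gt0 lt_neqAle dotp_ge0 andbT eq_sym; apply: contra x0 => /eqP h.
apply/eqP/rowP => i; rewrite mxE.
have := h; rewrite /dotp (bigD1 i)//= => /eqP; rewrite paddr_eq0 ?sumr_ge0//.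
- by move=> /andP[]; rewrite mulf_eq0 orbb => /eqP.
- by rewrite -expr2 sqr_ge0.
- by move=> j _; rewrite -expr2 sqr_ge0.
Qed.

Lemma enorm_sqr (x : V) : enorm x ^+ 2 = dotp x x.
Proof. by rewrite sqr_sqrtr// dotp_ge0. Qed.

(** A pointwise bound along characteristics is integrated by the substitution xi = e^t z, whose
    Jacobian is e^(d t). *)
Lemma fourier_L2_flow (f H : V -> R) (t : R) : Lint mud f -> Lint mud H ->
  (forall z, fourier_sq f (expR t *: z) <= H z) ->
  Lint mud (fun xi => fourier_sq f xi) /\
  \int[mud]_xi (fourier_sq f xi) <= expR t ^+ d * \int[mud]_z H z.
Proof.
move=> fi Hi hH; have [mr mi] := bmeas_fourier fi.
have e0 : expR (- t) != 0 by rewrite gt_eqF// expR_gt0.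
have [h3 h2] := Lint_scale e0 Hi.
have pw (xi : V) : fourier_sq f xi <= H (expR (- t) *: xi).
  by have := hH (expR (- t) *: xi); rewrite scalerA -expRD subrr expR0 scale1r.
have p0 (xi : V) : 0 <= fourier_sq f xi by rewrite addr_ge0 ?sqr_ge0.
have fi2 : Lint mud (fun xi => fourier_sq f xi).
  apply: Lint_le h3 => [|x]; last by rewrite ger0_norm.
  by apply: measurable_funD; apply: measurable_funX.
split => //.
apply: (@le_trans _ _ (\int[mud]_xi H (expR (- t) *: (xi : V)))); first exact: le_Rint.
by rewrite h2 gtr0_norm ?expR_gt0// expRN invrK.
Qed.

Lemma flow_weight (z : V) (tau T eta : R) : 0 <= tau <= T -> 0 <= eta ->
  (1 + enorm (expR tau *: z) ^+ 2) `^ (eta / 2) <= (expR (2 * T) * (1 + dotp z z)) `^ (eta / 2).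
Proof.
move=> /andP[t0 tT] e0; have d0 := dotp_ge0 z.
have e1 : 1 <= expR (2 * T) by rewrite -[leLHS]expR0 ler_expR; lra.
have e2 : expR tau ^+ 2 <= expR (2 * T) by rewrite expr2 -expRD ler_expR; lra.
apply: ge0_ler_powR; rewrite ?nnegrE ?divr_ge0 ?addr_ge0 ?sqr_ge0//.
  by rewrite mulr_ge0 ?expR_ge0// addr_ge0.
rewrite enorm_sqr dotpZl dotpZr mulrA -expr2 mulrDr mulr1.
by apply: lerD => //; exact: ler_wpM2r.
Qed.

End solutions.

(** * Choice of the constants and conclusion *)

Theorem theorem5p2 (R : realType) (d : nat)
    (J : R -> 'rV[R]_d -> R) (J1 : 'rV[R]_d -> R)
    (delta C0 c Rr cc : R) (Psi : 'rV[R]_d -> R)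
    (k m M eta : R) (u0 : 'rV[R]_d -> R) :
  (0 < d)%N ->
  H1 J delta C0 c Rr Psi ->
  H2 J J1 delta C0 cc ->
  0 <= k -> k < m -> m < M -> M <= 1 ->
  2 + delta < eta ->
  L1k M u0 -> in_H eta u0 ->
  let theta := (m - k) / (m + d%:R / 2) in
  forall Tstar : R, 0 < Tstar ->
  exists C : R,
    forall (s eps : R), 1/2 < s < 1 -> 0 < eps < 1 ->
    forall us u : R -> 'rV[R]_d -> R,
      mild_sol k (eps `^ (- (2 * s))) (resc eps (J s)) u0 us ->
      mild_sol k (eps `^ (-2)) (resc eps J1) u0 u ->
      forall t, 0 <= t <= Tstar ->
        L1k_norm k (fun x => us t x - u t x)
          <= C * (1 - s) `^ theta * (1 + eps `^ (delta * theta) * `|ln eps|).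
Proof.
move=> dpos HH1 HH2 k0 km mM M1 etad uM uH theta T T0.
case: HH1 => dl0 [C00 [_ [_ [HJ [_ [Hsym _]]]]]].
case: HH2 => pd1 [Hsym1 [cc0 Hdiff]].
have [J1i J10 J11] := prob_density_Lint pd1.
have m0 : 0 < m by lra.
have M0 : 0 <= M by lra.
have D0 : 0 < d%:R :> R by rewrite ltr0n.
have th01 : 0 < theta <= 1.
  have sg0 : 0 < m + d%:R / 2 by rewrite addr_gt0// divr_gt0.
  by rewrite divr_gt0 ?subr_gt0//= ler_pdivrMr// mul1r; lra.
(* The regularity in excess of 2 + delta, spent on the logarithms. *)
pose g := eta - 2 - delta; have g0 : 0 < g by rewrite /g; lra.
have eta0 : 0 <= eta by lra.
have gE : (2 + delta + g) / 2 = eta / 2 by rewrite /g; lra.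
pose B := 3 + 2 * C0; have B0 : 0 <= B by rewrite /B; lra.
have [mu0 u0M] := L1kE uM; have u0i := L1k_Lint M0 uM.
pose W0 (z : 'rV[R]_d) := (1 + dotp z z) `^ eta * (fourier_sq u0 z).
have W00 z : 0 <= W0 z by rewrite mulr_ge0 ?powR_ge0// addr_ge0 ?sqr_ge0.
have W0i : Lint (mu R d) W0.
  have [mr mi] := bmeas_fourier u0i.
  have mW : Bmeas W0.
    apply: measurable_funM; last by apply: measurable_funD; apply: measurable_funX.
    apply: (@measurableT_comp _ _ _ _ _ _ (@powR R ^~ eta)) => //.
    by apply: measurable_funD => //; apply: vmeas_dotp; exact: vmeas_id.
  apply/LintP; split => //; under eq_integral => x _ do rewrite ger0_norm//.
  by rewrite -iint_ge0E//; case: uH => _ [].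
pose A0 := \int[mu R d]_z W0 z.
have A00 : 0 <= A0 by apply: Rintegral_ge0.
pose Cm := moment_const u0 m M B T.
pose E := (cc + 2 * B) * (2 + g^-1).
have E0 : 0 <= E by rewrite mulr_ge0// addr_ge0 ?invr_ge0 ?mulr_ge0// ltW.
(* e T^2 and 2 come from [fourier_diff], E^2 from the symbol estimate, and the power of e^(2T) from
   comparing the Sobolev weight at e^tau z with that at z. *)
pose Cst := expR 1 * T ^+ 2 * (2 * (E ^+ 2 * expR (2 * T) `^ eta)).
have Cst0 : 0 <= Cst.
  have e1 := expR_ge0 (1 : R); have e2 := sqr_ge0 T; have e3 := sqr_ge0 E.
  have e4 := powR_ge0 (expR (2 * T)) eta.
  exact: mulr_ge0 (mulr_ge0 e1 e2) (mulr_ge0 (ler0n _ 2) (mulr_ge0 e3 e4)).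
pose A1 := expR T ^+ d * (Cst * A0).
have c0 : 0 < @ker_mass R d by have [] := @ker_Lint R d.
(* The outer 2 is that of [rate_power], 4^d comes from the volume (4 rho)^d, and 2 Cm adds the
   moments of the two solutions. *)
exists (2 * ((@ker_mass R d)^-1 * (1/2 * A1) + 1/2 * 4 ^+ d + 2 * Cm)).
move=> s eps hs he us u Ms M1s t ht; have /andP[s1 s2] := hs; have /andP[e0 e1] := he.
have /andP[t0 tT] := ht.
have s0 : 0 < 1 - s by rewrite subr_gt0.
have q1 : 1 <= 2 * s by rewrite mulrC -ler_pdivrMr// ltW.
have [Jsi Js0 Js1] := prob_density_Lint (HJ s hs).1.
have ep (p : R) : 0 < eps `^ p by exact: powR_gt0.
have [Ksi Ks1] := Lint_resc e0 Jsi; have [K1i K11] := Lint_resc e0 J1i.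
rewrite Js1 in Ks1; rewrite J11 in K11.
have Ks0 x : 0 <= resc eps (J s) x by rewrite mulr_ge0// ltW.
have K10 x : 0 <= resc eps J1 x by rewrite mulr_ge0// ltW.
have bs : forall xi, `|1 - fourier_re (J s) xi| + `|fourier_im (J s) xi| <= B * enorm xi `^ (2 * s).
  by apply: (@symbol_bound _ _ (J s) (2 * s) delta C0) => //; [exact: lt_le_trans q1|exact: Hsym].
have b1 : forall xi, `|1 - fourier_re J1 xi| + `|fourier_im J1 xi| <= B * enorm xi `^ 2.
  apply: (@symbol_bound _ _ J1 2 delta C0) => // xi x1.
  by rewrite powR_mulrn ?enorm_ge0//; exact: Hsym1.
have Ws := mild_weak k0 Ms (ltW (ep _)) Ksi Ks0 u0i.
have W1 := mild_weak k0 M1s (ltW (ep _)) K1i K10 u0i.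
have maxt : Num.max t 0 = t by rewrite max_l.
pose f (x : 'rV[R]_d) := us t x - u t x.
have fsi : Lint (mu R d) (us t) by have := ws_v Ws t; rewrite maxt.
have f1i : Lint (mu R d) (u t) by have := ws_v W1 t; rewrite maxt.
have fi : Lint (mu R d) f by exact: LintB.
have fk : Lint (mu R d) (fun x => `|f x| * jap x `^ k) by apply: L1kB; [exact: Ms.1|exact: M1s.1].
pose L := 1 + eps `^ delta * `|ln eps|.
have L0 : 0 < L by rewrite ltr_pwDl// mulr_ge0// ltW.
pose Q := (1 - s) * L; have Q0 : 0 < Q by rewrite mulr_gt0.
pose b (z : 'rV[R]_d) := Q * E * (expR (2 * T) * (1 + dotp z z)) `^ (eta / 2).
have b0 z : 0 <= b z by rewrite mulr_ge0 ?powR_ge0// mulr_ge0// ltW.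
have hb z tau : 0 <= tau <= T ->
    `|eps `^ (- (2 * s)) * (1 - fourier_re (resc eps (J s)) (expR tau *: z)) -
      eps `^ (- 2) * (1 - fourier_re (resc eps J1) (expR tau *: z))| <= b z /\
    `|eps `^ (- (2 * s)) * (- fourier_im (resc eps (J s)) (expR tau *: z)) -
      eps `^ (- 2) * (- fourier_im (resc eps J1) (expR tau *: z))| <= b z.
  move=> /andP[tau0 tauT]; set xi := expR tau *: z.
  (* (H2) is stated for nonzero frequencies; at 0 both symbols vanish because the kernels have mass
     1. *)
  have [xi0|xi0] := eqVneq xi 0.
    rewrite xi0; have [-> ->] := fourier0 Ksi Ks1; have [-> ->] := fourier0 K1i K11.
    by rewrite !subrr oppr0 !mulr0 subrr normr0.
  have r0 := enorm_gt0 xi0.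
  have exi0 : eps *: xi != 0 by rewrite scaler_eq0 negb_or xi0 gt_eqF.
  have [-> ->] := fourier_resc xi e0 Jsi; have [-> ->] := fourier_resc xi e0 J1i.
  have hd := Hdiff s hs _ exi0; rewrite (enormZ _ (ltW e0)) in hd.
  have c1 := le_trans (cmod_ge _ _).1 hd; have c2 := le_trans (cmod_ge _ _).2 hd.
  have bb := b1 (eps *: xi); rewrite powR_mulrn ?enorm_ge0// in bb.
  have n1 := normr_ge0 (1 - fourier_re J1 (eps *: xi)); have n2 := normr_ge0 (fourier_im J1 (eps *: xi)).
  have bJ : Q * E * (1 + enorm xi ^+ 2) `^ (eta / 2) <= b z.
    apply: ler_wpM2l; first by rewrite mulr_ge0// ltW.
    by apply: flow_weight eta0; rewrite tau0.
  rewrite (enormZ _ (ltW e0)) in bb.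
  have cc0' := ltW cc0.
  have key f0 f1 : `|f0 / (eps * enorm xi) `^ (2 * s) - f1 / (eps * enorm xi) ^+ 2| <=
      cc * (1 - s) * (eps * enorm xi) `^ delta * Num.max 1 `|ln (eps * enorm xi)| ->
      `|f1| <= B * (eps * enorm xi) ^+ 2 -> `|eps `^ (- (2 * s)) * f0 - eps `^ (- 2) * f1| <= b z.
    move=> h1 h2; have := symbol_diff he r0 hs dl0 g0 cc0' B0 h1 h2.
    by rewrite gE -/E -/L -/Q => /le_trans; apply.
  split; apply: key.
  - exact: c1.
  - by apply: le_trans bb; rewrite lerDl.
  - exact: c2.
  - by apply: le_trans bb; rewrite normrN lerDr.
have pw (z : 'rV[R]_d) : fourier_sq f (expR t *: z) <= Cst * Q ^+ 2 * W0 z.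
  have := fourier_diff Ws W1 Ks1 K11 T0 (hb z) ht; rewrite maxt.
  have [-> ->] := fourierB (expR t *: z) fsi f1i.
  move=> /le_trans; apply; apply: le_of_eq.
  have bE : b z ^+ 2 = Q ^+ 2 * E ^+ 2 * (expR (2 * T) `^ eta * (1 + dotp z z) `^ eta).
    rewrite /b exprMn exprMn; congr (_ * _).
    rewrite -powRM ?expR_ge0 ?addr_ge0 ?dotp_ge0// -powR_mulrn ?powR_ge0// -powRrM.
    by congr (_ `^ _); field.
  by rewrite bE /Cst /W0; ring.
have [f2 fA] := fourier_L2_flow fi (LintZ (Cst * Q ^+ 2) W0i) pw.
have {}fA : \int[mu R d]_xi (fourier_sq f xi) <= A1 * Q ^+ 2.
  apply: (le_trans fA); rewrite RintegralZl// -/A0 /A1.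
  rewrite (_ : expR T ^+ d * (Cst * A0) * Q ^+ 2 = expR T ^+ d * (Cst * Q ^+ 2 * A0)); last by ring.
  apply: ler_wpM2r; first exact: mulr_ge0 (mulr_ge0 Cst0 (sqr_ge0 Q)) A00.
  by apply: lerXn2r; rewrite ?nnegrE ?expR_ge0// ler_expR.
(* [moment_bound] is used with p = 2s and p = 2, both at least 1, and with the same [B], hence the
   same constant. *)
have hC N : trunc_moment m f N <= 2 * Cm.
  have q2 : 1 <= 2 :> R by rewrite ler1n.
  have := moment_bound Ws Ks1 (ep _) q1 B0 (resc_symbol_bound Jsi e0 bs) (ltW m0) mM M1 u0M ht N.
  have := moment_bound W1 K11 (ep _) q2 B0 (resc_symbol_bound J1i e0 b1) (ltW m0) mM M1 u0M ht N.
  rewrite maxt -/Cm => h1 h2.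
  have is_ := Lint_trunc_moment N (ltW m0) fsi; have i1 := Lint_trunc_moment N (ltW m0) f1i.
  apply: (@le_trans _ _ (trunc_moment m (us t) N + trunc_moment m (u t) N)).
    rewrite /trunc_moment -RintegralD//.
    apply: le_Rint; [exact: Lint_trunc_moment (ltW m0) fi|exact: LintD|move=> x].
    rewrite -mulrDr -mulrDr; apply: ler_wpM2l; first by rewrite indicE ler0n.
    by apply: ler_wpM2l; [exact: powR_ge0|exact: ler_normB].
  by rewrite (_ : 2 * Cm = Cm + Cm) ?lerD//; ring.
pose rho := Q `^ (- (m + d%:R / 2)^-1); pose la := rho `^ (k + d%:R / 2) / Q.
have rho0 : 0 < rho by rewrite powR_gt0.
have la0 : 0 < la by rewrite divr_gt0// powR_gt0.
have main := interpolation fi fk k0 km f2 fA hC rho0 la0.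
rewrite L1k_normE; last exact: Lint_meas fi.
apply: (le_trans main).
rewrite (optimize A1 (2 * Cm) (q := 4 ^+ d) c0 Q0 k0 km D0); last first.
  rewrite powR_mulrn ?(ltW rho0)// -exprMn; congr (_ ^+ _); rewrite /rho; ring.
have rp := rate_power s2 he dl0 th01; rewrite -/theta -/L -/Q.
have C0' : 0 <= (@ker_mass R d)^-1 * (1/2 * A1) + 1/2 * 4 ^+ d + 2 * Cm.
  have A10 : 0 <= A1 := mulr_ge0 (exprn_ge0 d (expR_ge0 T)) (mulr_ge0 Cst0 A00).
  (* Read off from the bound itself: it dominates a nonnegative moment. *)
  have Cm0 : 0 <= 2 * Cm.
    apply: le_trans (hC 0%N); apply: Rintegral_ge0 => x _.
    by rewrite mulr_ge0 ?mulr_ge0 ?powR_ge0// indicE ler0n.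
  apply: addr_ge0 => //; apply: addr_ge0; last by rewrite mulr_ge0// exprn_ge0.
  by apply: mulr_ge0; [rewrite invr_ge0 ltW|apply: mulr_ge0].
apply: le_trans (ler_wpM2l C0' rp) _.
by apply: le_of_eq; ring.
Qed.
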